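(* Let $m$ be an integer with $5\le m\le 12$, let $B^m\subset\mathbb{R}^m$ be the unit ball, and let $u=(u_{ij})_{1\le i,j\le m}\colon B^m\to\mathbb{S}^{m^2-1}\subset\mathbb{R}^{m^2}$ be the map $$u_{ij}(x)=\frac{1}{\sqrt{m(m-1)}}\Big(-\delta_{ij}+m\frac{x_ix_j}{r^2}\Big),\qquad r=|x|.$$ Let $\alpha\in(0,\frac{\pi}{2})$ be determined by $\sin^2\alpha=1-\frac{2}{m}$. Then the proper weak biharmonic map $$\tilde u\colon B^m\to\mathbb{S}^{m^2}\subset\mathbb{R}^{m^2}\times\mathbb{R},\qquad x\mapsto\big(\sin\alpha\;u(x),\cos\alpha\big)$$ is an unstable critical point of the bienergy $E_2$.
   Context: Maps are defined almost everywhere (here, for $x\neq0$); $\delta_{ij}$ is the Kronecker delta, $r=\sqrt{x_1^2+\dots+x_m^2}$, and $\Delta$ is the Euclidean Laplacian, acting componentwise; $|\nabla w|^2=\sum_k|\partial_kw|^2$. $W^{2,2}(B^m,\mathbb{S}^n)$ is the set of $w\in W^{2,2}(B^m,\mathbb{R}^{n+1})$ with $w(x)\in\mathbb{S}^n$ for a.e. $x$. The bienergy of $w\in W^{2,2}(B^m,\mathbb{S}^n)$ is $$E_2(w)=\frac12\int_{B^m}\big(|\Delta w|^2-|\nabla w|^4\big)\,dx,$$ and weak biharmonic maps are its critical points (distributional solutions in $W^{2,2}(B^m,\mathbb{S}^n)$ of its Euler–Lagrange equation); proper means not harmonic. A weak biharmonic map $w$ is unstable if there is a variation $(w_s)_{s\in(-\varepsilon,\varepsilon)}$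 in $W^{2,2}(B^m,\mathbb{S}^n)$, depending smoothly on $s$, with $w_0=w$ and with the same boundary data as $w$, i.e. $(w_s-w)|_{\partial B^m}=0$ and $\nabla(w_s-w)|_{\partial B^m}=0$ in the sense of traces, such that $$\frac{d^2}{ds^2}\Big|_{s=0}E_2(w_s)<0.$$ *)

(* Defs.v *)
From HB Require Import structures.
From mathcomp Require Import all_boot all_order all_algebra.
From mathcomp Require Import all_classical all_reals all_analysis.

Set Implicit Arguments.
Unset Strict Implicit.
Unset Printing Implicit Defensive.
Import Order.TTheory GRing.Theory Num.Theory.
Import numFieldNormedType.Exports.
Local Open Scope classical_set_scope.
Local Open Scope ring_scope.

Section rV_measurable.
Context {R : realType} {n : nat}.

Definition rV_coord (i : 'I_n) (x : 'rV[R]_n) : measurableTypeR R := x ord0 i.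

Let rV_set0 : g_sigma_preimage rV_coord set0.
Proof. exact: sigma_algebra0. Qed.

Let rV_setC A : g_sigma_preimage rV_coord A ->
  g_sigma_preimage rV_coord (~` A).
Proof. exact: sigma_algebraC. Qed.

Let rV_bigcup (F : _^nat) : (forall i, g_sigma_preimage rV_coord (F i)) ->
  g_sigma_preimage rV_coord (\bigcup_i (F i)).
Proof. exact: sigma_algebra_bigcup. Qed.

HB.instance Definition _ :=
  @isMeasurable.Build (measure_tuple_display default_measure_display)
  'rV[R]_n (g_sigma_preimage rV_coord) rV_set0 rV_setC rV_bigcup.

Lemma measurable_rV_coord (i : 'I_n) :
  measurable_fun [set: 'rV[R]_n] (rV_coord i).
Proof.
move=> _ Y mY; rewrite setTI; apply: sub_sigma_algebra => /=.
rewrite -bigcup_seq/=; exists i => /=; first by rewrite mem_index_enum.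
by exists Y => //; rewrite setTI.
Qed.

Lemma measurable_fun_rVP d (T : measurableType d) (f : T -> 'rV[R]_n) :
  (forall i, measurable_fun [set: T] (rV_coord i \o f)) ->
  measurable_fun [set: T] f.
Proof.
move=> mf; suff : g_sigma_preimage (fun i => rV_coord i \o f) `<=` measurable.
  rewrite g_sigma_preimage_comp => prefS.
  by move=> _ A mA; apply: prefS; exists A.
apply: smallest_sub; first exact: sigma_algebra_measurable.
rewrite -bigcup_seq; apply: bigcup_sub => i _ A [B mB <-].
exact: mf.
Qed.

End rV_measurable.

Section cons_measure.
Context {R : realType} {n : nat}.
Local Open Scope ereal_scope.

Definition rV_cons (p : measurableTypeR R * 'rV[R]_n) : 'rV[R]_n.+1 :=
  row_mx (const_mx p.1 : 'rV_1) p.2.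

Let rV_uncons (x : 'rV[R]_n.+1) : measurableTypeR R * 'rV[R]_n :=
  (x ord0 ord0, \row_j x ord0 (lift ord0 j)).

Let rV_cons0 p : rV_cons p ord0 ord0 = p.1.
Proof. by rewrite mxE; case: splitP => // j _; rewrite mxE. Qed.

Let rV_consS p j : rV_cons p ord0 (lift ord0 j) = p.2 ord0 j.
Proof.
rewrite mxE; case: splitP => [[[|//] ?]//|k].
by rewrite lift0 => -[] /val_inj ->.
Qed.

Let rV_consK : cancel rV_cons rV_uncons.
Proof.
move=> [t x]; rewrite /rV_uncons rV_cons0; congr pair.
by apply/rowP => j; rewrite mxE rV_consS.
Qed.

Lemma measurable_rV_cons : measurable_fun setT rV_cons.
Proof.
apply: measurable_fun_rVP => i.
have [j ->|->] := unliftP ord0 i.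
- rewrite (_ : _ \o _ = rV_coord j \o snd).
    by apply: measurableT_comp => //; exact: measurable_rV_coord.
  by apply/funext => p /=; rewrite /rV_coord rV_consS.
- rewrite (_ : _ \o _ = fst)//.
  by apply/funext => p /=; rewrite /rV_coord rV_cons0.
Qed.

Let measurable_rV_uncons : measurable_fun setT rV_uncons.
Proof.
apply/measurable_fun_pairP; split.
  exact: (measurable_rV_coord ord0).
apply: measurable_fun_rVP => i.
rewrite (_ : _ \o _ = rV_coord (lift ord0 i)); first exact: measurable_rV_coord.
by apply/funext => x /=; rewrite /rV_coord mxE.
Qed.

Variable mu : {sigma_finite_measure set 'rV[R]_n -> \bar R}.

Definition cons_measure : set 'rV[R]_n.+1 -> \bar R :=
  pushforward (@lebesgue_measure R \x mu) rV_cons.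

Let mu1 : {measure set (measurableTypeR R * 'rV[R]_n) -> \bar R} :=
  @lebesgue_measure R \x mu.

Let cons_measure0 : cons_measure set0 = 0.
Proof. by rewrite /cons_measure /pushforward preimage_set0 (measure0 mu1). Qed.

Let cons_measure_ge0 A : 0 <= cons_measure A.
Proof. exact: (measure_ge0 mu1). Qed.

Let cons_measure_sigma_additive : semi_sigma_additive cons_measure.
Proof.
move=> F mF tF mUF; rewrite /cons_measure /pushforward preimage_bigcup.
apply: (@measure_semi_sigma_additive _ _ _ mu1).
- by move=> n0; rewrite -[X in measurable X]setTI; exact: measurable_rV_cons.
- apply/trivIsetP => /= i j _ _ ij; rewrite -preimage_setI.
  by move/trivIsetP : tF => /(_ _ _ _ _ ij) ->//; rewrite preimage_set0.
- rewrite -preimage_bigcup -[X in measurable X]setTI.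
  exact: measurable_rV_cons.
Qed.

HB.instance Definition _ := isMeasure.Build _ _ _ cons_measure
  cons_measure0 cons_measure_ge0 cons_measure_sigma_additive.

Let cons_measure_sigma_finite : sigma_finite setT cons_measure.
Proof.
have /sigma_finiteP[F [TF ndF Foo]] := sigma_finiteT (@lebesgue_measure R).
have /sigma_finiteP[G [TG ndG Goo]] := sigma_finiteT mu.
exists (fun k => rV_uncons @^-1` (F k `*` G k)).
  rewrite -preimage_bigcup (_ : \bigcup_k _ = setT) ?preimage_setT//.
  rewrite -setXTT TF TG predeqE => -[x y]; split.
    by move=> [k _ []/= ? ?]; split; exists k.
  move=> [/= [k _ Fkx] [l _ Gly]]; exists (maxn k l) => //; split.
  - by move: x Fkx; exact/subsetPset/ndF/leq_maxl.
  - by move: y Gly; exact/subsetPset/ndG/leq_maxr.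
move=> k; have [mF Fk] := Foo k; have [mG Gk] := Goo k; split.
  rewrite -[X in measurable X]setTI.
  by apply: measurable_rV_uncons => //; exact: measurableX.
rewrite /cons_measure /pushforward (_ : _ @^-1` _ = F k `*` G k).
  by rewrite product_measure1E// lte_mul_pinfty// ge0_fin_numE.
by rewrite -comp_preimage (_ : _ \o _ = id)//; exact/funext/rV_consK.
Qed.

HB.instance Definition _ := Measure_isSigmaFinite.Build _ _ _ cons_measure
  cons_measure_sigma_finite.

Lemma cons_measure_box (A : 'I_n.+1 -> set (measurableTypeR R)) :
  (forall i, measurable (A i)) ->
  cons_measure [set x | forall i, A i (x ord0 i)] =
  lebesgue_measure (A ord0) *
  mu [set x | forall i, A (lift ord0 i) (x ord0 i)].
Proof.
move=> mA.
have mAS : measurable [set x : 'rV[R]_n | forall i, A (lift ord0 i) (x ord0 i)].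
  rewrite (_ : [set _ | _] = \bigcap_(i in [set: 'I_n])
      (rV_coord i @^-1` A (lift ord0 i))); last first.
    by apply/seteqP; split=> x /= Ax i; [move=> _; exact: (Ax i)|exact: (Ax i I)].
  apply: fin_bigcap_measurable; first exact: finite_finset.
  move=> i _; rewrite -[X in measurable X]setTI.
  exact: measurable_rV_coord.
rewrite -product_measure1E// /cons_measure /pushforward.
rewrite (_ : rV_cons @^-1` _ =
  A ord0 `*` [set x : 'rV[R]_n | forall i, A (lift ord0 i) (x ord0 i)])//.
apply/seteqP; split => [p /= Ap|p /= [A0 AS] i].
- split; first by rewrite -(rV_cons0 p).
  by move=> i; rewrite -rV_consS.
- have [j ->|->] := unliftP ord0 i; first by rewrite rV_consS; exact: AS.
  by rewrite rV_cons0.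
Qed.

End cons_measure.

Fixpoint lebesgue_rV {R : realType} n :
    {sigma_finite_measure set 'rV[R]_n -> \bar R} :=
  match n with
  | 0%N => @dirac _ 'rV[R]_0 (0 : 'rV[R]_0) R
  | n'.+1 => cons_measure (lebesgue_rV n')
  end.

Lemma lebesgue_rV_box {R : realType} n (A : 'I_n -> set (measurableTypeR R)) :
  (forall i, measurable (A i)) ->
  lebesgue_rV n [set x | forall i, A i (x ord0 i)] =
  (\prod_(i < n) lebesgue_measure (A i))%E.
Proof.
elim: n A => [|n IH] A mA.
  by rewrite big_ord0 /= diracE mem_set// => -[].
rewrite big_ord_recl /= cons_measure_box//; congr (_ * _)%E.
by apply: (IH (fun i => A (lift ord0 i))) => i; exact: mA.
Qed.

Section sobolev.
Context {R : realType} {m : nat}.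
Implicit Types (f g phi : 'rV[R]_m -> R) (i : 'I_m).

(* The library norm on 'rV[R]_n is the maximum norm. *)
Definition enorm {n} (x : 'rV[R]_n) : R := Num.sqrt (\sum_i x ord0 i ^+ 2).

Definition uball : set 'rV[R]_m := [set x | enorm x < 1].

Definition partial i f : 'rV[R]_m -> R := fun x => 'D_(delta_mx ord0 i) f x.

(* C^oo: all iterated partial derivatives are Frechet differentiable. *)
Definition smooth f := forall (s : seq 'I_m) x,
  differentiable (foldr partial f s) x.

Definition test_function phi :=
  [/\ smooth phi, compact (closure [set x | phi x != 0]) &
      closure [set x | phi x != 0] `<=` uball].

Definition L1loc f := measurable_fun uball f /\
  forall K, compact K -> K `<=` uball ->
    (lebesgue_rV m).-integrable K (EFin \o f).

Definition L2 f := measurable_fun uball f /\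
  (lebesgue_rV m).-integrable uball (fun x => (f x ^+ 2)%:E).

Definition is_wpartial i f g := [/\ L1loc f, L1loc g &
  forall phi, test_function phi ->
    \int[lebesgue_rV m]_(x in uball) (f x * partial i phi x) =
    - \int[lebesgue_rV m]_(x in uball) (g x * phi x)].

(* A representative of the weak derivative, unique up to a null set of the
   ball, and 0 if f has no weak derivative. *)
Definition wpartial i f : 'rV[R]_m -> R := xget (cst 0) (is_wpartial i f).

(* The Sobolev space W^{k,2} of the unit ball. *)
Fixpoint sobolev k f : Prop :=
  if k is k'.+1 then
    L2 f /\ forall i, exists2 g, is_wpartial i f g & sobolev k' g
  else L2 f.

(* Square of a W^{k,2} norm; mixed derivatives are counted once for each
   ordering. *)
Fixpoint sobolev_norm2 k f : \bar R :=
  (\int[lebesgue_rV m]_(x in uball) (f x ^+ 2)%:E +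
   (if k is k'.+1 then \sum_(i < m) sobolev_norm2 k' (wpartial i f) else 0))%E.

Definition wlaplacian f : 'rV[R]_m -> R :=
  fun x => \sum_(i < m) wpartial i (wpartial i f) x.

(* Integral over the unit sphere, in polar coordinates: the integral over the
   ball of the 0-homogeneous extension of g is 1/m times that of g. *)
Definition sphere_integral (g : 'rV[R]_m -> R) : \bar R :=
  (m%:R%:E * \int[lebesgue_rV m]_(x in uball) (g ((enorm x)^-1 *: x))%:E)%E.

(* g is the trace of f in W^{1,2}: the trace operator is the continuous
   extension to W^{1,2}, with values in L^2 of the sphere, of the restriction
   of functions smooth up to the boundary. *)
Definition is_trace f g :=
  [/\ sobolev 1 f,
      measurable_fun uball (fun x => g ((enorm x)^-1 *: x)) &
      exists F : nat -> 'rV[R]_m -> R, [/\ forall k, smooth (F k),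
        sobolev_norm2 1 (F k \- f) @[k --> \oo] --> 0%E &
        sphere_integral (fun x => (F k x - g x) ^+ 2) @[k --> \oo] --> 0%E]].

End sobolev.

Section bienergy.
Context {R : realType} {m : nat}.

Definition component {q} (w : 'rV[R]_m -> 'rV[R]_q) (a : 'I_q) :
  'rV[R]_m -> R := fun x => w x ord0 a.

Definition usphere n : set 'rV[R]_(n + 1) := [set y | enorm y = 1].

Definition sobolev_sphere k n (w : 'rV[R]_m -> 'rV[R]_(n + 1)) :=
  (forall a, sobolev k (component w a)) /\
  {ae lebesgue_rV m, forall x, uball x -> usphere (w x)}.

(* Pointwise inner product of the weak gradients, summed over components. *)
Definition wgrad_dot {q} (v w : 'rV[R]_m -> 'rV[R]_q) : 'rV[R]_m -> R :=
  fun x => \sum_(a < q) \sum_(i < m)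
    wpartial i (component v a) x * wpartial i (component w a) x.

Definition wlap_dot {q} (v w : 'rV[R]_m -> 'rV[R]_q) : 'rV[R]_m -> R :=
  fun x => \sum_(a < q)
    wlaplacian (component v a) x * wlaplacian (component w a) x.

(* The integrand is integrable for w in W^{2,2}(B, S^n): since |w| = 1, the
   identity <w, Delta w> = - |nabla w|^2 bounds |nabla w|^4 by
   |Delta w|^2. *)
Definition bienergy {q} (w : 'rV[R]_m -> 'rV[R]_q) : R :=
  2^-1 * \int[lebesgue_rV m]_(x in uball)
    (wlap_dot w w x - wgrad_dot w w x ^+ 2).

Definition tangential {q} (w phi : 'rV[R]_m -> 'rV[R]_q) :
    'rV[R]_m -> 'rV[R]_q :=
  fun x => phi x - (\sum_(a < q) w x ord0 a * phi x ord0 a) *: w x.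

(* The Euler-Lagrange equation of the bienergy says that the tangential part
   along w of Delta^2 w + 2 div(|nabla w|^2 nabla w) vanishes.  In the sense of
   distributions it is tested against the tangential parts
   psi = phi - <w, phi> w of compactly supported smooth phi, with all
   derivatives of order larger than 2 moved onto psi; the left-hand side is
   the derivative at s = 0 of the bienergy along (w + s phi) / |w + s phi|.
   The integral is extended-real-valued, so that a divergent one is not 0. *)
Definition weak_biharmonic n (w : 'rV[R]_m -> 'rV[R]_(n + 1)) :=
  sobolev_sphere 2 w /\
  forall phi : 'rV[R]_m -> 'rV[R]_(n + 1),
    (forall a, test_function (component phi a)) ->
    (\int[lebesgue_rV m]_(x in uball)
      (wlap_dot w (tangential w phi) x
       - 2 * wgrad_dot w w x * wgrad_dot w (tangential w phi) x)%:E = 0)%E.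

(* Weak form of the harmonic map equation Delta w + |nabla w|^2 w = 0. *)
Definition weak_harmonic n (w : 'rV[R]_m -> 'rV[R]_(n + 1)) :=
  sobolev_sphere 1 w /\
  forall phi : 'rV[R]_m -> 'rV[R]_(n + 1),
    (forall a, test_function (component phi a)) ->
    (\int[lebesgue_rV m]_(x in uball)
      (wgrad_dot w phi x
       - wgrad_dot w w x * \sum_a w x ord0 a * phi x ord0 a)%:E = 0)%E.

Definition proper_weak_biharmonic n (w : 'rV[R]_m -> 'rV[R]_(n + 1)) :=
  weak_biharmonic w /\ ~ weak_harmonic w.

Definition same_boundary_data {q} (v w : 'rV[R]_m -> 'rV[R]_q) :=
  forall a, is_trace (component v a \- component w a) (cst 0) /\
    forall i, is_trace (wpartial i (component v a \- component w a)) (cst 0).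

(* s |-> W s is a C^oo curve from ]-eps, eps[ to W^{2,2}; D k is its k-th
   derivative. *)
Definition smooth_curve {q} (eps : R) (W : R -> 'rV[R]_m -> 'rV[R]_q) :=
  exists2 D : nat -> R -> 'rV[R]_m -> 'rV[R]_q, D 0%N = W &
    forall k s a, `|s| < eps -> sobolev 2 (component (D k s) a) /\
      sobolev_norm2 2 (component
        (fun x => h^-1 *: (D k (s + h) x - D k s x) - D k.+1 s x) a)
        @[h --> 0^'] --> 0%E.

Definition unstable n (w : 'rV[R]_m -> 'rV[R]_(n + 1)) :=
  exists (eps : R) (W : R -> 'rV[R]_m -> 'rV[R]_(n + 1)),
    let E := fun s : R => bienergy (W s) in
    [/\ 0 < eps,
        forall s, `|s| < eps ->
          sobolev_sphere 2 (W s) /\ same_boundary_data (W s) w,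
        smooth_curve eps W,
        W 0 = w &
        [/\ \forall s \near 0, derivable E s 1,
            derivable (derive1 E) 0 1 &
            derive1n 2 E 0 < 0]].

End bienergy.

Section maps.
Context {R : realType} (m : nat).

Definition umap (x : 'rV[R]_m) : 'M[R]_m := \matrix_(i, j)
  ((Num.sqrt (m%:R * (m%:R - 1)))^-1 *
   (- (i == j)%:R + m%:R * (x ord0 i * x ord0 j / enorm x ^+ 2))).

Definition utilde (alpha : R) (x : 'rV[R]_m) : 'rV[R]_(m * m + 1) :=
  row_mx (sin alpha *: mxvec (umap x)) (const_mx (cos alpha)).

End maps.

(* Main.v *)
(* The map and all the functions built from it are smooth away from 0, with
   derivatives of order j bounded by a multiple of r^(-p-j).  For m >= 5 and
   total order at most 4 these are integrable, and the origin is removable for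
   integration by parts: cutoffs at scale e cost O(e^(-4)) on a ball of volume
   O(e^m).  Hence weak derivatives are the classical ones.  With
   Delta u = - 2m r^(-2) u, the biharmonic equation reduces to
   m sin^2 alpha = m - 2.

   For radial b, completing the square gives
     E_2(sin b u, cos b) = 1/2 int_B (Delta b - (m / r^2) sin (2 b))^2.
   Along b = alpha + s eta with eta = (1 - r^2)^8, the second derivative at
   s = 0 is
     int_B (Delta eta + 2 (m - 4) r^(-2) eta)^2 - 32 (m - 2) r^(-4) eta^2.
   Subtracting the divergence of r^(-4) S(r^2) x, for a suitable polynomial S
   vanishing at the boundary, reduces it to a negative multiple of
   int_B r^(-4) eta^2; the sign is where m <= 12 is used. *)

Require Import Defs.
From mathcomp Require Import all_boot all_order all_algebra.
From mathcomp Require Import all_classical all_reals all_analysis.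
From mathcomp Require Import measurable_realfun ring lra.

Set Implicit Arguments.
Unset Strict Implicit.
Unset Printing Implicit Defensive.
Import Order.TTheory GRing.Theory Num.Theory.
Import numFieldNormedType.Exports.
Local Open Scope classical_set_scope.
Local Open Scope ring_scope.

(** Bookkeeping is done in one scale of symbol classes: [Nice n p f] bounds the derivatives of order
    j <= n by M r^(-p-j) on the punctured closed ball. Products add the orders p, a derivative
    raises p by 1, and everything up to p = 4 is integrable, so integrability becomes arithmetic on
    exponents. The constant stays visible in [nice], because convergence of difference quotients in
    s and of trace approximants rests on constants that are uniform or tend to 0. Weak derivatives
    are picked by choice and known only almost everywhere, so the fundamental lemma of the calculus
    of variations has to precede any computation. Integrals of derivatives vanish by translation
    invariance: difference quotients have integral 0 and are dominated. Since eta is a polynomial in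
    r^2, the second variation is r^(-4) times a polynomial in y = 1 - r^2. The divergence of r^(-4)
    y^k x is r^(-4) times a combination of y^k and y^(k-1), so all monomials can be pushed into
    y^16, and the sign becomes rational arithmetic in m. *)

(** * Borel structure, translation invariance and null sets of R^n *)

Section rV_borel.
Context {R : realType} {n : nat}.
Implicit Types (a b : 'I_n -> R) (x : 'rV[R]_n).

Definition obox a b : set 'rV[R]_n := [set x | forall i, a i < x ord0 i < b i].

Lemma obox_box a b :
  obox a b = [set x | forall i, [set` `]a i, b i[] (x ord0 i)].
Proof.
by apply/seteqP; split => x /= H i; move: (H i); rewrite in_itv.
Qed.

Lemma oboxI a b a' b' : obox a b `&` obox a' b' =
  obox (fun i => Num.max (a i) (a' i)) (fun i => Num.min (b i) (b' i)).
Proof.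
apply/seteqP; split => x /=.
  by move=> [H K] i; rewrite gt_max lt_min; have /andP[-> ->] := H i; exact: K.
by move=> H; split => i; have := H i; rewrite gt_max lt_min => /andP[/andP[? ?] /andP[? ?]]; apply/andP.
Qed.

Lemma measurable_cyl (A : 'I_n -> set (measurableTypeR R)) :
  (forall i, measurable (A i)) -> measurable [set x : 'rV[R]_n | forall i, A i (x ord0 i)].
Proof.
move=> mA.
rewrite (_ : [set _ | _] = \bigcap_(i in [set: 'I_n])
    (rV_coord i @^-1` A i)); last first.
  by apply/seteqP; split=> x /= Ax i; [move=> _; exact: (Ax i)|exact: (Ax i I)].
apply: fin_bigcap_measurable; first exact: finite_finset.
by move=> i _; rewrite -[X in measurable X]setTI; exact: measurable_rV_coord.
Qed.

Lemma measurable_obox a b : measurable (obox a b).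
Proof. by rewrite obox_box; apply: (@measurable_cyl (fun i => [set` `]a i, b i[])) => i; exact: measurable_itv. Qed.

Lemma ball_obox x (e : R) : 0 < e ->
  ball x e = obox (fun i => x ord0 i - e) (fun i => x ord0 i + e).
Proof.
move=> e0; apply/seteqP; split => y /=.
  by move=> [_ H] i; have := H ord0 i; rewrite -ball_normE /= distrC ltr_distl.
move=> H; split => // i j; rewrite ord1 -ball_normE /= distrC ltr_distl.
exact: H.
Qed.


Definition rat_box (q : 'rV[rat]_n * nat) : set 'rV[R]_n :=
  obox (fun i => ratr (q.1 ord0 i) - q.2.+1%:R^-1)
       (fun i => ratr (q.1 ord0 i) + q.2.+1%:R^-1).

(** Boxes with rational centre and half-side 1/(N+1) are countable and form a base of the topology;
    [unpickle] indexes them by naturals. Hence open sets belong to the sigma-algebra generated by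
    the coordinates. *)
Lemma open_rat_box (U : set 'rV[R]_n) : open U ->
  U = \bigcup_(k in [set k | exists2 q, unpickle k = Some q & rat_box q `<=` U])
        (if unpickle k is Some q then rat_box q else set0).
Proof.
move=> oU; apply/seteqP; split => [x Ux|x [k /= [q -> qU]]]; last exact: qU.
have /nbhs_ballP[e /= e0 eU] : nbhs x U by exact: open_nbhs_nbhs.
(* Half of e: a point of the box and x are each within 1/(N+1) of the rational centre. *)
have [N N0 Ne] : exists2 N : nat, True & (N.+1%:R^-1 < e / 2 :> R).
  exists (Num.truncn (e / 2)^-1) => //.
  rewrite invf_plt ?posrE ?divr_gt0//; exact: truncnS_gt.
have qx i : exists q : rat, x ord0 i - N.+1%:R^-1 < ratr q < x ord0 i + N.+1%:R^-1.
  have [|q] := @rat_in_itvoo R (x ord0 i - N.+1%:R^-1) (x ord0 i + N.+1%:R^-1).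
    by rewrite ltrD2l gtrN // invr_gt0 ltr0n.
  by rewrite in_itv /= => H; exists q.
have [q Hq] := choice qx.
exists (pickle (\row_i q i, N)); last first.
  rewrite pickleK => i /=; rewrite mxE.
  by move: (Hq i); move: (ratr (q i)) => z /andP[z1 z2]; rewrite ltrBlDr z2 -ltrBlDr z1.
exists (\row_i q i, N); first exact: pickleK.
move=> y yq; apply: eU; rewrite ball_obox// => i.
move: Ne (yq i) (Hq i); rewrite /= mxE; move: (ratr (q i)) (N.+1%:R^-1 : R) => z d.
move=> ? /andP[? ?] /andP[? ?].
by apply/andP; split; lra.
Qed.

Lemma open_measurable_rV (U : set 'rV[R]_n) : open U -> measurable U.
Proof.
move=> /open_rat_box ->; apply: bigcup_measurable => k _.
by case: (unpickle k) => // q; exact: measurable_obox.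
Qed.

Definition oboxes : set (set 'rV[R]_n) := [set A | exists a b, A = obox a b].

Lemma setI_oboxes : setI_closed oboxes.
Proof. by move=> _ _ [a [b ->]] [a' [b' ->]]; rewrite oboxI; do 2 eexists. Qed.

Lemma oboxes_cover : \bigcup_k obox (fun=> - k%:R) (fun=> k%:R) = setT.
Proof.
apply/seteqP; split => // x _.
exists (Num.truncn (\sum_i `|x ord0 i|)).+1 => // i.
rewrite -ltr_norml; apply: le_lt_trans (truncnS_gt _).
by rewrite (bigD1 i)//= lerDl sumr_ge0.
Qed.

(** Boxes are closed under intersection and exhaust the space; once they generate, a measure that is
    finite on them is determined by its values there. *)
Lemma measurable_oboxes : measurable = <<s oboxes >>.
Proof.
apply/seteqP; split; last first.
  apply: smallest_sub; first exact: sigma_algebra_measurable.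
  by move=> _ [a [b ->]]; exact: measurable_obox.
apply: smallest_sub; first exact: smallest_sigma_algebra.
rewrite -bigcup_seq; apply: bigcup_sub => i _ _ [B mB <-].
suff : measurable_fun [set: g_sigma_algebraType oboxes] (fun x => rV_coord i x).
  by move=> /(_ measurableT B mB).
apply: (measurability _ (RGenOInfty.measurableE R)) => _ [_ [c ->] <-].
(* The half-space x_i > c is exhausted by the boxes ]-k, k[^n whose i-th lower bound is raised to
   max(c, -k). *)
rewrite setTI (_ : _ @^-1` _ = \bigcup_k
   obox (fun j => if j == i then Num.max c (- k%:R) else - k%:R) (fun=> k%:R)); last first.
  have := oboxes_cover; move=> /seteqP[_ cov].
  apply/seteqP; split => x /=.
    rewrite in_itv /= andbT => cx; have [k _ kx] := cov x I; exists k => // j.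
    have [->|_] := eqVneq j i; last exact: kx.
    by rewrite gt_max cx; exact: kx.
  move=> [k _ /(_ i)]; rewrite eqxx gt_max in_itv /= andbT.
  by move=> /andP[/andP[]].
by apply: bigcupT_measurable => k; apply: sub_sigma_algebra; do 2 eexists.
Qed.

Notation mu := (lebesgue_rV n).

Lemma lebesgue_rV_obox a b :
  mu (obox a b) = (\prod_(i < n) (Num.max 0 (b i - a i))%:E)%E.
Proof.
rewrite obox_box (lebesgue_rV_box (A := fun i => [set` `]a i, b i[])) => [|i]; last exact: measurable_itv.
apply: eq_bigr => i _; rewrite lebesgue_measure_itv/= lte_fin.
case: ifPn => ab; first by rewrite max_r ?EFinB// subr_ge0 ltW.
by rewrite max_l// subr_le0 leNgt.
Qed.

Lemma lebesgue_rV_obox_lty a b : (mu (obox a b) < +oo)%E.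
Proof. by rewrite lebesgue_rV_obox prodEFin ltry. Qed.

Definition rV_shift (h x : 'rV[R]_n) : 'rV[R]_n := x + h.

Lemma measurable_rV_shift h : measurable_fun setT (rV_shift h).
Proof.
apply: measurable_fun_rVP => i.
rewrite (_ : _ \o _ = (fun x => rV_coord i x + h ord0 i)).
  by apply: measurable_funD => //; exact: measurable_rV_coord.
by apply/funext => x; rewrite /rV_coord /= mxE.
Qed.

(** A translated box is a box with the same side lengths, and box volumes determine the measure. The
    vanishing of integrals of derivatives rests on this invariance. *)
Lemma lebesgue_rV_shift h A : measurable A -> mu (rV_shift h @^-1` A) = mu A.
Proof.
move=> mA; pose mh := measurable_rV_shift h.
pose nu := measure_function_pushforward__canonical__measure_function_Measure mu mh.
apply/esym/(@measure_unique _ R _ oboxes (fun k => obox (fun=> - k%:R) (fun=> k%:R))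
  measurable_oboxes setI_oboxes _ oboxes_cover mu nu) => //.
- by move=> i; do 2 eexists.
- move=> _ [a [b ->]].
  rewrite /nu /= /pushforward (_ : _ @^-1` _ =
    obox (fun i => a i - h ord0 i) (fun i => b i - h ord0 i)); last first.
    by apply/seteqP; split => x /= H i; have /andP[] := H i; rewrite !mxE => ? ?; apply/andP; split; lra.
  rewrite [RHS]lebesgue_rV_obox [LHS]lebesgue_rV_obox; apply: eq_bigr => i _.
  by congr (Num.max _ _)%:E; ring.
- by move=> k; exact: lebesgue_rV_obox_lty.
Qed.

Lemma ge0_integral_shift h (f : 'rV[R]_n -> \bar R) :
  measurable_fun setT f -> (forall x, 0 <= f x)%E ->
  (\int[mu]_x f (rV_shift h x) = \int[mu]_x f x)%E.
Proof.
move=> mf f0.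
have mh := measurable_rV_shift h.
have := @ge0_integral_pushforward _ _ _ _ R _ mh mu setT f
  measurableT mf (fun x _ => f0 x).
rewrite preimage_setT => <-.
apply: eq_measure_integral => A mA _.
by rewrite -[RHS](lebesgue_rV_shift h).
Qed.

Lemma integral_shift h (f : 'rV[R]_n -> \bar R) : measurable_fun setT f ->
  (\int[mu]_x f (rV_shift h x) = \int[mu]_x f x)%E.
Proof.
move=> mf; rewrite integralE [RHS]integralE; congr (_ - _)%E.
  have mp : measurable_fun [set: 'rV[R]_n] f^\+%E by apply: measurable_funepos.
  rewrite -[RHS](ge0_integral_shift h mp); last by move=> x; exact: funepos_ge0.
  by apply: eq_integral => x _; rewrite !funeposE.
have mp : measurable_fun [set: 'rV[R]_n] f^\-%E by apply: measurable_funeneg.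
rewrite -[RHS](ge0_integral_shift h mp); last by move=> x; exact: funeneg_ge0.
by apply: eq_integral => x _; rewrite !funenegE.
Qed.

(* pi-lambda: the boxes generate, so it suffices to test against them. *)
Lemma ae_eq0_obox (f : 'rV[R]_n -> R) : mu.-integrable setT (EFin \o f) ->
  (forall a b, \int[mu]_(x in obox a b) (f x)%:E = 0)%E ->
  ae_eq mu setT f (cst 0).
Proof.
move=> fi f0.
have mf := measurable_int _ fi.
have iS A : measurable A -> mu.-integrable A (EFin \o f).
  by move=> mA; apply: integrableS fi.
pose H := [set A : set 'rV[R]_n | measurable A /\ (\int[mu]_(x in A) (f x)%:E = 0)%E].
have HD A B : measurable A -> measurable B -> [disjoint A & B] ->
  (\int[mu]_(x in A `|` B) (f x)%:E = \int[mu]_(x in A) (f x)%:E + \int[mu]_(x in B) (f x)%:E)%E.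
  move=> mA mB AB; rewrite integral_setU_EFin//.
  by apply: measurable_funTS; apply/measurable_EFinP.
have HDB A B : B `<=` A -> H A -> H B -> H (A `\` B).
  move=> BA [mA A0] [mB B0]; split; first exact: measurableD.
  have := HD (A `\` B) B (measurableD mA mB) mB.
  rewrite setDKU// A0 B0 adde0 => <-//.
  by apply/disj_setPS => x [] [].
have HU (F : nat -> set 'rV[R]_n) : trivIset setT F -> (forall k, H (F k)) -> H (\bigcup_k F k).
  move=> tF HF; split; first by apply: bigcupT_measurable => k; have [] := HF k.
  rewrite integral_bigcup//; last 2 first.
    by move=> k; have [] := HF k.
    by apply: iS; apply: bigcupT_measurable => k; have [] := HF k.
  by rewrite eseries0// => k _ _; have [] := HF k.
have Hbox a b : H (obox a b) by split; [exact: measurable_obox|exact: f0].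
have HT : H setT.
  rewrite -oboxes_cover.
  set F := fun k => _.
  have ndF : nondecreasing_seq F.
    move=> i j ij; apply/subsetPset => x Fx l; have /andP[? ?] := Fx l.
    have : (i%:R <= j%:R :> R) by rewrite ler_nat.
    by move=> ?; apply/andP; split; lra.
  rewrite seqDU_bigcup_eq seqDU_seqD//; apply: HU; first exact: trivIset_seqD.
  move=> [|k]; first exact: Hbox.
  by apply: HDB => //; apply/subsetPset/ndF.
have sub : measurable `<=` H.
  rewrite measurable_oboxes; apply: lambda_system_subset => //.
  - exact: setI_oboxes.
  - apply/dynkin_lambda_system; split => //.
      by move=> A HA; rewrite -setTD; exact: HDB.
  - by move=> _ [a [b ->]].
have : ae_eq mu setT (EFin \o f) (cst 0%E).
  apply: integral_ae_eq => // A _ mA.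
  by rewrite integral0; have [] := sub _ mA.
by apply: filterS => x /= H0 _; have [] := H0 I.
Qed.

Lemma set1_rV_null (x : 'rV[R]_n) : (0 < n)%N -> mu [set x] = 0%E.
Proof.
move=> n0.
rewrite (_ : [set x] = [set y | forall i, [set x ord0 i] (y ord0 i)]); last first.
  apply/seteqP; split => y /=; first by move=> ->.
  by move=> H; apply/rowP => i; rewrite H.
rewrite (lebesgue_rV_box (A := fun i => [set x ord0 i])) => [|i]; last exact: measurable_set1.
rewrite (bigD1 (Ordinal n0))//= lebesgue_measure_set1 ?mul0e//.
Qed.

Lemma measurable_rV_set1 (x : 'rV[R]_n) : measurable [set x].
Proof.
rewrite (_ : [set x] = [set y | forall i, [set x ord0 i] (y ord0 i)]); last first.
  apply/seteqP; split => y /=; first by move=> ->.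
  by move=> H; apply/rowP => i; rewrite H.
exact: (@measurable_cyl (fun i => [set x ord0 i])).
Qed.

Lemma open_neq0 : open [set x : 'rV[R]_n | x != 0].
Proof.
rewrite (_ : [set x | _] = ~` [set 0]); first exact/closed_openC/accessible_closed_set1/hausdorff_accessible/norm_hausdorff.
by apply/seteqP; split => x /= /eqP.
Qed.

(** The origin is a measurable singleton, so it can be split off; the functions in use are singular
    at most there. *)
Lemma measurable_fun_neq0 (D : set 'rV[R]_n) (f : 'rV[R]_n -> R) : measurable D ->
  (forall x, x != 0 -> {for x, continuous f}) -> measurable_fun D f.
Proof.
move=> mD cf; apply: (measurable_funS measurableT) => //.
have -> : [set: 'rV[R]_n] = [set x | x != 0] `|` [set 0].
  by apply/seteqP; split => // x _ /=; have [|] := eqVneq x 0; [right|left].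
have m0 := open_measurable_rV open_neq0.
have m1 := measurable_rV_set1 0.
apply/measurable_funU => //; split; last first.
  move=> _ B mB; have [fB|fB] := pselect (B (f 0)).
    by rewrite (_ : _ `&` _ = [set 0])//; apply/seteqP; split => [x []//|x /= ->].
  by rewrite (_ : _ `&` _ = set0)//; apply/seteqP; split => [x /= [->]|].
move=> _; apply: (measurability _ (RGenOpens.measurableE R)) => //.
move=> _ [_ [a [b ->]] <-].
apply: open_measurable_rV; rewrite openE => x [/= x0 fab].
have : \forall y \near x, y != 0 by apply: open_nbhs_nbhs; split => //; exact: open_neq0.
have : \forall y \near x, f y \in `]a, b[.
  apply: (cf _ x0 `]a, b[%classic); apply: open_nbhs_nbhs; split => //; exact: itv_open.
by apply: filterS2.
Qed.

End rV_borel.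


(** * The Euclidean radius and the integrability of r^(-4) on the ball *)

Section radius.
Context {R : realType} {m : nat}.
Implicit Types x : 'rV[R]_m.

Definition rho x : R := \sum_i x ord0 i ^+ 2.
(** At the origin the value is 0, by the convention 0^-1 = 0, so a multiple of [rinv x ^+ 4] is no
    majorant at x = 0; this point is treated separately in the estimates. *)
Definition rinv x : R := (enorm x)^-1.

Lemma rho_ge0 x : 0 <= rho x.
Proof. by apply: sumr_ge0 => i _; exact: sqr_ge0. Qed.

Lemma enorm_ge0 x : 0 <= enorm x. Proof. exact: sqrtr_ge0. Qed.

Lemma sqr_enorm x : enorm x ^+ 2 = rho x.
Proof. by rewrite sqr_sqrtr// rho_ge0. Qed.

Lemma enorm_coord x i : `|x ord0 i| <= enorm x.
Proof.
rewrite -(@ler_pXn2r _ 2)// ?nnegrE ?enorm_ge0// sqr_enorm real_normK ?num_real//.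
by rewrite /rho (bigD1 i)//= lerDl sumr_ge0// => j _; exact: sqr_ge0.
Qed.

Lemma enorm0 : enorm (0 : 'rV[R]_m) = 0.
Proof. by rewrite /enorm big1 ?sqrtr0// => i _; rewrite mxE expr0n. Qed.

Lemma enorm_eq0 x : (enorm x == 0) = (x == 0).
Proof.
apply/eqP/eqP => [x0|->]; last exact: enorm0.
apply/rowP => i; rewrite mxE; apply/eqP; rewrite -normr_le0 -x0.
exact: enorm_coord.
Qed.

Lemma enorm_gt0 x : (0 < enorm x) = (x != 0).
Proof. by rewrite lt_neqAle enorm_ge0 andbT eq_sym enorm_eq0. Qed.

Lemma rho_gt0 x : (0 < rho x) = (x != 0).
Proof. by rewrite -sqr_enorm exprn_even_gt0//= enorm_eq0. Qed.

Lemma rinv_ge0 x : 0 <= rinv x. Proof. by rewrite invr_ge0 enorm_ge0. Qed.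

Lemma rinv_gt0 x : x != 0 -> 0 < rinv x.
Proof. by move=> x0; rewrite invr_gt0 enorm_gt0. Qed.

Lemma rinv_ge1 x : x != 0 -> enorm x <= 1 -> 1 <= rinv x.
Proof. by move=> x0 x1; rewrite invf_ge1 ?enorm_gt0. Qed.

Lemma rinv2 x : rinv x ^+ 2 = (rho x)^-1.
Proof. by rewrite exprVn sqr_enorm. Qed.

Lemma enorm_lt1 x : (enorm x < 1) = (rho x < 1).
Proof. by rewrite -sqr_enorm expr_lt1// enorm_ge0. Qed.

Lemma enorm_le1 x : (enorm x <= 1) = (rho x <= 1).
Proof. by rewrite -sqr_enorm expr_le1// enorm_ge0. Qed.

Lemma continuous_rho : continuous rho.
Proof.
rewrite /rho; elim: (index_enum _) => [|i s IH] x.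
  have -> : (fun x0 : 'rV[R]_m => \sum_(i <- [::]) x0 ord0 i ^+ 2) = cst 0.
    by apply/funext => y; rewrite big_nil.
  exact: cst_continuous.
under eq_fun do rewrite big_cons.
have ci : continuous ((fun t : R => t ^+ 2) \o (fun y : 'rV[R]_m => y ord0 i)).
  move=> z; apply: continuous_comp; first exact: coord_continuous.
  exact: exprn_continuous.
exact: (continuousD (ci x) (IH x)).
Qed.

Lemma continuous_enorm : continuous (@enorm R m).
Proof.
move=> x; apply: (@cvg_comp _ _ _ rho Num.sqrt); first exact: continuous_rho.
exact: sqrt_continuous.
Qed.

Lemma open_uball : open (@uball R m).
Proof.
rewrite (_ : uball = enorm @^-1` [set t | t < 1])//.
by apply: open_comp => [x _|]; [exact: continuous_enorm|exact: open_lt].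
Qed.

Lemma measurable_uball : measurable (@uball R m).
Proof. by apply: open_measurable_rV; exact: open_uball. Qed.

Lemma uball_sub_obox : @uball R m `<=` obox (fun=> -1) (fun=> 1).
Proof.
by move=> x x1 i; rewrite -ltr_norml; exact: le_lt_trans (enorm_coord x i) x1.
Qed.

Notation mu := (lebesgue_rV m).

Lemma mu_uball_lty : (mu (@uball R m) < +oo)%E.
Proof.
apply: le_lt_trans (lebesgue_rV_obox_lty (fun=> -1) (fun=> 1)).
apply: le_measure; rewrite ?inE; [exact: measurable_uball|exact: measurable_obox|].
exact: uball_sub_obox.
Qed.

(** A cube of half-side d = 1/(m+1) fits into the ball, because m d^2 <= m d < 1. *)
Lemma mu_uball_gt0 : (0 < mu (@uball R m))%E.
Proof.
pose d : R := (m.+1%:R)^-1.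
have d0 : 0 < d by rewrite invr_gt0 ltr0n.
have : (0 < mu (@obox R m (fun=> - d)%R (fun=> d)))%E.
  rewrite lebesgue_rV_obox prodEFin lte_fin; apply: prodr_gt0 => i _.
  by rewrite max_r; lra.
move=> /lt_le_trans; apply; apply: le_measure; rewrite ?inE.
- exact: measurable_obox.
- exact: measurable_uball.
move=> x Hx; rewrite /uball /= enorm_lt1.
apply: (@le_lt_trans _ _ (\sum_(i < m) d)).
  apply: ler_sum => i _; apply: (@le_trans _ _ (d ^+ 2)).
    by rewrite -real_normK ?num_real// ler_pXn2r// ?nnegrE ?(ltW d0)// ltW// ltr_norml; exact: Hx.
  by rewrite expr2 ger_pMl// invf_le1 ?ltr0n// ler1n.
rewrite sumr_const card_ord /d -[_ *+ m]mulr_natr mulrC ltr_pdivrMr ?ltr0n// mul1r ltr_nat//.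
Qed.

Hypothesis m5 : (5 <= m)%N.

Let c (k : nat) : R := 2^-1 ^+ k.
Let cube k := @obox R m (fun=> - c k) (fun=> c k).

Let c_gt0 k : 0 < c k. Proof. by rewrite exprn_gt0. Qed.

(** If x lies in the cube of half-side 2^(-k) but not in the next one, some coordinate is at least
    2^(-k-1) in absolute value, so r^(-4) <= 16^(k+1): the k-th term alone is a majorant. *)
Let rinv4_le x : uball x ->
  ((rinv x ^+ 4)%:E <= \sum_(k <oo) (16 ^+ k.+1 * \1_(cube k) x)%:E)%E.
Proof.
move=> x1.
have term0 k : (0 <= (16 ^+ k.+1 * \1_(cube k) x)%:E)%E.
  by rewrite lee_fin mulr_ge0// exprn_ge0.
have [->|x0] := eqVneq x 0.
  rewrite /rinv enorm0 invr0 expr0n; apply: nneseries_ge0 => k _ _.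
  by rewrite lee_fin mulr_ge0// exprn_ge0.
have /existsNP[i xi] : ~ forall i, x ord0 i = 0.
  by move=> H; move/eqP : x0; apply; apply/rowP => i; rewrite H mxE.
have exK : exists K, `[< ~ cube K x >].
  have : c K @[K --> \oo] --> 0 by apply: cvg_expr; rewrite ger0_norm// invf_lt1// ltr1n.
  move=> /cvgrPdist_lt /(_ `|x ord0 i|); rewrite normr_gt0.
  move=> /(_ (introN eqP xi))[K _ /(_ K (leqnn _))].
  rewrite sub0r normrN ger0_norm ?(ltW (c_gt0 K))// => cK.
  by exists K; apply/asboolP => /(_ i); rewrite -ltr_norml ltNge (ltW cK).
case: (ex_minnP exK) => -[|k] /asboolP nK minK.
  by exfalso; apply: nK => i'; rewrite /c expr0; exact: uball_sub_obox.
have ck : cube k x.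
  by apply: contrapT => /asboolP /minK; rewrite ltnn.
have [j xj] : exists j, c k.+1 <= `|x ord0 j|.
  apply: contrapT => H; apply: nK => j; rewrite -ltr_norml ltNge.
  by apply/negP => xj; apply: H; exists j.
have ik : rinv x ^+ 4 <= 16 ^+ k.+1.
  have -> : 16 ^+ k.+1 = (2 ^+ k.+1) ^+ 4 :> R.
    by rewrite exprAC; congr (_ ^+ _); rewrite -natrX.
  rewrite ler_pXn2r ?nnegrE ?rinv_ge0 ?exprn_ge0// /rinv -[leRHS]invrK -exprVn.
  rewrite lef_pV2 ?posrE ?enorm_gt0// ?(c_gt0 k.+1)//.
  exact: le_trans xj (enorm_coord x j).
apply: (@le_trans _ _ (16 ^+ k.+1 * \1_(cube k) x)%:E).
  by rewrite indicE mem_set// mulr1 lee_fin.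
apply: le_trans (nneseries_lim_ge k.+1 _) => //.
rewrite big_nat_recr//= leeDr//; apply: sume_ge0 => l _; exact: term0.
Qed.

(** The k-th term of the dyadic majorant integrates to at most 16^(k+1) (2 2^(-k))^m, which for m >=
    5 is at most 16 2^m 2^(-k). This is e / 2^(k+1) with e = 32 2^m, the bound on the sum. *)
Lemma integrable_rinv4 : mu.-integrable (@uball R m) (fun x => (rinv x ^+ 4)%:E).
Proof.
have mi : measurable_fun uball (fun x => (rinv x ^+ 4)%:E).
  apply/measurable_EFinP; apply: measurable_funX; apply: measurable_fun_neq0.
    exact: measurable_uball.
  move=> x x0; apply: (@continuous_comp _ _ _ enorm GRing.inv).
    exact: continuous_enorm.
  by apply: inv_continuous; rewrite enorm_eq0.
apply/integrableP; split => //.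
have mcube k : measurable (cube k) by exact: measurable_obox.
have mterm k : measurable_fun uball (fun x : 'rV[R]_m => (16 ^+ k.+1 * \1_(cube k) x)%:E).
  by apply/measurable_EFinP; apply: measurable_funM => //; exact: measurable_indic.
have term0 k x : (0 <= (16 ^+ k.+1 * \1_(cube k) x)%:E)%E.
  by rewrite lee_fin mulr_ge0// exprn_ge0.
apply: (@le_lt_trans _ _ (\int[mu]_(x in uball)
    (\sum_(k <oo) (16 ^+ k.+1 * \1_(cube k) x)%:E))%E).
  apply: ge0_le_integral => //.
  - exact: measurable_uball.
  - exact: measurableT_comp.
  - by apply: ge0_emeasurable_sum => // k x _ _; exact: term0.
  - move=> x x1; rewrite gee0_abs ?rinv4_le//.
    by rewrite lee_fin exprn_ge0// rinv_ge0.
rewrite integral_nneseries//; last exact: measurable_uball.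
have e0 : 0 <= 32 * 2 ^+ m :> R by rewrite mulr_ge0// exprn_ge0.
apply: (@le_lt_trans _ _ (32 * 2 ^+ m)%:E); last exact: ltry.
apply: le_trans (epsilon_trick0 xpredT e0).
apply: lee_nneseries => [k _ _|k _]; first by apply: integral_ge0 => x _; exact: term0.
rewrite (@integralZl_indic _ _ _ _ _ measurable_uball (fun=> cube k))//; last first.
  by rewrite ltNge exprn_ge0.
rewrite integral_indic//; last exact: measurable_uball.
apply: (@le_trans _ _ ((16 ^+ k.+1)%:E * mu (cube k))%E).
  apply: lee_wpmul2l; first by rewrite lee_fin exprn_ge0.
  apply: le_measure; rewrite ?inE//.
    by apply: measurableI => //; exact: measurable_uball.
rewrite lebesgue_rV_obox prodEFin -EFinM lee_fin.
rewrite prodr_const card_ord opprK max_r; last by rewrite addr_ge0// ltW// c_gt0.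
rewrite natrX ler_pdivlMr ?exprn_gt0//.
rewrite -mulr2n -[c k *+ 2]mulr_natl exprMn.
have -> : c k ^+ m = c k ^+ 4 * c k ^+ (m - 4) by rewrite -exprD subnKC// ltnW.
have -> : 16 ^+ k.+1 * (2 ^+ m * (c k ^+ 4 * c k ^+ (m - 4))) * 2 ^+ k.+1 =
   32 * 2 ^+ m * ((2 ^+ k * c k) ^+ 4 * (2 ^+ k * c k ^+ (m - 4))).
  have -> : 16 ^+ k.+1 = 16 * (2 ^+ k) ^+ 4 :> R.
    rewrite exprS; congr (_ * _); rewrite exprAC; congr (_ ^+ _).
    by rewrite -natrX.
  rewrite [2 ^+ k.+1]exprS; move: (c k ^+ (m - 4)) (c k) (2 ^+ m : R) (2 ^+ k : R) => a b d e; ring.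
have ck : 2 ^+ k * c k = 1 by rewrite -exprMn divff// expr1n.
rewrite ck expr1n mul1r ler_piMr//.
have -> : (m - 4 = (m - 5).+1)%N by rewrite subnSK.
rewrite exprS mulrA ck mul1r exprn_ile1// ?(ltW (c_gt0 k))//.
by rewrite exprn_ile1// invf_le1// ler1n.
Qed.

End radius.

(** * Locality of differentiability *)

Section near_diff.
Context {R : numFieldType} {V W : normedModType R}.

Lemma near_eq_differentiable (f g : V -> W) (x : V) :
  (\near x, f x = g x) -> differentiable f x -> differentiable g x.
Proof.
move=> fg dfx; apply/diffP => /=.
apply: (@getPex _ (fun (df : {linear V -> W}) => continuous df /\
  forall y, g y = g (lim (nbhs x)) + df (y - lim (nbhs x))
                  +o_(y \near x) (y - lim (nbhs x)))).
exists ('d f x); split; first exact: diff_continuous.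
have gx : f x = g x by exact: nbhs_singleton fg.
have /diffE fE := dfx.
have /funext/eqaddoP fo := fE.
rewrite -[forall y, _]funeqE; apply/eqaddoP => e e0.
have := fo e e0; apply: filterS2 fg => y fgy.
by rewrite lim_id //= !fctE fgy gx.
Qed.

End near_diff.

(** * Gradients, a smooth bump and a class of smooth functions closed under partial derivatives *)

Section calculus.
Context {R : realType} {m : nat}.
Implicit Types (f g : 'rV[R]_m -> R) (x : 'rV[R]_m) (i j : 'I_m) (G H : 'I_m -> R).

(** Differentiability travels with the values of the partial derivatives, because the chain rule
    needs it and existence of partial derivatives does not give it. *)
Definition pdiff f x G := differentiable f x /\ forall i, partial i f x = G i.

Lemma pdiff_eq f x G H : pdiff f x G -> G =1 H -> pdiff f x H.
Proof. by move=> [df pf] GH; split => // i; rewrite pf GH. Qed.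

Lemma pdiff_fext f g x G H : f =1 g -> G =1 H -> pdiff f x G -> pdiff g x H.
Proof. by move=> /funext -> GH pf; exact: pdiff_eq pf GH. Qed.

Lemma pdiffP f x : differentiable f x -> pdiff f x (fun i => partial i f x).
Proof. by []. Qed.

Lemma pdiff_cst (c : R) x : pdiff (fun=> c) x (fun=> 0).
Proof.
split; first exact: differentiable_cst.
by move=> i; rewrite /partial; exact: derive_cst.
Qed.

Lemma pdiff_coord k x : pdiff (fun y => y ord0 k) x (fun i => (i == k)%:R).
Proof.
split; first exact: differentiable_coord.
move=> i; rewrite /partial /derive; apply: cvg_lim => //.
apply: (@cvg_trans _ ((fun=> (i == k)%:R : R) @ (0:R)^')); last exact: cvg_cst.
apply: near_eq_cvg; near=> h.
have h0 : h != 0 by near: h; exact: nbhs_dnbhs_neq.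
rewrite /= !mxE eqxx /= addrK /GRing.scale /= eq_sym mulrA mulVf// mul1r.
by rewrite eq_sym.
Unshelve. all: by end_near. Qed.

Lemma pdiffD f g x G H : pdiff f x G -> pdiff g x H ->
  pdiff (fun y => f y + g y) x (fun i => G i + H i).
Proof.
move=> [df pf] [dg pg]; split; first exact: differentiableD.
move=> i; rewrite /partial -pf -pg; apply: deriveD; exact: diff_derivable.
Qed.

Lemma pdiffM f g x G H : pdiff f x G -> pdiff g x H ->
  pdiff (fun y => f y * g y) x (fun i => G i * g x + f x * H i).
Proof.
move=> [df pf] [dg pg]; split; first exact: differentiableM.
move=> i; rewrite -pf -pg /partial.
rewrite [LHS](@deriveM _ _ f g); try exact: diff_derivable.
by rewrite addrC; congr (_ + _); exact: mulrC.
Qed.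

Lemma pdiff_comp (g : R -> R) (d : R) f x G : pdiff f x G -> is_derive (f x) 1 g d ->
  pdiff (fun y => g (f y)) x (fun i => d * G i).
Proof.
move=> [df pf] dg.
have dg1 : differentiable g (f x) by apply/derivable1_diffP; case: dg.
split; first exact: (@differentiable_comp _ _ _ _ f g).
move=> i; rewrite -pf /partial !deriveE //; last exact: (@differentiable_comp _ _ _ _ f g).
rewrite (@diff_comp _ _ _ _ f g)//= diff1E//= mulrC derive1E.
by rewrite (@derive_val _ _ _ _ _ _ _ dg).
Qed.

Lemma pdiffN f x G : pdiff f x G -> pdiff (fun y => - f y) x (fun i => - G i).
Proof.
move=> pf; have := pdiffM (pdiff_cst (-1) x) pf.
by apply: pdiff_fext => [y|i]; rewrite ?mul0r ?add0r mulN1r.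
Qed.

Lemma pdiff_sum (I : Type) (r : seq I) (F : I -> 'rV[R]_m -> R) x (G : I -> 'I_m -> R) :
  (forall k, pdiff (F k) x (G k)) ->
  pdiff (fun y => \sum_(k <- r) F k y) x (fun i => \sum_(k <- r) G k i).
Proof.
move=> dF; elim: r => [|k r IH].
  have := pdiff_cst 0 x; by apply: pdiff_fext => [y|i]; rewrite big_nil.
have := pdiffD (dF k) IH; by apply: pdiff_fext => [y|i]; rewrite big_cons.
Qed.

Lemma pdiffV f x G : f x != 0 -> pdiff f x G ->
  pdiff (fun y => (f y)^-1) x (fun i => - (f x) ^- 2 * G i).
Proof.
move=> fx0 pf; have := @pdiff_comp (fun t => t^-1) (- (f x) ^- 2) f x G pf.
apply; have := @is_deriveV R id (f x) 1 1 fx0 (is_derive_id _ _).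
by rewrite /GRing.scale /= mulr1.
Qed.

Lemma pdiff_rho x : pdiff rho x (fun i => 2 * x ord0 i).
Proof.
have := pdiff_sum (index_enum 'I_m) (fun k => pdiffM (pdiff_coord k x) (pdiff_coord k x)).
apply: pdiff_fext => [y|i].
  by apply: eq_bigr => k _; rewrite expr2.
rewrite (bigD1 i)//= big1 ?addr0 => [|k /negbTE ki].
  by rewrite eqxx mul1r mulr1 mulr_natl mulr2n.
by rewrite eq_sym ki mul0r mulr0 addr0.
Qed.

Lemma pdiff_rinv x : x != 0 ->
  pdiff rinv x (fun i => - (x ord0 i * rinv x) * rinv x ^+ 2).
Proof.
move=> x0; have r0 : 0 < rho x by rewrite rho_gt0.
have e0 : enorm x != 0 by rewrite enorm_eq0.
have ds := is_derive1_sqrt r0.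
have := pdiffV (f := fun y => Num.sqrt (rho y)) e0 (pdiff_comp (pdiff_rho x) ds).
apply: pdiff_fext => // i; rewrite /rinv -/(rho x) -[Num.sqrt (rho x)]/(enorm x).
by field.
Qed.

(** The case k = 0 is the classical flat function exp(-1/t). The factors t^(-k) make the span of the
    family closed under differentiation. *)
Definition ebump k (t : R) : R := if 0 < t then t^-1 ^+ k * expR (- t^-1) else 0.

Lemma bump_gt0 k t : 0 < t -> ebump k t = t^-1 ^+ k * expR (- t^-1).
Proof. by rewrite /ebump => ->. Qed.

Lemma bump_le0 k t : t <= 0 -> ebump k t = 0.
Proof. by rewrite /ebump leNgt => /negbTE ->. Qed.

Lemma bump_ge0 k t : 0 <= ebump k t.
Proof.
have [t0|t0] := ltP 0 t; last by rewrite bump_le0.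
by rewrite bump_gt0// mulr_ge0 ?expR_ge0// exprn_ge0// invr_ge0 ltW.
Qed.

(** The single term t^(-k-1)/(k+1)! of the series of exp(1/t) is enough. The linear bound is what
    makes the derivative at 0 vanish. *)
Lemma bump_ub k t : ebump k t <= (k.+1)`!%:R * `|t|.
Proof.
have [t0|t0] := ltP 0 t; last by rewrite bump_le0// mulr_ge0.
rewrite bump_gt0// ger0_norm ?(ltW t0)//.
have ti0 : 0 <= t^-1 by rewrite invr_ge0 ltW.
have := expR_ge1Dxn k ti0.
move=> /(le_trans (ler_wpDl ler01 (lexx _))); rewrite ler_pdivrMr ?ltr0n ?fact_gt0// => H.
rewrite expRN ler_pdivrMr ?expR_gt0//.
have -> : t^-1 ^+ k = t * t^-1 ^+ k.+1 by rewrite exprS mulrA divff ?mul1r// lt0r_neq0.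
by rewrite [_ * t]mulrC -mulrA ler_pM2l// mulrC.
Qed.

Lemma bumpS k t : 0 < t -> ebump k t = t * ebump k.+1 t.
Proof.
by move=> t0; rewrite !bump_gt0// exprS !mulrA divff ?mul1r// lt0r_neq0.
Qed.

Lemma bump0_le1 t : ebump 0 t <= 1.
Proof.
have [t0|t0] := ltP 0 t; last by rewrite bump_le0.
by rewrite bump_gt0// expr0 mul1r expR_le1 oppr_le0 invr_ge0 ltW.
Qed.

Lemma is_derive_bump k (t : R) : is_derive t 1 (ebump k) (- k%:R * ebump k.+1 t + ebump k.+2 t).
Proof.
have [t0|t0|->] := ltgtP t 0.
- apply: (@near_eq_is_derive _ _ _ (cst 0)).
    near=> s; rewrite bump_le0// ltW//; near: s; exact: lt_nbhsl.
  by rewrite !bump_le0 ?(ltW t0)// mulr0 addr0; exact: is_derive_cst.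
- apply: (@near_eq_is_derive _ _ _ (fun s : R => s^-1 ^+ k * expR (- s^-1))).
    near=> s; rewrite bump_gt0//; near: s; exact: lt_nbhsr.
  have dV : is_derive t 1 (fun s : R => s^-1) (- t ^- 2).
    have := @is_deriveV R id t 1 1 (lt0r_neq0 t0) (is_derive_id _ _).
    by rewrite /GRing.scale /= mulr1.
  have dX : is_derive t 1 (fun s : R => s^-1 ^+ k) (k%:R * t^-1 ^+ k.-1 * - t ^- 2).
    have dk : is_derive (t^-1) 1 (fun s : R => s ^+ k) (k%:R * t^-1 ^+ k.-1).
      have := @is_deriveX R R id k t^-1 1 1 (is_derive_id _ _).
      by rewrite /GRing.scale /= mulr1 exprfctE.
    exact: (@is_derive1_comp _ (fun s => s ^+ k)).
  have dE : is_derive t 1 (fun s : R => expR (- s^-1)) (expR (- t^-1) * t ^- 2).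
    have dN : is_derive t 1 (fun s : R => - s^-1) (t ^- 2).
      by have := @is_deriveN _ _ _ _ _ _ _ dV; rewrite opprK.
    exact: (@is_derive1_comp _ expR).
  apply: is_derive_eq.
  rewrite !bump_gt0// /GRing.scale /= !exprVn.
  case: k {dX} => [|k]; rewrite ?mul0r ?mulr0 ?addr0 /=.
    move: (expR _) => E. rewrite !expr0. field. exact: lt0r_neq0.
  move: (expR _) => E. rewrite !exprS. field.
  by rewrite expf_neq0// lt0r_neq0.
- rewrite !bump_le0// mulr0 addr0.
  (* For h > 0 the quotient [ebump k h / h] equals [ebump k.+1 h], which is O(h); for h < 0 it is
     0. *)
  have H : h^-1 *: ((ebump k \o shift 0) (h *: 1) - ebump k 0) @[h --> 0^'] --> (0 : R).
    apply/cvgrPdist_le => e e0; near=> h.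
    have h0 : h != 0 by near: h; exact: nbhs_dnbhs_neq.
    rewrite sub0r normrN /= addr0 (bump_le0 k (lexx 0)) subr0 /GRing.scale /= mulr1.
    rewrite normrM normfV ger0_norm ?bump_ge0//.
    apply: (@le_trans _ _ ((k.+2)`!%:R * `|h|)).
      rewrite mulrC ler_pdivrMr ?normr_gt0//.
      have [hp|hn] := ltP 0 h; last by rewrite bump_le0// !mulr_ge0.
      rewrite (bumpS k hp); have := bump_ub k.+1 h; rewrite ger0_norm ?(ltW hp)// => H.
      by rewrite mulrC ler_pM2r.
    rewrite mulrC -ler_pdivlMr ?ltr0n ?fact_gt0//.
    near: h; apply: dnbhs0_le; by rewrite divr_gt0// ltr0n fact_gt0.
  by apply: DeriveDef; [apply/cvg_ex; exists 0|exact: cvg_lim].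
Unshelve. all: by end_near. Qed.

(** [smooth] speaks of all iterated partial derivatives at once, so it is obtained by induction from
    a syntactic class that partial derivatives do not leave. *)
Inductive Sm : ('rV[R]_m -> R) -> Prop :=
| Sm_cst c : Sm (fun=> c)
| Sm_coord i : Sm (fun x => x ord0 i)
| Sm_add f g : Sm f -> Sm g -> Sm (fun x => f x + g x)
| Sm_mul f g : Sm f -> Sm g -> Sm (fun x => f x * g x)
| Sm_sin f : Sm f -> Sm (fun x => sin (f x))
| Sm_cos f : Sm f -> Sm (fun x => cos (f x))
| Sm_inv f : (forall x, f x != 0) -> Sm f -> Sm (fun x => (f x)^-1)
| Sm_bump k f : Sm f -> Sm (fun x => ebump k (f x)).

Lemma Sm_opp f : Sm f -> Sm (fun x => - f x).
Proof.
move=> sf; have := Sm_mul (Sm_cst (-1)) sf; congr Sm.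
by apply/funext => x; rewrite mulN1r.
Qed.

Lemma Sm_sub f g : Sm f -> Sm g -> Sm (fun x => f x - g x).
Proof. by move=> sf /Sm_opp; exact: Sm_add. Qed.

Lemma Sm_exp f n : Sm f -> Sm (fun x => f x ^+ n).
Proof.
move=> sf; elim: n => [|n IH]; first exact: (Sm_cst 1).
have := Sm_mul sf IH; congr Sm.
by apply/funext => x; rewrite exprS.
Qed.

Lemma Sm_sum (I : Type) (r : seq I) (F : I -> 'rV[R]_m -> R) :
  (forall k, Sm (F k)) -> Sm (fun x => \sum_(k <- r) F k x).
Proof.
move=> sF; elim: r => [|k r IH].
  have := Sm_cst 0; congr Sm; by apply/funext => x; rewrite big_nil.
have := Sm_add (sF k) IH; congr Sm; by apply/funext => x; rewrite big_cons.
Qed.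

Lemma Sm_prod (I : Type) (r : seq I) (F : I -> 'rV[R]_m -> R) :
  (forall k, Sm (F k)) -> Sm (fun x => \prod_(k <- r) F k x).
Proof.
move=> sF; elim: r => [|k r IH].
  have := Sm_cst 1; congr Sm; by apply/funext => x; rewrite big_nil.
have := Sm_mul (sF k) IH; congr Sm; by apply/funext => x; rewrite big_cons.
Qed.

Lemma Sm_rho : Sm rho.
Proof. by apply: Sm_sum => i; apply: Sm_exp; exact: Sm_coord. Qed.

Lemma Sm_pdiff f : Sm f -> exists2 G : 'I_m -> 'rV[R]_m -> R,
  forall i, Sm (G i) & forall x, pdiff f x (fun i => G i x).
Proof.
elim=> {f} [c|k|f g sf [G sG dG] sg [H sH dH]|f g sf [G sG dG] sg [H sH dH]
  |f sf [G sG dG]|f sf [G sG dG]|f f0 sf [G sG dG]|k f sf [G sG dG]].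
- exists (fun _ _ => 0) => [i|x]; [exact: Sm_cst|exact: pdiff_cst].
- exists (fun i _ => (i == k)%:R) => [i|x]; [exact: Sm_cst|exact: pdiff_coord].
- exists (fun i x => G i x + H i x) => [i|x]; [exact: Sm_add|exact: pdiffD].
- exists (fun i x => G i x * g x + f x * H i x) => [i|x]; last exact: pdiffM.
  by apply: Sm_add; exact: Sm_mul.
- exists (fun i x => cos (f x) * G i x) => [i|x]; last exact: pdiff_comp.
  by apply: Sm_mul => //; exact: Sm_cos.
- exists (fun i x => - sin (f x) * G i x) => [i|x]; last exact: pdiff_comp.
  by apply: Sm_mul => //; apply: Sm_opp; exact: Sm_sin.
- exists (fun i x => - (f x) ^- 2 * G i x) => [i|x]; last exact: pdiffV.
  apply: Sm_mul => //; apply: Sm_opp.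
  apply: Sm_inv; last exact: Sm_exp.
  by move=> x; rewrite expf_neq0.
- exists (fun i x => (- k%:R * ebump k.+1 (f x) + ebump k.+2 (f x)) * G i x) => [i|x].
    apply: Sm_mul => //; apply: Sm_add; last exact: Sm_bump.
    by apply: Sm_mul; [exact: Sm_cst|exact: Sm_bump].
  by apply: pdiff_comp => //; exact: is_derive_bump.
Qed.

Lemma Sm_partial f i : Sm f -> Sm (partial i f).
Proof.
move=> /Sm_pdiff[G sG dG]; have := sG i; congr Sm.
by apply/funext => x; have [_ ->] := dG x.
Qed.

Lemma Sm_differentiable f x : Sm f -> differentiable f x.
Proof. by move=> /Sm_pdiff[G _ dG]; have [] := dG x. Qed.

Lemma Sm_smooth f : Sm f -> smooth f.
Proof.
move=> sf s x; apply: Sm_differentiable.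
by elim: s => //= i s IH; exact: Sm_partial.
Qed.

Lemma smooth_partial f i : smooth f -> smooth (partial i f).
Proof. by move=> sf s x; have := sf (rcons s i) x; rewrite foldr_rcons. Qed.

Lemma smooth_differentiable f x : smooth f -> differentiable f x.
Proof. by move=> /(_ [::] x). Qed.

End calculus.

(** * Symbol classes: derivatives of order j bounded by r^(-p-j) *)

Section nice.
Context {R : realType} {m : nat}.
Implicit Types (f g : 'rV[R]_m -> R) (x : 'rV[R]_m) (i j : 'I_m) (n p q : nat) (M : R).

(** Nothing is asked at the origin, where the partial derivatives of a singular function carry no
    information. Since r <= 1 in the bounds, the classes grow with p. The same M serves all orders
    up to n. *)
Fixpoint nice n p M f : Prop :=
  [/\ forall x, x != 0 -> differentiable f x,
      forall x, x != 0 -> enorm x <= 1 -> `|f x| <= M * rinv x ^+ p &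
      if n is n'.+1 then forall i, nice n' p.+1 M (partial i f) else True].

Lemma nice_diff n p M f x : nice n p M f -> x != 0 -> differentiable f x.
Proof. by case: n => [|n] [H _ _]; exact: H. Qed.

Lemma nice_bound n p M f x : nice n p M f -> x != 0 -> enorm x <= 1 ->
  `|f x| <= M * rinv x ^+ p.
Proof. by case: n => [|n] [_ H _]; exact: H. Qed.

Lemma nice_partial n p M f i : nice n.+1 p M f -> nice n p.+1 M (partial i f).
Proof. by case=> _ _ H; exact: H. Qed.

Lemma niceW n p M f : nice n.+1 p M f -> nice n p M f.
Proof.
elim: n p f => [|n IH] p f [df bf pf]; split => // i.
exact: IH.
Qed.

Lemma nice_anti n n' p M f : (n' <= n)%N -> nice n p M f -> nice n' p M f.
Proof.
move=> /subnKC <-; elim: (n - n')%N => [|k IH]; first by rewrite addn0.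
by rewrite addnS => /niceW.
Qed.

Lemma nice_le n p q M M' f : M <= M' -> (p <= q)%N -> nice n p M f -> nice n q M' f.
Proof.
move=> MM'; elim: n p q f => [|n IH] p q f pq [df bf pf]; split => //; last first.
  by move=> i; apply: IH (pf i).
all: move=> x x0 x1; have ix := rinv_ge1 x0 x1; have ip := rinv_gt0 x0.
all: have Mp := bf x x0 x1; have M0 : 0 <= M by
  have := le_trans (normr_ge0 _) Mp; rewrite pmulr_lge0// exprn_gt0.
all: apply: (le_trans Mp); apply: ler_pM => //; rewrite ?exprn_ge0 ?(ltW ip)//.
all: by apply: ler_weXn2l.
Qed.

Lemma partial_off0 f g i : (forall x, x != 0 -> f x = g x) ->
  forall x, x != 0 -> partial i f x = partial i g x.
Proof.
move=> fg x x0; apply: near_eq_derive.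
have : \forall y \near x, y != 0 by apply: open_nbhs_nbhs; split => //; exact: open_neq0.
by apply: filterS => y /fg.
Qed.

Lemma differentiable_off0 f g : (forall x, x != 0 -> f x = g x) ->
  forall x, x != 0 -> differentiable f x -> differentiable g x.
Proof.
move=> fg x x0; apply: near_eq_differentiable.
have : \forall y \near x, y != 0 by apply: open_nbhs_nbhs; split => //; exact: open_neq0.
by apply: filterS => y /fg.
Qed.

Lemma nice_off0 n p M f g : (forall x, x != 0 -> f x = g x) ->
  nice n p M f -> nice n p M g.
Proof.
elim: n p f g => [|n IH] p f g fg [df bf pf]; split => //.
- by move=> x x0; apply: differentiable_off0 (df _ x0).
- by move=> x x0; rewrite -fg//; exact: bf.
- by move=> x x0; apply: differentiable_off0 (df _ x0).
- by move=> x x0; rewrite -fg//; exact: bf.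
- by move=> i; apply: IH (pf i); exact: partial_off0.
Qed.

Lemma nice_add n p M M' f g : nice n p M f -> nice n p M' g ->
  nice n p (M + M') (fun x => f x + g x).
Proof.
elim: n p f g => [|n IH] p f g [df bf pf] [dg bg pg]; split => //.
1,3: by move=> x x0; apply: differentiableD; [exact: df|exact: dg].
1,2: move=> x x0 x1; rewrite mulrDl; apply: le_trans (ler_normD _ _) _.
1,2: by apply: lerD; [exact: bf|exact: bg].
move=> i; apply: nice_off0 (IH _ _ _ (pf i) (pg i)) => x x0.
by have [_ ->] := pdiffD (pdiffP (df x x0)) (pdiffP (dg x x0)).
Qed.

(** Each application of the Leibniz rule doubles the number of terms, whence the factor 2^n. *)
Lemma nice_mul n p q M M' f g : nice n p M f -> nice n q M' g ->
  nice n (p + q) (2 ^+ n * M * M') (fun x => f x * g x).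
Proof.
elim: n p q f g => [|n IH] p q f g [df bf pf] [dg bg pg]; split => //.
1,3: by move=> x x0; apply: differentiableM; [exact: df|exact: dg].
1,2: move=> x x0 x1; rewrite normrM exprD.
1: have -> : 2 ^+ 0 * M * M' * (rinv x ^+ p * rinv x ^+ q) =
   (M * rinv x ^+ p) * (M' * rinv x ^+ q) by rewrite expr0; ring.
1: by apply: ler_pM => //; [exact: bf|exact: bg].
1: apply: (@le_trans _ _ ((M * rinv x ^+ p) * (M' * rinv x ^+ q))).
1: by apply: ler_pM => //; [exact: bf|exact: bg].
1: have M0 : 0 <= (M * rinv x ^+ p) * (M' * rinv x ^+ q).
1: by apply: mulr_ge0; apply: le_trans (normr_ge0 _) _; [exact: bf|exact: bg].
1: have -> : 2 ^+ n.+1 * M * M' * (rinv x ^+ p * rinv x ^+ q) =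
   2 ^+ n.+1 * ((M * rinv x ^+ p) * (M' * rinv x ^+ q)) by ring.
1: by apply: ler_peMl => //; apply: exprn_ege1; rewrite ler1n.
move=> i.
have n1 : nice n (p + q).+1 (2 ^+ n * M * M') (fun x => partial i f x * g x).
  by rewrite -addSn; apply: (IH _ _ _ _ (pf i)); apply: (@niceW _ _ _ g); split.
have n2 : nice n (p + q).+1 (2 ^+ n * M * M') (fun x => f x * partial i g x).
  by rewrite -addnS; apply: (IH _ _ _ _ _ (pg i)); apply: (@niceW _ _ _ f); split.
have -> : 2 ^+ n.+1 * M * M' = 2 ^+ n * M * M' + 2 ^+ n * M * M' by rewrite exprS; ring.
apply: nice_off0 (nice_add n1 n2) => x x0.
by have [_ ->] := pdiffM (pdiffP (df x x0)) (pdiffP (dg x x0)).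
Qed.

Lemma nice_cst n p (c : R) : nice n p `|c| (fun=> c).
Proof.
suff H k p' : nice k p' `|c| (fun=> 0).
  have dc : forall x, x != 0 -> differentiable (fun=> c) x by move=> x _; exact: (pdiff_cst c x).1.
  have bc : forall x, x != 0 -> enorm x <= 1 -> `|c| <= `|c| * rinv x ^+ p.
    by move=> x x0 x1; rewrite ler_peMr// exprn_ege1// rinv_ge1.
  case: n => [|n]; split => // i; rewrite (_ : partial i _ = fun=> 0)//; apply/funext => x.
  by have [_ ->] := pdiff_cst c x.
have d0 : forall x, x != 0 -> differentiable (fun=> 0 : R) x by move=> x _; exact: (pdiff_cst 0 x).1.
have b0 q : forall x, x != 0 -> enorm x <= 1 -> `|0 : R| <= `|c| * rinv x ^+ q.
  by move=> x x0 x1; rewrite normr0 mulr_ge0// exprn_ge0// rinv_ge0.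
elim: k p' => [|k IH] p'; split; try exact: d0; try exact: b0; first by [].
move=> i; rewrite (_ : partial i _ = fun=> 0)//; apply/funext => x.
by have [_ ->] := pdiff_cst 0 x.
Qed.

Definition Nice n p f := exists M, nice n p M f.

Lemma Nice_add n p f g : Nice n p f -> Nice n p g -> Nice n p (fun x => f x + g x).
Proof. by move=> [M nf] [M' ng]; exists (M + M'); exact: nice_add. Qed.

Lemma Nice_mul n p q f g : Nice n p f -> Nice n q g -> Nice n (p + q) (fun x => f x * g x).
Proof. by move=> [M nf] [M' ng]; eexists; exact: nice_mul nf ng. Qed.

Lemma Nice_cst n p c : Nice n p (fun=> c).
Proof. by exists `|c|; exact: nice_cst. Qed.

Lemma Nice_le n p q f : (p <= q)%N -> Nice n p f -> Nice n q f.
Proof. by move=> pq [M nf]; exists M; exact: nice_le nf. Qed.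

Lemma Nice_off0 n p f g : (forall x, x != 0 -> f x = g x) -> Nice n p f -> Nice n p g.
Proof. by move=> fg [M nf]; exists M; exact: nice_off0 nf. Qed.

Lemma Nice_opp n p f : Nice n p f -> Nice n p (fun x => - f x).
Proof.
move=> nf; have := Nice_mul (Nice_cst n 0 (-1)) nf.
by apply: Nice_off0 => x _; rewrite mulN1r.
Qed.

Lemma Nice_sub n p f g : Nice n p f -> Nice n p g -> Nice n p (fun x => f x - g x).
Proof. by move=> nf /Nice_opp; exact: Nice_add. Qed.

Lemma Nice_sum n p (I : Type) (r : seq I) (F : I -> 'rV[R]_m -> R) :
  (forall k, Nice n p (F k)) -> Nice n p (fun x => \sum_(k <- r) F k x).
Proof.
move=> nF; elim: r => [|k r IH].
  by apply: Nice_off0 (Nice_cst n p 0) => x _; rewrite big_nil.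
by apply: Nice_off0 (Nice_add (nF k) IH) => x _; rewrite big_cons.
Qed.

Lemma Nice_partial n p f i : Nice n.+1 p f -> Nice n p.+1 (partial i f).
Proof. by move=> [M nf]; exists M; exact: nice_partial. Qed.

Lemma Nice_anti n n' p f : (n' <= n)%N -> Nice n p f -> Nice n' p f.
Proof. by move=> nn [M nf]; exists M; exact: nice_anti nf. Qed.

Lemma Nice_diff n p f x : Nice n p f -> x != 0 -> differentiable f x.
Proof. by move=> [M nf]; exact: nice_diff nf. Qed.

Lemma nice_uniform n p (I : finType) (F : I -> 'rV[R]_m -> R) :
  (forall k, Nice n p (F k)) -> exists M, forall k, nice n p M (F k).
Proof.
move=> /choice[M nM]; exists (\sum_k `|M k|) => k.
apply: nice_le (nM k) => //; rewrite (bigD1 k)//=.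
by apply: (le_trans (ler_norm _)); rewrite lerDl sumr_ge0.
Qed.

Lemma bounded_cball f : continuous f -> exists2 M, 0 <= M &
  forall x, enorm x <= 1 -> `|f x| <= M.
Proof.
move=> cf.
pose K := [set v : 'rV[R]_m | forall i, `[-1, 1]%classic (v ord0 i)].
have cK : compact K.
  by apply: (@rV_compact R m (fun=> `[-1, 1]%classic)) => _; exact: segment_compact.
have /compact_bounded[M [_ bM]] : compact (f @` K).
  by apply: continuous_compact => //; exact: continuous_subspaceT.
exists (`|M| + 1); first by rewrite addr_ge0.
move=> x x1; apply: (bM (`|M| + 1)); first by rewrite (le_lt_trans (ler_norm _))// ltrDl.
exists x => // i /=; rewrite in_itv /= -ler_norml.
exact: le_trans (enorm_coord x i) x1.
Qed.

Lemma Nice_smooth n f : smooth f -> Nice n 0 f.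
Proof.
elim: n f => [|n IH] f sf.
  have [|M M0 fM] := bounded_cball (f := f).
    by move=> x; apply: differentiable_continuous; exact: smooth_differentiable.
  exists M; split => // [x _|x x0 x1]; first exact: smooth_differentiable.
  by rewrite expr0 mulr1; exact: fM.
have [|M M0 fM] := bounded_cball (f := f).
  by move=> x; apply: differentiable_continuous; exact: smooth_differentiable.
have [M' pM] := nice_uniform (fun i => IH _ (smooth_partial i sf)).
exists (M + `|M'|); split => // [x _|x x0 x1|i]; first exact: smooth_differentiable.
  rewrite expr0 mulr1; apply: le_trans (fM x x1) _; by rewrite lerDl.
apply: nice_le (pM i) => //; apply: (le_trans (ler_norm _)); by rewrite lerDr.
Qed.

Lemma Nice_Sm n f : Sm f -> Nice n 0 f.
Proof. by move=> /Sm_smooth; exact: Nice_smooth. Qed.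

Definition angl i x : R := x ord0 i * rinv x.

Lemma angl_le1 i x : `|angl i x| <= 1.
Proof.
have [->|x0] := eqVneq x 0; first by rewrite /angl mxE mul0r normr0.
rewrite normrM (ger0_norm (rinv_ge0 x)) ler_pdivrMr ?enorm_gt0// mul1r.
exact: enorm_coord.
Qed.

Lemma sum_angl2 x : x != 0 -> \sum_i angl i x ^+ 2 = 1.
Proof.
move=> x0; under eq_bigr do rewrite exprMn; rewrite -mulr_suml -/(rho x) rinv2.
by rewrite divff// lt0r_neq0// rho_gt0.
Qed.

Lemma pdiff_rinv_angl x : x != 0 -> pdiff rinv x (fun k => - (angl k x) * rinv x ^+ 2).
Proof. exact: pdiff_rinv. Qed.

Lemma pdiff_angl i x : x != 0 ->
  pdiff (angl i) x (fun k => rinv x * ((k == i)%:R - angl i x * angl k x)).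
Proof.
move=> x0; have := pdiffM (pdiff_coord i x) (pdiff_rinv x0).
by apply: pdiff_fext => // k; rewrite /angl; ring.
Qed.

(** The induction has to treat both families together: the gradient of 1/r is -(x_k/r) r^(-2), and
    that of x_i/r is r^(-1) times a quadratic expression in the x_k/r. *)
Lemma Nice_rinv_angl n : Nice n 1 rinv /\ forall i, Nice n 0 (angl i).
Proof.
elim: n => [|n [ni na]].
  split; first exists 1; first split => // [x x0|x x0 x1].
  - exact: (pdiff_rinv x0).1.
  - by rewrite mul1r expr1 ger0_norm// rinv_ge0.
  move=> i; exists 1; split => // [x x0|x x0 x1].
  - exact: (pdiff_angl i x0).1.
  - by rewrite expr0 mulr1 angl_le1.
have nI k : Nice n 2 (partial k rinv).
  apply: Nice_off0 (Nice_mul (Nice_opp (na k)) (Nice_mul ni ni)) => x x0.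
  by rewrite (pdiff_rinv_angl x0).2 expr2.
have nA i k : Nice n 1 (partial k (angl i)).
  apply: Nice_off0 (Nice_mul ni (Nice_sub (Nice_cst n 0 (k == i)%:R) (Nice_mul (na i) (na k)))) => x x0.
  by rewrite (pdiff_angl i x0).2.
have [M pM] := nice_uniform nI.
have [M' pM'] := nice_uniform (fun z : 'I_m * 'I_m => nA z.1 z.2).
split.
  exists (1 + `|M|); split => [x x0|x x0 x1|k]; first exact: (pdiff_rinv x0).1.
    rewrite expr1 ger0_norm ?rinv_ge0// ler_peMl ?rinv_ge0//; by rewrite lerDl.
  by apply: nice_le (pM k) => //; apply: (le_trans (ler_norm _)); rewrite lerDr.
move=> i; exists (1 + `|M'|); split => [x x0|x x0 x1|k]; first exact: (pdiff_angl i x0).1.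
  by rewrite expr0 mulr1 (le_trans (angl_le1 i x))// lerDl.
by apply: nice_le (pM' (i, k)) => //; apply: (le_trans (ler_norm _)); rewrite lerDr.
Qed.

Lemma Nice_rinv n : Nice n 1 rinv. Proof. by have [] := Nice_rinv_angl n. Qed.
Lemma Nice_angl n i : Nice n 0 (angl i). Proof. by have [_] := Nice_rinv_angl n. Qed.

(* The constant C does not depend on the outer function. *)
Lemma nice_comp n f : Nice n 0 f -> exists2 C, 0 <= C &
  forall (g : nat -> R -> R) (K : R),
    (forall (j : nat) (t : R), (j <= n)%N -> is_derive t 1 (g j) (g j.+1 t)) ->
    (forall (j : nat) x, (j <= n)%N -> x != 0 -> enorm x <= 1 -> `|g j (f x)| <= K) ->
    nice n 0 (C * K) (fun x => g 0 (f x)).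
Proof.
elim: n => [|n IH] [M nf].
  exists 1 => // g K dg bg; split => // x x0; last first.
    by move=> x1; rewrite mul1r expr0 mulr1; exact: bg.
  exact: (pdiff_comp (pdiffP (nice_diff nf x0)) (dg 0%N _ (leqnn _))).1.
have nf' : Nice n 0 f by exists M; exact: niceW.
have [C C0 HC] := IH nf'.
exists (1 + 2 ^+ n * C * `|M|) => [|g K dg bg].
  by rewrite addr_ge0// !mulr_ge0// exprn_ge0.
have K0 x : x != 0 -> enorm x <= 1 -> 0 <= K.
  by move=> x0 x1; apply: le_trans (normr_ge0 _) (bg 0%N x (leq0n _) x0 x1).
split.
- move=> x x0; exact: (pdiff_comp (pdiffP (nice_diff nf x0)) (dg 0%N _ (leq0n _))).1.
- move=> x x0 x1; rewrite expr0 mulr1; apply: le_trans (bg 0%N x (leq0n _) x0 x1) _.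
  rewrite ler_peMl ?(K0 x)// lerDl !mulr_ge0// exprn_ge0//.
move=> i.
have n1 : nice n 0 (C * K) (fun x => g 1%N (f x)).
  refine (HC (fun j : nat => g j.+1) K _ _) => [j t jn|j x jn]; [exact: dg|exact: bg].
(* Without a nonzero point in the ball, that is for m = 0, the sign of K is unknown, but then every
   bound is vacuous. *)
have [K1|K1] := pselect (exists x : 'rV[R]_m, x != 0 /\ enorm x <= 1); last first.
  have H0 : forall x : 'rV[R]_m, x != 0 -> enorm x <= 1 -> False.
    by move=> x x0 x1; apply: K1; exists x.
  have := nice_mul n1 (nice_partial i nf).
  have H : forall k p A B h, nice k p A h -> nice k p B h.
    elim=> [|k IHk] p A B h [d1 b1 p1]; split => //.
    + by move=> x x0 /(H0 x x0).
    + by move=> x x0 /(H0 x x0).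
    + by move=> j; exact: IHk (p1 j).
  move=> /(H _ _ _ ((1 + 2 ^+ n * C * `|M|) * K)); apply: nice_off0 => x x0.
  by rewrite (pdiff_comp (pdiffP (nice_diff nf x0)) (dg 0%N _ (leq0n _))).2.
have {K1}K0' : 0 <= K by case: K1 => x [x0 x1]; exact: (K0 x).
apply: (@nice_le _ _ _ (2 ^+ n * (C * K) * M)); last 1 first.
- apply: nice_off0 (nice_mul n1 (nice_partial i nf)) => x x0.
  by rewrite (pdiff_comp (pdiffP (nice_diff nf x0)) (dg 0%N _ (leq0n _))).2.
- apply: (@le_trans _ _ (2 ^+ n * (C * K) * `|M|)).
    by apply: ler_wpM2l; [rewrite !mulr_ge0// exprn_ge0|exact: ler_norm].
  rewrite mulrDl mul1r (_ : _ * `|M| = 2 ^+ n * C * `|M| * K); last by ring.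
  by rewrite lerDr.
- by [].
Qed.

(** With e = 1/(k+1), this is the relative error of the regularisation of r^(-2): r^(-2) - (r^2 +
    e)^(-1) = r^(-2) [zeta k]. *)
Definition zeta k x : R := k.+1%:R^-1 / (rho x + k.+1%:R^-1).

Lemma Sm_zeta k : Sm (zeta k).
Proof.
apply: Sm_mul; first exact: Sm_cst.
apply: Sm_inv => [x|]; last by apply: Sm_add; [exact: Sm_rho|exact: Sm_cst].
by rewrite lt0r_neq0// ltr_wpDl ?rho_ge0// invr_gt0 ltr0n.
Qed.

Lemma zeta_ge0 k x : 0 <= zeta k x.
Proof. by rewrite divr_ge0 ?addr_ge0 ?rho_ge0 ?invr_ge0. Qed.

Lemma zeta_le1 k x : zeta k x <= 1.
Proof.
rewrite ler_pdivrMr ?mul1r ?lerDr ?rho_ge0//.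
by rewrite ltr_wpDl ?rho_ge0// invr_gt0 ltr0n.
Qed.

Lemma zeta_le_rinv2 k x : x != 0 -> zeta k x <= k.+1%:R^-1 * rinv x ^+ 2.
Proof.
move=> x0; rewrite rinv2; apply: ler_wpM2l; first by rewrite invr_ge0.
rewrite lef_pV2 ?posrE ?rho_gt0// ?lerDl ?invr_ge0//.
by rewrite ltr_wpDl ?rho_ge0// invr_gt0 ltr0n.
Qed.

Lemma partial_zeta k i x : x != 0 ->
  partial i (zeta k) x = (-2 * (angl i x * rinv x)) * (zeta k x * (1 - zeta k x)).
Proof.
move=> x0.
have e0 : (0 : R) < k.+1%:R^-1 by rewrite invr_gt0 ltr0n.
have r0 : rho x + k.+1%:R^-1 != 0 by rewrite lt0r_neq0// ltr_wpDl ?rho_ge0.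
have := pdiffM (pdiff_cst k.+1%:R^-1 x)
  (pdiffV r0 (pdiffD (pdiff_rho x) (pdiff_cst k.+1%:R^-1 x))).
move=> [_ ->]; rewrite /angl -mulrA -[_ * rinv x]mulrA -expr2 rinv2 /zeta.
have : rho x != 0 by rewrite lt0r_neq0// rho_gt0.
move: e0 r0; move: (rho x) (k.+1%:R^-1 : R) => r e e0 r0 rn0.
by field; rewrite r0 rn0.
Qed.

(** The gradient of [zeta k] is a function of order 1 free of k times the polynomial zeta (1 -
    zeta). Hence the uniform bound and the bound that gains 1/(k+1) at the price of r^(-2) both pass
    to derivatives. *)
Lemma nice_zeta n : exists C, forall k,
  nice n 0 C (zeta k) /\ nice n 2 (C * k.+1%:R^-1) (zeta k).
Proof.
elim: n => [|n [C HC]].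
  exists 1 => k; split; split => // x x0; try exact/Sm_differentiable/Sm_zeta.
    by move=> _; rewrite expr0 mulr1 ger0_norm ?zeta_ge0 ?zeta_le1.
  by move=> _; rewrite mul1r ger0_norm ?zeta_ge0 ?zeta_le_rinv2.
have [A nA] : exists A, forall i, nice n 1 A (fun x => -2 * (angl i x * rinv x)).
  apply: nice_uniform => i; apply: (Nice_mul (Nice_cst n 0 (-2))).
  exact: (Nice_mul (Nice_angl n i) (Nice_rinv n)).
have n1 k : nice n 0 (`|1| + 2 ^+ n * `|-1| * C) (fun x => 1 - zeta k x).
  have := nice_add (nice_cst n 0 1) (nice_mul (nice_cst n 0 (-1)) (HC k).1).
  by apply: nice_off0 => x _; rewrite mulN1r.
pose B := `|1| + 2 ^+ n * `|-1| * C : R.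
pose D := 2 ^+ n * A * (2 ^+ n * C * B).
have pz i k x : x != 0 -> (-2 * (angl i x * rinv x)) * (zeta k x * (1 - zeta k x)) =
   partial i (zeta k) x by move=> x0; rewrite partial_zeta.
exists (1 + `|D|) => k; split; split => [x x0|x x0 x1|i].
- exact/Sm_differentiable/Sm_zeta.
- rewrite expr0 mulr1 ger0_norm ?zeta_ge0// (le_trans (zeta_le1 _ _))//; by rewrite lerDl.
- apply: (@nice_le _ 1 _ D) => //.
    by apply: (le_trans (ler_norm _)); rewrite lerDr.
  exact: (nice_off0 (pz i k) (nice_mul (nA i) (nice_mul (HC k).1 (n1 k)))).
- exact/Sm_differentiable/Sm_zeta.
- rewrite ger0_norm ?zeta_ge0// (le_trans (zeta_le_rinv2 _ _))//.
  have P0 : 0 <= k.+1%:R^-1 * rinv x ^+ 2 by rewrite mulr_ge0 ?invr_ge0// exprn_ge0// rinv_ge0.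
  by rewrite -mulrA ler_peMl// lerDl.
- refine (@nice_le n 3 3 (2 ^+ n * A * (2 ^+ n * (C * k.+1%:R^-1) * B)) _ (partial i (zeta k)) _ _ _) => //.
    rewrite (_ : _ * _ = D * k.+1%:R^-1); last by rewrite /D; ring.
    apply: ler_wpM2r; first by rewrite invr_ge0.
    by apply: (le_trans (ler_norm _)); rewrite lerDr.
  exact: (nice_off0 (pz i k) (nice_mul (nA i) (nice_mul (HC k).2 (n1 k)))).
Qed.

End nice.

(** * Difference quotients along coordinate lines *)

Section directional.
Context {R : realType} {m : nat}.
Implicit Types (f g G F : 'rV[R]_m -> R) (x : 'rV[R]_m) (i : 'I_m).

Lemma partial_seq G x i (h : nat -> R) : derivable G x (delta_mx ord0 i) ->
  (forall n, h n != 0) -> h n @[n --> \oo] --> 0 ->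
  (h n)^-1 * (G (x + h n *: delta_mx ord0 i) - G x) @[n --> \oo] --> partial i G x.
Proof.
move=> dG h0 hc.
have /cvgr_dnbhsP/(_ h (conj h0 hc)) := dG.
rewrite /comp /=; under eq_fun do rewrite [_ + x]addrC; exact.
Qed.

Lemma is_derive_line G x i (t : R) : derivable G (x + t *: delta_mx ord0 i) (delta_mx ord0 i) ->
  is_derive t 1 (fun s => G (x + s *: delta_mx ord0 i)) (partial i G (x + t *: delta_mx ord0 i)).
Proof.
move=> dG.
have E : (fun h : R => h^-1 *: (((fun s => G (x + s *: delta_mx ord0 i)) \o shift t) (h *: 1) -
     G (x + t *: delta_mx ord0 i))) =
   (fun h : R => h^-1 *: ((G \o shift (x + t *: delta_mx ord0 i)) (h *: delta_mx ord0 i) -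
      G (x + t *: delta_mx ord0 i))).
  apply/funext => h /=; congr (_ *: (G _ - _)).
  by rewrite scalerDl [h *: 1]mulr1 addrCA.
by split; rewrite /derivable /partial /derive E.
Qed.

Lemma line_lipschitz G i (L : R) : (forall x, derivable G x (delta_mx ord0 i)) ->
  (forall x, `|partial i G x| <= L) ->
  forall x (h : R), 0 < h -> `|h^-1 * (G (x + h *: delta_mx ord0 i) - G x)| <= L.
Proof.
move=> dG bG x h h0.
have dl t := is_derive_line (dG (x + t *: delta_mx ord0 i)).
have [|c _] := @MVT _ _ (fun t => partial i G (x + t *: delta_mx ord0 i)) _ _ h0 (fun t _ => dl t).
  apply: derivable_within_continuous => t _; exact: (@ex_derive _ _ _ _ _ _ _ (dl t)).
rewrite scale0r addr0 subr0 => ->.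
by rewrite mulrC mulfK ?lt0r_neq0//.
Qed.

Lemma enorm_line x i (h : R) : 0 <= h * x ord0 i -> enorm x <= enorm (x + h *: delta_mx ord0 i).
Proof.
move=> hx; rewrite -(@ler_pXn2r _ 2)// ?nnegrE ?enorm_ge0// !sqr_enorm.
apply: ler_sum => j _; rewrite !mxE eqxx /= sqrrD.
have [->|_] := eqVneq j i; last by rewrite mulr0 mulr0 mul0rn expr0n addr0 addr0.
by rewrite mulr1 -addrA lerDl addr_ge0 ?sqr_ge0// mulrn_wge0// mulrC.
Qed.

(** Moving along e_i with the sign of x_i does not decrease the norm, so the quotients on that side
    are 0. This one-sided argument also covers the points of the sphere. *)
Lemma partial_outside G x i : derivable G x (delta_mx ord0 i) ->
  (forall y, 1 <= enorm y -> G y = 0) -> 1 <= enorm x -> partial i G x = 0.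
Proof.
move=> dG G0 x1.
pose c : R := if 0 <= x ord0 i then 1 else -1.
have c0 : c != 0 by rewrite /c; case: ifP; rewrite ?oner_eq0// oppr_eq0 oner_eq0.
have cx : 0 <= c * x ord0 i.
  rewrite /c; case: ifPn; first by rewrite mul1r.
  by rewrite -ltNge => /ltW; rewrite mulN1r oppr_ge0.
have h0 n : c * n.+1%:R^-1 != 0 by rewrite mulf_neq0// invr_eq0 pnatr_eq0.
have hc : c * n.+1%:R^-1 @[n --> \oo] --> 0.
  by rewrite -(mulr0 c); apply: cvgM; [exact: cvg_cst|exact: cvg_harmonic].
have := partial_seq dG h0 hc.
suff -> : (fun n => (c * n.+1%:R^-1)^-1 * (G (x + (c * n.+1%:R^-1) *: delta_mx ord0 i) - G x)) = cst 0.
  by move=> H; apply: (cvg_unique (@Rhausdorff R) H); exact: cvg_cst.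
apply/funext => n; rewrite !G0 ?subrr ?mulr0//.
apply: (le_trans x1); apply: enorm_line.
by rewrite mulrAC mulr_ge0// invr_ge0.
Qed.

End directional.

(** * Domination by r^(-4), and integrals of bounded derivatives *)

Section integration.
Context {R : realType} {m : nat}.
Hypothesis m5 : (5 <= m)%N.
Implicit Types (f g G F : 'rV[R]_m -> R) (x : 'rV[R]_m) (i : 'I_m) (M : R).
Notation mu := (@lebesgue_rV R m).
Notation B := (@uball R m).

Let m0 : (0 < m)%N. Proof. exact: leq_trans m5. Qed.

Lemma measurable_fun_continuous (D : set 'rV[R]_m) f : measurable D -> continuous f -> measurable_fun D f.
Proof. by move=> mD cf; apply: measurable_fun_neq0 => // x _; exact: cf. Qed.

Lemma differentiable_measurable (D : set 'rV[R]_m) f : measurable D ->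
  (forall x, x != 0 -> differentiable f x) -> measurable_fun D f.
Proof.
move=> mD df; apply: measurable_fun_neq0 => // x x0.
exact/differentiable_continuous/df.
Qed.

Lemma Nice_measurable n p f : Nice n p f -> measurable_fun B f.
Proof.
move=> nf; apply: differentiable_measurable; first exact: measurable_uball.
by move=> x; exact: Nice_diff nf.
Qed.

Lemma integrable_cst_uball (c : R) : mu.-integrable B (fun=> c%:E).
Proof.
apply/integrableP; split; first exact: measurable_cst.
rewrite integral_cst//; last exact: measurable_uball.
by rewrite lte_mul_pinfty// ?mu_uball_lty.
Qed.

Lemma integrable_rinv4_bound f M : measurable_fun B f ->
  (forall x, x != 0 -> enorm x <= 1 -> `|f x| <= M * rinv x ^+ 4) ->
  mu.-integrable B (EFin \o f).
Proof.
move=> mf bf.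
(* The constant [|f 0|] covers the origin, where [rinv] is 0 and no bound on f is given. *)
apply: (@le_integrable _ _ _ mu B measurable_uball _ (fun x => (`|M| * rinv x ^+ 4)%:E + (`|f 0|)%:E)%E).
- exact/measurable_EFinP.
- move=> x x1; change (`|f x|%:E <= `| `|M| * rinv x ^+ 4 + `|f 0| |%:E)%E; rewrite lee_fin.
  have [->|x0] := eqVneq x 0; first by rewrite /rinv enorm0 invr0 expr0n mulr0 add0r normr_id.
  apply: le_trans (bf x x0 (ltW x1)) _.
  apply: le_trans (ler_norm _); apply: ler_wpDr => //; apply: ler_wpM2r (ler_norm _).
  by rewrite exprn_ge0// rinv_ge0.
- apply: integrableD; [exact: measurable_uball| |exact: integrable_cst_uball].
  under eq_fun do rewrite EFinM.
  by apply: integrableZl; [exact: measurable_uball|exact: integrable_rinv4].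
Qed.

Lemma Nice_integrable n p f : (p <= 4)%N -> Nice n p f -> mu.-integrable B (EFin \o f).
Proof.
move=> p4 nf; have mf := Nice_measurable nf.
have [M nM] := Nice_le p4 nf.
by apply: integrable_rinv4_bound mf _ => x x0 x1; exact: (nice_bound nM).
Qed.

Lemma ae_neq0 : {ae mu, forall x, x != 0}.
Proof.
exists [set 0]; split; [exact: measurable_rV_set1|exact: set1_rV_null|].
by move=> x /= /negP; rewrite negbK => /eqP.
Qed.

Lemma eq_integral_off0 f g : measurable_fun B f -> measurable_fun B g ->
  (forall x, x != 0 -> B x -> f x = g x) ->
  (\int[mu]_(x in B) (f x)%:E = \int[mu]_(x in B) (g x)%:E)%E.
Proof.
move=> mf mg fg; apply: ae_eq_integral.
- exact: measurable_uball.
- exact/measurable_EFinP.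
- exact/measurable_EFinP.
- by apply: filterS ae_neq0 => x x0 Bx; rewrite /= fg.
Qed.

Lemma cvg_bound_harmonic (u : nat -> R) (l A : R) :
  (forall k, `|u k - l| <= A * k.+1%:R^-1) -> u k @[k --> \oo] --> l.
Proof.
move=> H; apply/subr_cvg0.
apply: norm_cvg0.
have hA : A * k.+1%:R^-1 @[k --> \oo] --> 0.
  by rewrite -(mulr0 A); apply: cvgM; [exact: cvg_cst|exact: cvg_harmonic].
apply: (squeeze_cvgr _ (cvg_cst 0) hA).
by apply: nearW => k; rewrite normr_ge0 H.
Qed.

Lemma dominated_rinv4 (F : nat -> 'rV[R]_m -> R) f M :
  (forall k, measurable_fun B (F k)) -> measurable_fun B f ->
  (forall k x, x != 0 -> B x -> `|F k x| <= M * rinv x ^+ 4) ->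
  (forall x, x != 0 -> B x -> F k x @[k --> \oo] --> f x) ->
  ((\int[mu]_(x in B) (F k x)%:E) @[k --> \oo] --> \int[mu]_(x in B) (f x)%:E)%E.
Proof.
move=> mF mf bF cF.
have [] // := @dominated_convergence _ _ _ mu B measurable_uball
  (fun k x => (F k x)%:E) (EFin \o f) (fun x => (M%:E * (rinv x ^+ 4)%:E)%E).
- by move=> k; exact/measurable_EFinP.
- exact/measurable_EFinP.
- by apply: filterS ae_neq0 => x x0 Bx; apply: cvg_EFin; [exact: nearW|exact: cF].
- by apply: integrableZl; [exact: measurable_uball|exact: integrable_rinv4].
- by apply: filterS ae_neq0 => x x0 k Bx; rewrite -EFinM lee_fin; exact: bF.
Qed.

(** Translation invariance makes the integral of each difference quotient over the whole space
    vanish. The mean value theorem bounds the quotients by L on a fixed box, dominated convergence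
    gives the derivative, and the derivative is 0 outside the ball. *)
Lemma integral_partial_eq0_bounded G i (L : R) : (forall x, differentiable G x) ->
  (forall x, `|partial i G x| <= L) -> (forall x, 1 <= enorm x -> G x = 0) ->
  measurable_fun setT (partial i G) ->
  (\int[mu]_(x in B) (partial i G x)%:E = 0)%E.
Proof.
move=> dG bG G0 mpG.
have cG : continuous G by move=> x; exact/differentiable_continuous.
have dG' x : derivable G x (delta_mx ord0 i) by exact: diff_derivable.
have mG : measurable_fun setT G by exact: measurable_fun_continuous.
(* Steps are at most 1, so all quotients of a function supported in the unit ball live well inside
   half-side 3. *)
pose box := @obox R m (fun=> -3) (fun=> 3).
have mbox : measurable box by exact: measurable_obox.
have [M M0 bM] := bounded_cball cG.
have bM' x : `|G x| <= M * \1_box x.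
  have [x1|x1] := leP 1 (enorm x).
    by rewrite G0// normr0 mulr_ge0.
  rewrite indicE mem_set ?mulr1; first by rewrite bM// ltW.
  move=> j; have := le_lt_trans (enorm_coord x j) x1; rewrite ltr_norml => /andP[? ?].
  by apply/andP; split; lra.
have ibox c : mu.-integrable setT (fun x => (c * \1_box x)%:E).
  apply/integrableP; split.
    by apply/measurable_EFinP; apply: measurable_funM => //; exact: measurable_indic.
  under eq_integral => x _ do rewrite abse_EFin normrM (ger0_norm (_ : 0 <= \1_box x))//.
  rewrite (@integralZl_indic _ _ _ _ _ measurableT (fun=> box))//; last by rewrite ltNge normr_ge0.
  rewrite integral_indic// setIT lte_mul_pinfty//.
  exact: lebesgue_rV_obox_lty.
have iG : mu.-integrable setT (EFin \o G).
  apply: le_integrable (ibox M) => //; first exact/measurable_EFinP.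
  move=> x _ /=; rewrite lee_fin; apply: le_trans (bM' x) _; exact: ler_norm.
pose h (n : nat) : R := n.+1%:R^-1.
have h0 n : 0 < h n by rewrite invr_gt0 ltr0n.
have h1 n : h n <= 1 by rewrite invf_le1 ?ltr0n// ler1n.
pose q n x := (h n)^-1 * (G (rV_shift (h n *: delta_mx ord0 i) x) - G x).
have msh n : measurable_fun setT (fun x => G (rV_shift (h n *: delta_mx ord0 i) x)).
  by apply: (measurableT_comp mG); exact: measurable_rV_shift.
have mq n : measurable_fun setT (q n).
  by apply: measurable_funM => //; apply: measurable_funB.
have ish n : mu.-integrable setT (fun x => (G (rV_shift (h n *: delta_mx ord0 i) x))%:E).
  apply/integrableP; split; first exact/measurable_EFinP.
  have := @ge0_integral_shift R m (h n *: delta_mx ord0 i) (fun x => `|(G x)%:E|%E).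
  move=> /(_ _ _) ->; first by case/integrableP : iG.
    by apply: measurableT_comp => //; exact/measurable_EFinP.
  by move=> x; exact: abse_ge0.
have iq n : (\int[mu]_x (q n x)%:E = 0)%E.
  under eq_integral => x _ do rewrite /q EFinM EFinB.
  rewrite integralZl//; last by apply: integrableB.
  rewrite integralB//.
  rewrite (@integral_shift R m (h n *: delta_mx ord0 i) (EFin \o G)); last exact/measurable_EFinP.
  rewrite subee ?mule0//; exact: integrable_fin_num iG.
have bq n x : `|q n x| <= L * \1_box x.
  have [xb|xb] := pselect (box x).
    by rewrite indicE mem_set// mulr1; exact: line_lipschitz.
  rewrite indicE memNset// mulr0 /q.
  have big (y : 'rV[R]_m) : ~ (forall j, -2 < y ord0 j < 2) -> G y = 0.
    move=> yb; apply: G0; rewrite leNgt; apply/negP => y1; apply: yb => j.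
    have := le_lt_trans (enorm_coord y j) y1; rewrite ltr_norml => /andP[? ?].
    by apply/andP; split; lra.
  rewrite !big ?subrr ?mulr0 ?normr0//.
    by move=> H; apply: xb => j; have /andP[? ?] := H j; apply/andP; split; lra.
  move=> H; apply: xb => j; have := H j; rewrite /rV_shift !mxE eqxx /=.
  have := h1 n; have := h0 n; case: (j == i) => /= ? ? /andP[]; rewrite ?mulr1 ?mulr0 => ? ?; apply/andP; split; lra.
have [] := @dominated_convergence _ _ _ mu setT measurableT
  (fun n x => (q n x)%:E) (fun x => (partial i G x)%:E) (fun x => (L * \1_box x)%:E).
- by move=> n; exact/measurable_EFinP.
- exact/measurable_EFinP.
- apply: aeW => x _; apply: cvg_EFin; first exact: nearW.
  apply: partial_seq => // [n|]; first by rewrite lt0r_neq0.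
  exact: cvg_harmonic.
- exact: ibox.
- by apply: aeW => x n _; rewrite lee_fin; exact: bq.
move=> _ _; rewrite (_ : (fun n => _) = cst 0%E); last by apply/funext => n; exact: iq.
move=> /cvg_lim => /(_ _) H.
rewrite -[RHS](_ : (\int[mu]_x (partial i G x)%:E = 0)%E); last first.
  by rewrite -H//; apply/cvg_lim => //; exact: cvg_cst.
rewrite [LHS]integral_mkcond; apply: eq_integral => x _; rewrite patchE.
case: ifPn => //; rewrite notin_setE /uball /= => /negP; rewrite -leNgt => x1.
by rewrite (partial_outside (dG' x) G0 x1).
Qed.

End integration.

(** * Integration by parts across the origin *)

Section parts.
Context {R : realType} {m : nat}.
Hypothesis m5 : (5 <= m)%N.
Implicit Types (f g G F : 'rV[R]_m -> R) (x : 'rV[R]_m) (i : 'I_m) (M : R).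
Notation mu := (@lebesgue_rV R m).
Notation B := (@uball R m).

Lemma bump_bound k (t : R) : ebump k.+1 t <= (k.+1)`!%:R.
Proof.
have [t0|t0] := ltP 0 t; last by rewrite bump_le0.
rewrite bump_gt0//.
have ti0 : 0 <= t^-1 by rewrite invr_ge0 ltW.
have := expR_ge1Dxn k ti0.
move=> /(le_trans (ler_wpDl ler01 (lexx _))); rewrite ler_pdivrMr ?ltr0n ?fact_gt0// => H.
by rewrite expRN ler_pdivrMr ?expR_gt0// mulrC.
Qed.

(* A cutoff vanishing on the ball of radius 1/sqrt(k+1); its gradient is
   O(1/r) uniformly in k, so it is harmless for integrands of order r^-4. *)
Definition cutoff k x : R := ebump 0 (k.+1%:R * rho x - 1).

Lemma Sm_cutoff k : Sm (cutoff k).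
Proof.
apply: Sm_bump; apply: Sm_sub; last exact: Sm_cst.
by apply: Sm_mul; [exact: Sm_cst|exact: Sm_rho].
Qed.

Lemma cutoff_le1 k x : `|cutoff k x| <= 1.
Proof. by rewrite ger0_norm ?bump_ge0// bump0_le1. Qed.

Lemma partial_cutoff k i x : partial i (cutoff k) x =
  ebump 2 (k.+1%:R * rho x - 1) * (k.+1%:R * (2 * x ord0 i)).
Proof.
have d1 := pdiffM (pdiff_cst k.+1%:R x) (pdiff_rho x).
have d2 := pdiffD d1 (pdiff_cst (-1) x).
have [_ ->] := pdiff_comp d2 (is_derive_bump 0 _).
by rewrite mulNr mul0r oppr0 add0r addr0 mul0r add0r.
Qed.

(** Put t = (k+1) r^2. For t < 2 the right-hand side exceeds 1; otherwise 1 - exp(-v) <= v with v =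
    1/(t - 1) <= 2/t. *)
Lemma cutoff_near k x : x != 0 ->
  `|1 - cutoff k x| <= 2 * k.+1%:R^-1 * rinv x ^+ 2.
Proof.
move=> x0; have r0 : 0 < rho x by rewrite rho_gt0.
have k0 : (0 : R) < k.+1%:R by rewrite ltr0n.
rewrite rinv2 -mulrA -invfM ger0_norm ?subr_ge0 ?bump0_le1// /cutoff.
move: (k.+1%:R : R) (rho x) k0 r0 => K r K0 r0.
have Kr : 0 < K * r by rewrite mulr_gt0.
have [t1|t1] := leP 2 (K * r); last first.
  apply: (@le_trans _ _ 1); first by rewrite gerBl bump_ge0.
  by rewrite ler_pdivlMr// mul1r ltW.
have t0 : 0 < K * r - 1 by lra.
rewrite bump_gt0// expr0 mul1r.
apply: (@le_trans _ _ (K * r - 1)^-1).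
  by rewrite lerBlDl -lerBlDr; have := expR_ge1Dx (- (K * r - 1)^-1); lra.
rewrite -[leLHS]mul1r ler_pdivrMr// mulrAC ler_pdivlMr//; lra.
Qed.

(** With t = (k+1) r^2 and b = [ebump 2 (t - 1)], r times the derivative is at most 2 t b = 2 (t -
    1) b + 2 b. Here (t - 1) b = [ebump 1 (t - 1)] <= 1 and b <= 2, which gives 6. *)
Lemma partial_cutoff_bound k i x : x != 0 -> `|partial i (cutoff k) x| <= 6 * rinv x.
Proof.
move=> x0; have r0 : 0 < rho x by rewrite rho_gt0.
have e0 : 0 < enorm x by rewrite enorm_gt0.
rewrite partial_cutoff normrM (ger0_norm (bump_ge0 _ _)).
have [t0|t0] := ltP 0 (k.+1%:R * rho x - 1); last first.
  by rewrite bump_le0// mul0r mulr_ge0// rinv_ge0.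
rewrite /rinv ler_pdivlMr// -mulrA.
apply: (@le_trans _ _ (ebump 2 (k.+1%:R * rho x - 1) * (2 * (k.+1%:R * rho x)))).
  apply: ler_wpM2l; first exact: bump_ge0.
  rewrite normrM (ger0_norm (_ : 0 <= k.+1%:R))// normrM (ger0_norm (_ : 0 <= 2))//.
  rewrite -!mulrA [leRHS]mulrCA; apply: ler_wpM2l => //; apply: ler_wpM2l => //.
  by rewrite -sqr_enorm expr2; apply: ler_wpM2r; [exact: ltW|exact: enorm_coord].
have H1 : ebump 2 (k.+1%:R * rho x - 1) <= 2 by exact: (bump_bound 1).
have H2 : (k.+1%:R * rho x - 1) * ebump 2 (k.+1%:R * rho x - 1) <= 1.
  by rewrite -(bumpS 1 t0); exact: (bump_bound 0).
move: H1 H2; move: (ebump 2 (k.+1%:R * rho x - 1)) => b.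
move: (k.+1%:R * rho x) => t H1 H2.
have -> : b * (2 * t) = 2 * ((t - 1) * b) + 2 * b by ring.
lra.
Qed.

(** With t = (k+1) r^2, the bound is 12/(t r). For t < 2 it follows from the uniform bound 6/r; for
    t >= 2, [ebump 2 (t - 1)] <= (t - 1)^(-2) <= (2/t)^2 gives even 8/(t r). *)
Lemma partial_cutoff_near k i x : x != 0 ->
  `|partial i (cutoff k) x| <= 12 * k.+1%:R^-1 * rinv x ^+ 3.
Proof.
move=> x0; have r0 : 0 < rho x by rewrite rho_gt0.
have e0 : 0 < enorm x by rewrite enorm_gt0.
have k0 : (0 : R) < k.+1%:R by rewrite ltr0n.
have Kr : 0 < k.+1%:R * rho x by rewrite mulr_gt0.
have [t1|t1] := leP 2 (k.+1%:R * rho x); last first.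
  apply: le_trans (partial_cutoff_bound k i x0) _.
  rewrite exprSr mulrA; apply: ler_wpM2r; first exact: rinv_ge0.
  by rewrite rinv2 -mulrA -invfM ler_pdivlMr//; lra.
rewrite partial_cutoff normrM (ger0_norm (bump_ge0 _ _)).
have t0 : 0 < k.+1%:R * rho x - 1 by lra.
rewrite bump_gt0//.
have ex1 : expR (- (k.+1%:R * rho x - 1)^-1) <= 1 by rewrite expR_le1 oppr_le0 invr_ge0 ltW.
apply: (@le_trans _ _ ((2 / (k.+1%:R * rho x)) ^+ 2 * (k.+1%:R * (2 * enorm x)))).
  apply: ler_pM => //.
  - by rewrite mulr_ge0 ?expR_ge0// exprn_ge0// invr_ge0 ltW.
  - apply: (@le_trans _ _ ((k.+1%:R * rho x - 1)^-1 ^+ 2)).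
      by rewrite ler_piMr// exprn_ge0// invr_ge0 ltW.
    rewrite ler_pXn2r// ?nnegrE ?invr_ge0 ?(ltW t0)//; last by rewrite divr_ge0// ltW.
    rewrite ler_pdivlMr// mulrC ler_pdivrMr//; lra.
  rewrite normrM (ger0_norm (_ : 0 <= k.+1%:R))// normrM (ger0_norm (_ : 0 <= 2))//.
  by do 2 apply: ler_wpM2l => //; exact: enorm_coord.
rewrite /rinv -sqr_enorm; move: e0 k0; move: (enorm x) (k.+1%:R : R) => e K e0 K0.
have -> : (2 / (K * e ^+ 2)) ^+ 2 * (K * (2 * e)) = 8 * K^-1 * e^-1 ^+ 3.
  by field; rewrite !lt0r_neq0.
apply: ler_wpM2r; first by rewrite exprn_ge0// invr_ge0 ltW.
by apply: ler_wpM2r; [rewrite invr_ge0 ltW|rewrite ler_nat].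
Qed.

(** The product with the cutoff falls under the bounded case. Its derivative has a majorant in
    r^(-4) free of k, because F of order 3 meets a gradient O(1/r), and it converges pointwise at
    rate 1/(k+1). *)
Lemma integral_partial_eq0 F i : Nice 1 3 F ->
  (forall x, 1 <= enorm x -> F x = 0) ->
  (\int[mu]_(x in B) (partial i F x)%:E = 0)%E.
Proof.
move=> nF F0.
have [M nM] := nF.
have dF x : x != 0 -> differentiable F x by move=> x0; exact: Nice_diff nF x0.
have bF x : x != 0 -> enorm x <= 1 -> `|F x| <= M * rinv x ^+ 3 by exact: (nice_bound nM).
have bpF x : x != 0 -> enorm x <= 1 -> `|partial i F x| <= M * rinv x ^+ 4.
  by exact: (nice_bound (nice_partial i nM)).
have M0 x : x != 0 -> enorm x <= 1 -> 0 <= M.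
  move=> x0 x1; have := le_trans (normr_ge0 _) (bF x x0 x1).
  by rewrite pmulr_lge0// exprn_gt0// rinv_gt0.
pose G k x := F x * cutoff k x.
have pG k x : x != 0 -> pdiff (G k) x (fun j => partial j F x * cutoff k x + F x * partial j (cutoff k) x).
  move=> x0; apply: pdiffM; first exact/pdiffP/dF.
  exact/pdiffP/Sm_differentiable/Sm_cutoff.
have nG k : Nice 1 3 (G k).
  by have := Nice_mul nF (Nice_Sm 1 (Sm_cutoff k)); rewrite addn0.
have mpG k (D : set 'rV[R]_m) : measurable D -> measurable_fun D (partial i (G k)).
  move=> mD; apply: differentiable_measurable => // x.
  exact: Nice_diff (Nice_partial i (nG k)).
have G0 k x : 1 <= enorm x -> G k x = 0 by move=> x1; rewrite /G F0// mul0r.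
have nearG k x : k.+1%:R * rho x < 1 -> \forall y \near x, cst 0 y = G k y.
  move=> x1; have cr := @continuous_rho R m x.
  have : \forall y \near x, rho y < k.+1%:R^-1.
    apply: (cr [set t | t < k.+1%:R^-1]); apply: lt_nbhsl.
    by rewrite -[ltRHS]mul1r ltr_pdivlMr ?ltr0n// mulrC.
  apply: filterS => y y1; rewrite /G /cutoff bump_le0 ?mulr0// subr_le0.
  by rewrite mulrC -ler_pdivlMr ?ltr0n// mul1r ltW.
have dG k x : differentiable (G k) x.
  have [->|x0] := eqVneq x 0; last exact: (pG k x x0).1.
  apply: near_eq_differentiable (differentiable_cst 0 _); apply: nearG.
  rewrite /rho big1 ?mulr0// => j _; by rewrite mxE expr0n.
(* 7 = 1 + 6: the cutoff is at most 1 and its partial derivatives at most 6/r. *)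
have bG k x : x != 0 -> enorm x <= 1 -> `|partial i (G k) x| <= 7 * `|M| * rinv x ^+ 4.
  move=> x0 x1; rewrite (pG k x x0).2.
  have i0 := rinv_ge0 x.
  apply: le_trans (ler_normD _ _) _; rewrite !normrM.
  have -> : 7 * `|M| * rinv x ^+ 4 = `|M| * rinv x ^+ 4 * 1 + `|M| * rinv x ^+ 3 * (6 * rinv x) by ring.
  have MM : M <= `|M| := ler_norm M.
  apply: lerD; apply: ler_pM => //.
  - by apply: le_trans (bpF x x0 x1) _; apply: ler_wpM2r; rewrite ?exprn_ge0.
  - exact: cutoff_le1.
  - by apply: le_trans (bF x x0 x1) _; apply: ler_wpM2r; rewrite ?exprn_ge0.
  - exact: partial_cutoff_bound.
have iG k : (\int[mu]_(x in B) (partial i (G k) x)%:E = 0)%E.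
  (* [G k] vanishes where (k+1) r^2 < 1, and elsewhere r^(-4) <= (k+1)^2; this bound may depend on
     k. *)
  apply: (@integral_partial_eq0_bounded R m (G k) i (7 * `|M| * k.+1%:R ^+ 2)) => //; [|exact: G0|exact: mpG].
  move=> x; have L0 : 0 <= 7 * `|M| * k.+1%:R ^+ 2 by rewrite !mulr_ge0// exprn_ge0.
  have [x1|x1] := leP 1 (enorm x).
    by rewrite (partial_outside _ (G0 k) x1) ?normr0//; exact: diff_derivable.
  have [kx|kx] := ltP (k.+1%:R * rho x) 1.
    rewrite /partial -(near_eq_derive _ (nearG k x kx)).
    by have [_] := pdiff_cst 0 x; rewrite /partial => ->; rewrite normr0.
  have x0 : x != 0.
    apply/eqP => x0; move: kx; rewrite x0 /rho big1 ?mulr0 ?ler10//.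
    by move=> j _; rewrite mxE expr0n.
  apply: le_trans (bG k x x0 (ltW x1)) _; apply: ler_wpM2l; first by rewrite mulr_ge0.
  have -> : rinv x ^+ 4 = (rho x)^-1 ^+ 2 by rewrite -rinv2 -exprM.
  rewrite ler_pXn2r ?nnegrE ?invr_ge0 ?rho_ge0//.
  by rewrite -[leLHS]mul1r ler_pdivrMr ?rho_gt0.
have H : ((\int[mu]_(x in B) (partial i (G k) x)%:E) @[k --> \oo] -->
    \int[mu]_(x in B) (partial i F x)%:E)%E.
  apply: (@dominated_rinv4 R m m5 _ _ (7 * `|M|)).
  - by move=> k; apply: mpG; exact: measurable_uball.
  - exact: Nice_measurable (Nice_partial i nF).
  - by move=> k x x0 x1; exact: bG x0 (ltW x1).
  move=> x x0 x1.
  apply: (@cvg_bound_harmonic _ _ _ (M * rinv x ^+ 4 * (2 * rinv x ^+ 2) + M * rinv x ^+ 3 * (12 * rinv x ^+ 3))).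
  move=> k; rewrite (pG k x x0).2.
  have -> : partial i F x * cutoff k x + F x * partial i (cutoff k) x - partial i F x =
     - (partial i F x * (1 - cutoff k x)) + F x * partial i (cutoff k) x by ring.
  apply: le_trans (ler_normD _ _) _; rewrite normrN !normrM.
  rewrite (_ : _ * k.+1%:R^-1 = M * rinv x ^+ 4 * (2 * k.+1%:R^-1 * rinv x ^+ 2) +
    M * rinv x ^+ 3 * (12 * k.+1%:R^-1 * rinv x ^+ 3)); last by ring.
  apply: lerD; apply: ler_pM => //.
  - exact: bpF (ltW x1).
  - exact: cutoff_near.
  - exact: bF (ltW x1).
  - exact: partial_cutoff_near.
apply: (cvg_unique _ H); first exact: ereal_hausdorff.
by rewrite (_ : (fun k => _) = cst 0%E); [exact: cvg_cst|apply/funext => k; exact: iG].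
Qed.

End parts.

(** * Weak derivatives: existence, uniqueness and the fundamental lemma *)

Section weak_derivative.
Context {R : realType} {m : nat}.
Hypothesis m5 : (5 <= m)%N.
Implicit Types (f g h phi : 'rV[R]_m -> R) (x : 'rV[R]_m) (i : 'I_m) (M : R).
Notation mu := (@lebesgue_rV R m).
Notation B := (@uball R m).
Let mB := @measurable_uball R m.

Lemma compact_measurable (K : set 'rV[R]_m) : compact K -> measurable K.
Proof.
move=> cK; rewrite -[K]setCK; apply: measurableC; apply: open_measurable_rV.
by apply: closed_openC; apply: compact_closed cK; exact: norm_hausdorff.
Qed.

Lemma compact_rho_le (c : R) : c < 1 -> compact [set x : 'rV[R]_m | rho x <= c] /\
  [set x : 'rV[R]_m | rho x <= c] `<=` B.
Proof.
move=> c1; have sub : [set x : 'rV[R]_m | rho x <= c] `<=` B.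
  by move=> x xc; rewrite /uball /= enorm_lt1; exact: le_lt_trans c1.
split=> //; apply: (@subclosed_compact _ _ [set v : 'rV[R]_m | forall i, `[-1, 1]%classic (v ord0 i)]).
- apply: (@preimage_closed _ _ rho [set t | t <= c]); last exact: closed_le.
  by move=> x _; exact: continuous_rho.
- by apply: (@rV_compact R m (fun=> `[-1, 1]%classic)) => _; exact: segment_compact.
- move=> x /sub x1 i /=; rewrite in_itv /= -ler_norml.
  exact: le_trans (enorm_coord x i) (ltW x1).
Qed.

Lemma test_outside phi x : test_function phi -> ~ B x -> phi x = 0.
Proof.
move=> [_ _ sB] xB; apply/eqP; apply: contrapT => /negP px; apply: xB.
by apply: sB; exact: subset_closure.
Qed.

Lemma L1loc_Nice p f : (p <= 4)%N -> Nice 0 p f -> L1loc f.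
Proof.
move=> p4 nf; split; first exact: Nice_measurable nf.
move=> K cK KB; apply: (@integrableS _ _ _ mu B) => //.
- exact: compact_measurable.
- exact: (Nice_integrable m5 p4 nf).
Qed.

Lemma L1loc_mul_integrable h phi (K : set 'rV[R]_m) : L1loc h -> continuous phi ->
  compact K -> K `<=` B -> (forall x, ~ K x -> phi x = 0) ->
  mu.-integrable B (fun x => (h x * phi x)%:E).
Proof.
move=> [mh ih] cphi cK KB phi0.
have [M M0 bM] := bounded_cball cphi.
have mK := compact_measurable cK.
have iK : mu.-integrable setT ((EFin \o h) \_ K).
  by apply/(integrable_mkcond (EFin \o h) mK); apply: ih.
have iB : mu.-integrable B (fun x => M%:E * ((EFin \o h) \_ K) x)%E.
  by apply: integrableZl => //; exact: integrableS iK.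
apply: le_integrable iB => //.
  apply/measurable_EFinP; apply: measurable_funM => //.
  exact: measurable_fun_continuous.
move=> x xB; rewrite abseM patchE; case: ifPn => xK.
  rewrite /= lee_fin normrM mulrC (ger0_norm M0).
  by apply: ler_wpM2r => //; apply: bM; exact: ltW.
rewrite phi0 ?mulr0 ?normr0 ?mule0 ?abse0 ?mule0//.
by rewrite notin_setE in xK.
Qed.

Lemma test_integrable h phi : L1loc h -> test_function phi ->
  mu.-integrable B (fun x => (h x * phi x)%:E).
Proof.
move=> lh tp; have [sp cK KB] := tp.
apply: (L1loc_mul_integrable lh _ cK KB).
  by move=> x; apply: differentiable_continuous; exact: smooth_differentiable.
by move=> x xK; apply: contrapT => /eqP px; apply: xK; exact: subset_closure.
Qed.

Lemma Nice_test n phi : test_function phi -> Nice n 0 phi.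
Proof. by move=> [sp _ _]; exact: Nice_smooth. Qed.

(** The identity expresses that the i-th derivative of [f * phi] has integral 0; p <= 3 keeps this
    derivative within order 4. *)
Lemma is_wpartial_Nice p f i : (p <= 3)%N -> Nice 1 p f -> is_wpartial i f (partial i f).
Proof.
move=> p3 nf; have nf0 := Nice_anti (leq0n 1) nf; have npf := Nice_partial i nf.
split; [exact: L1loc_Nice (leqW p3) nf0|exact: L1loc_Nice npf|].
move=> phi tp; have nphi := Nice_test 1 tp.
have nphi0 := Nice_anti (leq0n 1) nphi; have npphi := Nice_partial i nphi.
have n1 := Nice_mul nf0 npphi; have n2 := Nice_mul npf nphi0.
have n12 : Nice 1 3 (fun x => f x * phi x).
  by apply: (@Nice_le _ _ _ (p + 0)); [rewrite addn0|exact: Nice_mul].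
have := integral_partial_eq0 m5 i n12.
move=> /(_ _) H; have {H} : (\int[mu]_(x in B) (partial i (fun x => f x * phi x) x)%:E = 0)%E.
  apply: H => x x1; rewrite (test_outside tp) ?mulr0//.
  by apply/negP; rewrite -leNgt.
rewrite (@eq_integral_off0 _ _ m5 _ (fun x => f x * partial i phi x + partial i f x * phi x)).
- move=> H0.
  have : \int[mu]_(x in B) (f x * partial i phi x + partial i f x * phi x) = 0.
    by rewrite /Rintegral H0.
  rewrite RintegralD//; first by move/eqP; rewrite addr_eq0 => /eqP.
    by apply: (Nice_integrable m5 _ n1); rewrite addn1.
  by apply: (Nice_integrable m5 _ n2); rewrite addn0.
- exact: Nice_measurable (Nice_partial i n12).
- apply: measurable_funD; [exact: Nice_measurable n1|exact: Nice_measurable n2].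
move=> x x0 _; rewrite addrC.
by rewrite (pdiffM (pdiffP (Nice_diff nf x0)) (pdiffP (Nice_diff nphi x0))).2.
Qed.

(** Inside the box every factor exp(-1/((k+1) t)) tends to 1, outside it some factor is 0. The
    indicator of a box is thus a bounded pointwise limit of smooth functions. *)
Definition box_bump (a b : 'I_m -> R) k x : R :=
  \prod_(i < m) (ebump 0 (k.+1%:R * (x ord0 i - a i)) * ebump 0 (k.+1%:R * (b i - x ord0 i))).

Lemma Sm_box_bump a b k : Sm (box_bump a b k).
Proof.
apply: Sm_prod => i; apply: Sm_mul; apply: Sm_bump; apply: Sm_mul; try exact: Sm_cst.
  by apply: Sm_sub; [exact: Sm_coord|exact: Sm_cst].
by apply: Sm_sub; [exact: Sm_cst|exact: Sm_coord].
Qed.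

Lemma box_bump_ge0_le1 a b k x : 0 <= box_bump a b k x <= 1.
Proof.
rewrite /box_bump; elim/big_rec: _ => [|i y _ /andP[y0 y1]]; first by rewrite ler01 lexx.
rewrite !mulr_ge0 ?ebump_ge0 ?bump_ge0//= mulr_ile1 ?mulr_ile1 ?mulr_ge0 ?bump_ge0 ?bump0_le1//.
Qed.

Lemma cvg_prod_seq (I : Type) (r : seq I) (F : I -> nat -> R) (l : I -> R) :
  (forall k, F k n @[n --> \oo] --> l k) ->
  \prod_(k <- r) F k n @[n --> \oo] --> \prod_(k <- r) l k.
Proof.
move=> cF; elim: r => [|k r IH].
  by under eq_fun do rewrite big_nil; rewrite big_nil; apply: cvg_cst.
by under eq_fun do rewrite big_cons; rewrite big_cons; apply: cvgM.
Qed.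

Lemma cvg_ebump0 (t : R) : 0 < t -> ebump 0 (k.+1%:R * t) @[k --> \oo] --> (1 : R).
Proof.
move=> t0; apply: (@cvg_bound_harmonic _ _ _ t^-1) => k.
rewrite distrC ger0_norm ?subr_ge0 ?bump0_le1// bump_gt0 ?mulr_gt0 ?ltr0n// expr0 mul1r.
have -> : (k.+1%:R * t)^-1 = t^-1 * k.+1%:R^-1 by rewrite invfM mulrC.
by move: (t^-1 * k.+1%:R^-1) => u; have := expR_ge1Dx (- u); lra.
Qed.

Lemma cvg_box_bump a b x : box_bump a b k x @[k --> \oo] --> (\1_(obox a b) x : R).
Proof.
have [xb|xb] := pselect (obox a b x).
  rewrite indicE mem_set//= (_ : 1%:R = \prod_(i < m) (1 * 1)); last first.
    by rewrite big1// => i _; rewrite mulr1.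
  apply: cvg_prod_seq => i; have /andP[xa xb'] := xb i.
  by apply: cvgM; apply: cvg_ebump0; rewrite subr_gt0.
rewrite indicE memNset//= (_ : (fun k => _) = cst 0); first exact: cvg_cst.
move/existsNP : xb => [i xi]; apply/funext => k; rewrite /box_bump (bigD1 i)//=.
move/negP : xi; rewrite negb_and -!leNgt => /orP[xa|xb].
  by rewrite bump_le0 ?mul0r// mulr_ge0_le0// subr_le0.
by rewrite [X in _ * X * _]bump_le0 ?mulr0 ?mul0r// mulr_ge0_le0// subr_le0.
Qed.

(** Multiplication by the radial bump [chi n], supported in r^2 <= 1 - 1/(n+1), makes h integrable
    on the whole space and [box_bump] admissible as a test function. So [h * chi n] has integral 0
    over every box and is null; each point of the ball has some [chi n] positive. *)
Lemma L1loc_eq0 h : L1loc h ->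
  (forall phi, test_function phi -> \int[mu]_(x in B) (h x * phi x) = 0) ->
  ae_eq mu B h (cst 0).
Proof.
move=> lh H0; have [mh ih] := lh.
pose c (n : nat) : R := 1 - n.+1%:R^-1.
have c1 n : c n < 1 by rewrite gtrBl invr_gt0 ltr0n.
pose K n := [set x : 'rV[R]_m | rho x <= c n].
pose chi n x := ebump 0 (c n - rho x).
have schi n : Sm (chi n) by apply: Sm_bump; apply: Sm_sub; [exact: Sm_cst|exact: Sm_rho].
have chi0 n x : ~ K n x -> chi n x = 0.
  by move=> /negP; rewrite -ltNge => xK; rewrite /chi bump_le0// subr_le0 ltW.
have cchi n : continuous (chi n).
  by move=> x; apply: differentiable_continuous; exact: Sm_differentiable.
have ihc n : mu.-integrable B (fun x => (h x * chi n x)%:E).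
  have [cK KB] := compact_rho_le (c1 n).
  exact: (L1loc_mul_integrable lh (cchi n) cK KB (chi0 n)).
pose H n := (fun x => h x * chi n x) \_ B.
have iH n : mu.-integrable setT (EFin \o H n).
  by have := ihc n; rewrite (integrable_mkcond _ mB) -restrict_EFin.
have step n : ae_eq mu setT (H n) (cst 0).
  apply: ae_eq0_obox => // a b.
  have mhc : measurable_fun B (fun x => h x * chi n x).
    by apply/measurable_EFinP; case/integrableP : (ihc n).
  have tk k : test_function (fun x => chi n x * box_bump a b k x).
    have [cK KB] := compact_rho_le (c1 n).
    have sub : closure [set x | chi n x * box_bump a b k x != 0] `<=` K n.
      rewrite [X in _ `<=` X](_ : K n = closure (K n)); last first.
        by apply/closure_id; apply: compact_closed cK; exact: norm_hausdorff.
      apply: closureS => x /= px; apply: contrapT => /chi0 cx.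
      by move: px; rewrite cx mul0r eqxx.
    split; first by apply: Sm_smooth; apply: Sm_mul => //; exact: Sm_box_bump.
      by apply: subclosed_compact cK sub; exact: closed_closure.
    exact: subset_trans KB.
  have [] := @dominated_convergence _ _ _ mu B mB
    (fun k x => (h x * chi n x * box_bump a b k x)%:E)
    (fun x => (h x * chi n x * \1_(obox a b) x)%:E)
    (fun x => `|(h x * chi n x)%:E|%E).
  - move=> k; apply/measurable_EFinP; apply: measurable_funM => //.
    apply: measurable_fun_continuous => // x.
    by apply: differentiable_continuous; apply: Sm_differentiable; exact: Sm_box_bump.
  - apply/measurable_EFinP; apply: measurable_funM => //.
    by apply: measurable_indic; exact: measurable_obox.
  - apply: aeW => x _; apply: cvg_EFin; first exact: nearW.
    by apply: cvgM; [exact: cvg_cst|exact: cvg_box_bump].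
  - exact: integrable_abse.
  - apply: aeW => x k _; rewrite !abse_EFin lee_fin normrM ler_piMr//.
    by have /andP[b0 b1] := box_bump_ge0_le1 a b k x; rewrite ger0_norm.
  move=> _ _; rewrite (_ : (fun k => _) = cst 0%E); last first.
    apply/funext => k /=.
    rewrite -[LHS]fineK; last first.
      apply: integrable_fin_num => //.
      have := test_integrable lh (tk k).
      by under eq_fun do rewrite mulrA.
    have := H0 _ (tk k); rewrite /Rintegral; under eq_fun do rewrite mulrA.
    by move=> ->.
  move=> Hc; have E : (\int[mu]_(x in B) (h x * chi n x * \1_(obox a b) x)%:E = 0)%E.
    by apply: (cvg_unique _ Hc); [exact: ereal_hausdorff|exact: cvg_cst].
  rewrite -E integral_mkcond [RHS]integral_mkcond; apply: eq_integral => x _.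
  rewrite !patchE /H !patchE indicE; case: ifPn => xb; case: ifPn => xB; rewrite ?mulr1 ?mulr0//.
have := ae_foralln step; apply: filterS => x Hx xB.
have [n xn] : exists n, rho x < c n.
  have r1 : 0 < 1 - rho x by rewrite subr_gt0 -enorm_lt1.
  exists (Num.truncn (1 - rho x)^-1).
  have := truncnS_gt (1 - rho x)^-1; rewrite invf_plt ?posrE ?ltr0n//.
  by rewrite /c; move: (_.+1%:R^-1) => u; lra.
have := Hx n I; rewrite /H patchE mem_set//= => /eqP; rewrite mulf_eq0 => /orP[/eqP//|].
rewrite /chi bump_gt0 ?subr_gt0// mulf_eq0 expr0 oner_eq0 /= => /eqP e0.
by have := expR_gt0 (- (c n - rho x)^-1); rewrite e0 ltxx.
Qed.

Lemma L1loc_sub f g : L1loc f -> L1loc g -> L1loc (fun x => f x - g x).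
Proof.
move=> [mf jf] [mg jg]; split; first exact: measurable_funB.
move=> K cK KB; have mK := compact_measurable cK.
have := integrableB mK (jf K cK KB) (jg K cK KB).
by congr (_.-integrable _ _).
Qed.

Lemma is_wpartial_unique i f g g' : is_wpartial i f g -> is_wpartial i f g' -> ae_eq mu B g g'.
Proof.
move=> [lf lg Hg] [_ lg' Hg'].
have := @L1loc_eq0 (fun x => g x - g' x) (L1loc_sub lg lg').
move=> H; have {H} := H _; move=> H.
have : ae_eq mu B (fun x => g x - g' x) (cst 0).
  apply: H => phi tp.
  under eq_Rintegral do rewrite mulrBl.
  rewrite RintegralB//; try exact: test_integrable.
  by apply/eqP; rewrite subr_eq0 -eqr_opp -Hg// -Hg'.
by apply: filterS => x Hx xB; apply/eqP; rewrite -subr_eq0; apply/eqP; exact: Hx.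
Qed.

(** One weak derivative being known, [xget] returns some weak derivative, and uniqueness identifies
    the two almost everywhere. *)
Lemma wpartialP i f g : is_wpartial i f g ->
  is_wpartial i f (wpartial i f) /\ ae_eq mu B (wpartial i f) g.
Proof.
move=> fg; have H : is_wpartial i f (wpartial i f).
  by apply: (@xgetPex _ (cst 0) (is_wpartial i f)); exists g.
by split => //; exact: is_wpartial_unique H fg.
Qed.

Lemma L1loc_ae f g : ae_eq mu B f g -> measurable_fun B g -> L1loc f -> L1loc g.
Proof.
move=> fg mg [mf jf]; split => // K cK KB; have mK := compact_measurable cK.
have /integrableP[_ Hf] := jf K cK KB.
have mfK := measurable_funS mB KB mf; have mgK := measurable_funS mB KB mg.
apply/integrableP; split; first exact/measurable_EFinP.
rewrite (@ae_eq_integral _ _ _ _ _ (fun x => `|(EFin \o f) x|%E))//.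
- by apply: measurableT_comp => //; exact/measurable_EFinP.
- by apply: measurableT_comp => //; exact/measurable_EFinP.
- by apply: filterS fg => x fgx xK /=; rewrite fgx//; exact: KB.
Qed.

Lemma is_wpartial_ae i f f' g : ae_eq mu B f f' -> measurable_fun B f' ->
  is_wpartial i f g -> is_wpartial i f' g.
Proof.
move=> ff mf' [lf lg H]; have lf' := L1loc_ae ff mf' lf.
split => // phi tp; rewrite -H// /Rintegral; congr fine; apply: ae_eq_integral => //.
- apply/measurable_EFinP; apply: measurable_funM => //.
  apply: measurable_fun_continuous => // x; apply: differentiable_continuous.
  by apply: smooth_differentiable; apply: smooth_partial; case: tp.
- apply/measurable_EFinP; apply: measurable_funM; first by case: lf.
  apply: measurable_fun_continuous => // x; apply: differentiable_continuous.
  by apply: smooth_differentiable; apply: smooth_partial; case: tp.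
- by apply: filterS ff => x ffx xB; rewrite ffx.
Qed.

End weak_derivative.

(** * Sobolev norms, traces and weak gradients through classical derivatives *)

Section sobolev_nice.
Context {R : realType} {m : nat}.
Hypothesis m5 : (5 <= m)%N.
Implicit Types (f g h phi : 'rV[R]_m -> R) (x : 'rV[R]_m) (i : 'I_m) (M : R).
Notation mu := (@lebesgue_rV R m).
Notation B := (@uball R m).
Let mB := @measurable_uball R m.

Lemma L2_Nice p f : (p <= 2)%N -> Nice 0 p f -> L2 f.
Proof.
move=> p2 nf; split; first exact: Nice_measurable nf.
have nff := Nice_mul nf nf.
by apply: (Nice_integrable m5 _ nff); rewrite (leq_add p2 p2).
Qed.

(** The square of a derivative of order j <= k has order 2 (p + j) <= 4, within the range of
    integrability. *)
Lemma sobolev_Nice k p f : (p + k <= 2)%N -> Nice k p f -> sobolev k f.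
Proof.
elim: k p f => [|k IH] p f pk nf.
  by apply: L2_Nice (Nice_anti (leq0n _) nf); rewrite addn0 in pk.
have p2 : (p <= 2)%N by apply: leq_trans pk; exact: leq_addr.
split; first exact: L2_Nice (Nice_anti (leq0n _) nf).
move=> i; exists (partial i f).
  by apply: (@is_wpartial_Nice _ _ m5 p) => //; [exact: leqW|exact: Nice_anti nf].
by apply: IH (Nice_partial i nf); rewrite addSnnS.
Qed.

Lemma L2_ae f g : ae_eq mu B f g -> measurable_fun B g -> L2 f -> L2 g.
Proof.
move=> fg mg [mf /integrableP[_ jf]]; split => //.
have mf2 : measurable_fun B (fun x => (f x ^+ 2)%:E).
  by apply/measurable_EFinP; exact: measurable_funX.
have mg2 : measurable_fun B (fun x => (g x ^+ 2)%:E).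
  by apply/measurable_EFinP; exact: measurable_funX.
apply/integrableP; split => //.
rewrite (@ae_eq_integral _ _ _ _ _ (fun x => `|(f x ^+ 2)%:E|%E))//.
- exact: measurableT_comp.
- exact: measurableT_comp.
- by apply: filterS fg => x fgx xB; rewrite fgx.
Qed.

Lemma sobolev_ae k f g : ae_eq mu B f g -> measurable_fun B g -> sobolev k f -> sobolev k g.
Proof.
case: k => [|k] fg mg; first exact: L2_ae.
move=> [lf H]; split; first exact: L2_ae lf.
by move=> i; have [h wh sh] := H i; exists h => //; exact: is_wpartial_ae wh.
Qed.

Fixpoint cnorm2 k f : \bar R :=
  (\int[mu]_(x in B) (f x ^+ 2)%:E +
   (if k is k'.+1 then \sum_(i < m) cnorm2 k' (partial i f) else 0))%E.

Lemma wpartial_ae_Nice p f g i : (p <= 3)%N -> Nice 1 p f -> ae_eq mu B f g ->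
  measurable_fun B g ->
  ae_eq mu B (partial i f) (wpartial i g) /\ measurable_fun B (wpartial i g).
Proof.
move=> p3 nf fg mg; have wf := is_wpartial_Nice m5 i p3 nf.
have [w1 w2] := wpartialP (is_wpartial_ae fg mg wf).
by split; [exact: ae_eq_sym|case: w1 => _ []].
Qed.

Lemma sobolev_norm2_Nice k p f g : (p + k <= 4)%N -> Nice k p f -> ae_eq mu B f g ->
  measurable_fun B g -> sobolev_norm2 k g = cnorm2 k f.
Proof.
elim: k p f g => [|k IH] p f g pk nf fg mg /=.
  rewrite !adde0; apply: ae_eq_integral => //.
  - by apply/measurable_EFinP; exact: measurable_funX.
  - by apply/measurable_EFinP; apply: measurable_funX; exact: Nice_measurable nf.
  - by apply: filterS fg => x fgx xB; rewrite fgx.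
congr (_ + _)%E.
  apply: ae_eq_integral => //.
  - by apply/measurable_EFinP; exact: measurable_funX.
  - by apply/measurable_EFinP; apply: measurable_funX; exact: Nice_measurable nf.
  - by apply: filterS fg => x fgx xB; rewrite fgx.
apply: eq_bigr => i _.
have p3 : (p <= 3)%N by rewrite -ltnS (leq_trans _ pk)// addnS ltnS leq_addr.
have [w1 w2] := wpartial_ae_Nice i p3 (Nice_anti (ltn0Sn k) nf) fg mg.
by apply: (IH p.+1) => //; [rewrite addSnnS|exact: Nice_partial].
Qed.

Definition J4 : R := \int[mu]_(x in B) (rinv x ^+ 4).

Lemma J4E : (\int[mu]_(x in B) (rinv x ^+ 4)%:E)%E = J4%:E.
Proof. by rewrite fineK//; apply: integrable_fin_num => //; exact: integrable_rinv4. Qed.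

Lemma nice_sqr_bound p M f x : (p <= 2)%N -> nice 0 p M f -> x != 0 -> B x ->
  f x ^+ 2 <= M ^+ 2 * rinv x ^+ 4.
Proof.
move=> p2 nf x0 xB; have := nice_bound (nice_le (lexx M) p2 nf) x0 (ltW xB) => H.
have -> : M ^+ 2 * rinv x ^+ 4 = (M * rinv x ^+ 2) ^+ 2 by rewrite exprMn -exprM.
rewrite -real_normK ?num_real// ler_pXn2r ?nnegrE//.
exact: le_trans (normr_ge0 _) H.
Qed.

Lemma integral_nice_sqr p M f : (p <= 2)%N -> nice 0 p M f ->
  (\int[mu]_(x in B) (f x ^+ 2)%:E <= (M ^+ 2 * J4)%:E)%E.
Proof.
move=> p2 nf.
have mf : measurable_fun B f by apply: (@Nice_measurable _ _ 0 p); exists M.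
rewrite EFinM -J4E -integralZl//; last exact: integrable_rinv4.
(* The value at the origin is reset to 0, since [nice] leaves it unbounded while the majorant is 0
   there. *)
rewrite (@eq_integral_off0 _ _ m5 _ (fun x => if x == 0 then 0 else f x ^+ 2)).
- apply: ge0_le_integral => //.
  + by move=> x _; rewrite lee_fin; case: ifP => // _; exact: sqr_ge0.
  + apply/measurable_EFinP; apply: differentiable_measurable => // x x0.
    apply: (@differentiable_off0 _ _ (fun y => f y * f y)) => // [y /negbTE -> //|].
    by apply: differentiableM; exact: nice_diff nf x0.
  + apply: emeasurable_funM => //.
    by case/integrableP : (@integrable_rinv4 R m m5).
  + move=> x xB; rewrite -EFinM lee_fin; case: ifPn => [_|x0].
      by rewrite mulr_ge0 ?sqr_ge0// exprn_ge0// rinv_ge0.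
    by apply: (nice_sqr_bound p2 nf).
- exact: measurable_funX.
- apply: differentiable_measurable => // x x0.
  apply: (@differentiable_off0 _ _ (fun y => f y * f y)) => // [y /negbTE -> //|].
  by apply: differentiableM; exact: nice_diff nf x0.
- by move=> x /negbTE ->.
Qed.

Lemma cnorm2_ge0 k f : (0 <= cnorm2 k f)%E.
Proof.
elim: k f => [|k IH] f /=; apply: adde_ge0.
1,3: by apply: integral_ge0 => x _; rewrite lee_fin sqr_ge0.
- by [].
- by apply: sume_ge0 => i _; exact: IH.
Qed.

Lemma cnorm2_bound k p : (p + k <= 2)%N -> exists2 C : R, 0 <= C &
  forall M f, nice k p M f -> (cnorm2 k f <= (C * M ^+ 2)%:E)%E.
Proof.
have J0 : 0 <= J4 by apply: Rintegral_ge0 => x _; rewrite exprn_ge0// rinv_ge0.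
elim: k p => [|k IH] p pk.
  exists J4 => // M f nf; rewrite /= adde0 mulrC; apply: integral_nice_sqr nf.
  by rewrite addn0 in pk.
have [C C0 HC] := IH p.+1 (etrans (congr1 (leq^~ 2) (addSnnS _ _)) pk).
exists (J4 + m%:R * C) => [|M f nf /=]; first by rewrite addr_ge0// mulr_ge0.
rewrite mulrDl EFinD; apply: leeD.
  rewrite mulrC; apply: integral_nice_sqr (nice_anti (leq0n _) nf).
  by apply: leq_trans pk; exact: leq_addr.
apply: (@le_trans _ _ (\sum_(i < m) (C * M ^+ 2)%:E)%E).
  by apply: lee_sum => i _; apply: HC; exact: nice_partial.
by rewrite sumEFin sumr_const card_ord lee_fin -mulrA mulr_natl.
Qed.

(** The two bounds share the work: the uniform one gives the integrable majorant M^2 r^(-4), and the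
    one with 1/(n+1), possibly too singular to integrate, gives the pointwise limit off the
    origin. *)
Lemma integral_sqr_cvg p M (F : nat -> 'rV[R]_m -> R) : (p <= 2)%N ->
  (forall n, nice 0 p M (F n)) -> (forall n, nice 0 (p + 2) (M * n.+1%:R^-1) (F n)) ->
  ((\int[mu]_(x in B) (F n x ^+ 2)%:E) @[n --> \oo] --> 0)%E.
Proof.
move=> p2 nF vF.
rewrite -[X in _ --> X](integral0 mu B).
apply: (@dominated_rinv4 R m m5 (fun n x => F n x ^+ 2) (fun=> 0) (M ^+ 2)).
- by move=> n; apply: measurable_funX; apply: (@Nice_measurable _ _ 0 p); exists M.
- exact: measurable_cst.
- move=> n x x0 xB; rewrite ger0_norm ?sqr_ge0//; exact: (nice_sqr_bound p2 (nF n)).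
move=> x x0 xB; apply: (@cvg_bound_harmonic _ _ _ ((M * rinv x ^+ (p + 2)) ^+ 2)) => n.
rewrite subr0 ger0_norm ?sqr_ge0//.
have H := nice_bound (vF n) x0 (ltW xB).
have n0 : (0 : R) <= n.+1%:R^-1 by rewrite invr_ge0.
have n1 : n.+1%:R^-1 <= 1 :> R by rewrite invf_le1 ?ltr0n// ler1n.
apply: (@le_trans _ _ ((M * n.+1%:R^-1 * rinv x ^+ (p + 2)) ^+ 2)).
  rewrite -real_normK ?num_real// ler_pXn2r ?nnegrE//.
  exact: le_trans (normr_ge0 _) H.
rewrite mulrAC exprMn; apply: ler_wpM2l; first exact: sqr_ge0.
by rewrite expr2 ler_piMl.
Qed.

Lemma cnorm2_cvg k p M (F : nat -> 'rV[R]_m -> R) : (p + k <= 2)%N ->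
  (forall n, nice k p M (F n)) -> (forall n, nice k (p + 2) (M * n.+1%:R^-1) (F n)) ->
  (cnorm2 k (F n) @[n --> \oo] --> 0)%E.
Proof.
elim: k p F => [|k IH] p F pk nF vF /=.
  under eq_fun do rewrite adde0.
  by apply: integral_sqr_cvg nF vF; rewrite addn0 in pk.
rewrite -[X in _ --> X]adde0; apply: cvgeD => //.
  apply: (@integral_sqr_cvg p M).
  - by apply: leq_trans pk; exact: leq_addr.
  - by move=> n; exact: nice_anti (leq0n _) (nF n).
  - by move=> n; exact: nice_anti (leq0n _) (vF n).
have := @cvg_nnesum nat \oo _ R _ (index_enum 'I_m)
  (fun i n => cnorm2 k (partial i (F n))) (fun=> 0%E) xpredT.
rewrite big1_eq; apply => [i _|i _]; first by apply: nearW => n; exact: cnorm2_ge0.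
apply: (IH p.+1) => [|n|n]; first by rewrite addSnnS.
  exact: nice_partial (nF n).
exact: nice_partial (vF n).
Qed.

(** The approximants vanish on the sphere, so the boundary term is 0 for every n and only
    convergence in W^{1,2} is left. *)
Lemma is_trace_cst0 p M f g (F : nat -> 'rV[R]_m -> R) : (p <= 1)%N ->
  Nice 1 p f -> ae_eq mu B f g -> measurable_fun B g ->
  (forall n, smooth (F n)) -> (forall n x, enorm x = 1 -> F n x = 0) ->
  (forall n, nice 1 p M (fun x => F n x - f x)) ->
  (forall n, nice 1 (p + 2) (M * n.+1%:R^-1) (fun x => F n x - f x)) ->
  is_trace g (cst 0).
Proof.
move=> p1 nf fg mg sF F0 nF vF; split.
- by apply: sobolev_ae fg mg _; apply: sobolev_Nice nf; rewrite addn1.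
- exact: measurable_cst.
exists F; split => //.
- have p4 : (p + 1 <= 4)%N by rewrite addn1 (leq_ltn_trans p1).
  have E n : sobolev_norm2 1 (F n \- g) = cnorm2 1 (fun x => F n x - f x).
    apply: (@sobolev_norm2_Nice 1 p) => //; first by exists M.
      by apply: filterS fg => x fgx xB; rewrite /= fgx.
    apply: measurable_funB => //; apply: differentiable_measurable => // x _.
    exact: smooth_differentiable.
  under eq_fun do rewrite E.
  by apply: cnorm2_cvg nF vF; rewrite addn1.
- rewrite (_ : (fun k => _) = cst 0%E); first exact: cvg_cst.
  apply/funext => n; rewrite /sphere_integral.
  (* The origin is normalised to itself, not to a point of the sphere, so the integrand is
     [F n 0 ^+ 2] there; a single point is null. *)
  rewrite (eq_integral (fun x => (F n 0 ^+ 2 * \1_[set (0 : 'rV[R]_m)] x)%:E)); last first.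
    move=> x _; rewrite subr0 indicE; congr EFin.
    have [->|x0] := eqVneq x 0; first by rewrite scaler0 mem_set ?mulr1.
    rewrite memNset ?mulr0; last by move=> /= /eqP; rewrite (negbTE x0).
    rewrite F0 ?expr0n// /enorm.
    under eq_bigr do rewrite mxE exprMn.
    rewrite -mulr_sumr -/(rho x) -/(rinv x) rinv2 mulVf ?sqrtr1//.
    by rewrite lt0r_neq0// rho_gt0.
  rewrite (@integralZl_indic _ _ _ _ _ mB (fun=> [set 0]))//; last 2 first.
  - by rewrite ltNge sqr_ge0.
  - exact: measurable_rV_set1.
  rewrite integral_indic//; last exact: measurable_rV_set1.
  rewrite [X in (_ * (_ * X))%E](_ : _ = 0%E) ?mule0//.
  apply/eqP; rewrite -measure_le0 -(set1_rV_null 0 (leq_trans (isT : (0 < 5)%N) m5)).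
  by apply: measureIl => //; exact: measurable_rV_set1.
Qed.

Definition lap f x : R := \sum_(i < m) partial i (partial i f) x.

Lemma wlaplacian_Nice f : Nice 2 0 f ->
  ae_eq mu B (lap f) (wlaplacian f) /\ measurable_fun B (wlaplacian f).
Proof.
move=> nf.
have w1 i := wpartial_ae_Nice i (isT : (0 <= 3)%N) (Nice_anti (isT : (1 <= 2)%N) nf)
  (ae_eq_refl _ _ f) (Nice_measurable nf).
have w2 i := wpartial_ae_Nice i (isT : (1 <= 3)%N) (Nice_partial i nf) (w1 i).1 (w1 i).2.
split; last first.
  by apply: measurable_sum => i; exact: (w2 i).2.
have : {ae mu, forall x, forall i, B x -> partial i (partial i f) x = wpartial i (wpartial i f) x}.
  apply: filter_forall => i; exact: (w2 i).1.
by apply: filterS => x H xB; apply: eq_bigr => i _; exact: H.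
Qed.

Section vector_valued.
Context {q : nat}.
Implicit Types (v w : 'rV[R]_m -> 'rV[R]_q).

Definition cgrad_dot v w x : R := \sum_(a < q) \sum_(i < m)
  partial i (component v a) x * partial i (component w a) x.
Definition clap_dot v w x : R := \sum_(a < q)
  lap (component v a) x * lap (component w a) x.

Lemma wgrad_dot_Nice v w : (forall a, Nice 1 0 (component v a)) ->
  (forall a, Nice 1 0 (component w a)) ->
  ae_eq mu B (cgrad_dot v w) (wgrad_dot v w) /\ measurable_fun B (wgrad_dot v w).
Proof.
move=> nv nw.
have wv a i := wpartial_ae_Nice i (isT : (0 <= 3)%N) (nv a)
  (ae_eq_refl _ _ _) (Nice_measurable (nv a)).
have ww a i := wpartial_ae_Nice i (isT : (0 <= 3)%N) (nw a)
  (ae_eq_refl _ _ _) (Nice_measurable (nw a)).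
split; last first.
  apply: measurable_sum => a; apply: measurable_sum => i.
  by apply: measurable_funM; [exact: (wv a i).2|exact: (ww a i).2].
have : {ae mu, forall x, forall a i, B x ->
   partial i (component v a) x = wpartial i (component v a) x /\
   partial i (component w a) x = wpartial i (component w a) x}.
  apply: filter_forall => a; apply: filter_forall => i.
  by apply: filterS2 (wv a i).1 (ww a i).1 => x H1 H2 xB; split; [exact: H1|exact: H2].
apply: filterS => x H xB; apply: eq_bigr => a _; apply: eq_bigr => i _.
by have [-> ->] := H a i xB.
Qed.

Lemma wlap_dot_Nice v w : (forall a, Nice 2 0 (component v a)) ->
  (forall a, Nice 2 0 (component w a)) ->
  ae_eq mu B (clap_dot v w) (wlap_dot v w) /\ measurable_fun B (wlap_dot v w).
Proof.
move=> nv nw; have wv a := wlaplacian_Nice (nv a); have ww a := wlaplacian_Nice (nw a).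
split; last first.
  apply: measurable_sum => a.
  by apply: measurable_funM; [exact: (wv a).2|exact: (ww a).2].
have : {ae mu, forall x, forall a, B x ->
   lap (component v a) x = wlaplacian (component v a) x /\
   lap (component w a) x = wlaplacian (component w a) x}.
  apply: filter_forall => a.
  by apply: filterS2 (wv a).1 (ww a).1 => x H1 H2 xB; split; [exact: H1|exact: H2].
apply: filterS => x H xB; apply: eq_bigr => a _.
by have [-> ->] := H a xB.
Qed.

End vector_valued.
End sobolev_nice.

(** * Laplacians and gradients of x_i / r, of their products and of r^(-2) *)

Section laplacian.
Context {R : realType} {m : nat}.
Implicit Types (f g : 'rV[R]_m -> R) (x : 'rV[R]_m) (i j k : 'I_m).

Definition grad_dot f g x : R := \sum_i partial i f x * partial i g x.

Lemma lap_off0 f g : (forall x, x != 0 -> f x = g x) ->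
  forall x, x != 0 -> lap f x = lap g x.
Proof.
move=> fg x x0; apply: eq_bigr => i _.
by apply: partial_off0 => // y y0; exact: partial_off0.
Qed.

Lemma partialM p q f g i x : Nice 1 p f -> Nice 1 q g -> x != 0 ->
  partial i (fun y => f y * g y) x = partial i f x * g x + f x * partial i g x.
Proof.
move=> nf ng x0.
by rewrite (pdiffM (pdiffP (Nice_diff nf x0)) (pdiffP (Nice_diff ng x0))).2.
Qed.

Lemma partialZ p f c i x : Nice 1 p f -> x != 0 ->
  partial i (fun y => c * f y) x = c * partial i f x.
Proof.
by move=> nf x0; rewrite (pdiffM (pdiff_cst c x) (pdiffP (Nice_diff nf x0))).2 mul0r add0r.
Qed.

Lemma lapZ p f c x : Nice 2 p f -> x != 0 -> lap (fun y => c * f y) x = c * lap f x.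
Proof.
move=> nf x0; rewrite /lap mulr_sumr; apply: eq_bigr => i _.
rewrite -(partialZ _ _ (Nice_partial i nf) x0); apply: partial_off0 => // y y0.
by apply: (@partialZ p) => //; exact: Nice_anti nf.
Qed.

Lemma lapM p q f g x : Nice 2 p f -> Nice 2 q g -> x != 0 ->
  lap (fun y => f y * g y) x = lap f x * g x + 2 * grad_dot f g x + f x * lap g x.
Proof.
move=> nf ng x0; have nf1 := Nice_anti (isT : (1 <= 2)%N) nf.
have ng1 := Nice_anti (isT : (1 <= 2)%N) ng.
rewrite /lap /grad_dot !mulr_suml !mulr_sumr -!big_split; apply: eq_bigr => i _ /=.
have npf := Nice_partial i nf; have npg := Nice_partial i ng.
rewrite (@partial_off0 _ _ _ (fun y => partial i f y * g y + f y * partial i g y))//; last first.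
  by move=> y y0; rewrite (partialM i nf1 ng1).
have d1 := pdiffM (pdiffP (Nice_diff npf x0)) (pdiffP (Nice_diff ng x0)).
have d2 := pdiffM (pdiffP (Nice_diff nf x0)) (pdiffP (Nice_diff npg x0)).
rewrite (pdiffD d1 d2).2.
move: (partial i (partial i f) x) (partial i (partial i g) x) (partial i f x) (partial i g x) => a b c d.
ring.
Qed.

Lemma sum_delta (F : 'I_m -> R) i : \sum_k (k == i)%:R * F k = F i.
Proof.
rewrite (bigD1 i)//= eqxx mul1r big1 ?addr0// => k /negbTE ->.
by rewrite mul0r.
Qed.

Lemma grad_dot_angl i j x : x != 0 ->
  grad_dot (angl i) (angl j) x = rinv x ^+ 2 * ((i == j)%:R - angl i x * angl j x).
Proof.
move=> x0; rewrite /grad_dot.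
under eq_bigr => k _ do rewrite !(pdiff_angl _ x0).2.
rewrite (eq_bigr (fun k => rinv x ^+ 2 * ((k == i)%:R * ((k == j)%:R - angl j x * angl k x)) +
  (- (rinv x ^+ 2 * angl i x) * ((k == j)%:R * angl k x) +
   rinv x ^+ 2 * (angl i x * angl j x) * angl k x ^+ 2))); last by move=> k _; ring.
rewrite !big_split /= -!mulr_sumr !sum_delta sum_angl2//; ring.
Qed.

(** x_i / r is a spherical harmonic of degree 1, with eigenvalue m - 1. *)
Lemma lap_angl i x : x != 0 -> lap (angl i) x = - ((m%:R - 1) * rinv x ^+ 2 * angl i x).
Proof.
move=> x0; rewrite /lap.
rewrite (eq_bigr (fun k => - 2 * rinv x ^+ 2 * ((k == i)%:R * angl k x) +
   (3 * rinv x ^+ 2 * angl i x * angl k x ^+ 2 + - (rinv x ^+ 2 * angl i x)))); last first.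
  move=> k _; rewrite (@partial_off0 _ _ _ (fun y => rinv y * ((k == i)%:R + - (angl i y * angl k y))))//; last first.
    by move=> y y0; rewrite (pdiff_angl i y0).2.
  have d1 := pdiffN (pdiffM (pdiff_angl i x0) (pdiff_angl k x0)).
  have d2 := pdiffM (pdiff_rinv_angl x0) (pdiffD (pdiff_cst (k == i)%:R x) d1).
  by rewrite d2.2 eqxx /=; ring.
rewrite !big_split /= -!mulr_sumr sum_delta sum_angl2// sumr_const card_ord -mulr_natl; ring.
Qed.

Lemma Nice_anglM n i j : Nice n 0 (fun x => angl i x * angl j x).
Proof. exact: (Nice_mul (Nice_angl n i) (Nice_angl n j)). Qed.

(** x_i x_j / r^2 - delta_ij / m is a spherical harmonic of degree 2, with eigenvalue 2 m; the delta
    term removes the mean. *)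
Lemma lap_anglM i j x : x != 0 -> lap (fun y => angl i y * angl j y) x =
  rinv x ^+ 2 * (2 * (i == j)%:R - 2 * m%:R * (angl i x * angl j x)).
Proof.
move=> x0; rewrite (lapM (Nice_angl 2 i) (Nice_angl 2 j) x0).
by rewrite !lap_angl// grad_dot_angl//; ring.
Qed.

Lemma partial_anglM k i j x : x != 0 -> partial k (fun y => angl i y * angl j y) x =
  rinv x * ((k == i)%:R * angl j x + (k == j)%:R * angl i x - 2 * (angl i x * angl j x) * angl k x).
Proof.
by move=> x0; rewrite (pdiffM (pdiff_angl i x0) (pdiff_angl j x0)).2; ring.
Qed.

(** Euler's identity for a function that is homogeneous of degree 0. *)
Lemma sum_angl_partial_anglM i j x : x != 0 ->
  \sum_k angl k x * partial k (fun y => angl i y * angl j y) x = 0.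
Proof.
move=> x0; under eq_bigr => k _ do rewrite partial_anglM//.
rewrite (eq_bigr (fun k => rinv x * angl j x * ((k == i)%:R * angl k x) +
  (rinv x * angl i x * ((k == j)%:R * angl k x) +
   - 2 * rinv x * angl i x * angl j x * angl k x ^+ 2))); last by move=> k _; ring.
rewrite !big_split /= -!mulr_sumr !sum_delta sum_angl2//; ring.
Qed.

Lemma grad_anglM2 i j x : x != 0 ->
  \sum_k partial k (fun y => angl i y * angl j y) x ^+ 2 =
  rinv x ^+ 2 * (angl i x ^+ 2 + angl j x ^+ 2 + 2 * ((i == j)%:R * (angl i x * angl j x))
    - 4 * (angl i x ^+ 2 * angl j x ^+ 2)).
Proof.
move=> x0.
rewrite (eq_bigr (fun k => angl j x ^+ 2 * (partial k (angl i) x * partial k (angl i) x) +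
  (2 * (angl i x * angl j x) * (partial k (angl i) x * partial k (angl j) x) +
   angl i x ^+ 2 * (partial k (angl j) x * partial k (angl j) x)))); last first.
  by move=> k _; rewrite (partialM k (Nice_angl 1 i) (Nice_angl 1 j) x0); ring.
rewrite !big_split /= -!mulr_sumr -!/(grad_dot _ _ _) !grad_dot_angl// !eqxx /=; ring.
Qed.

Definition i2 x : R := rinv x ^+ 2.

Lemma Nice_i2 n : Nice n 2 i2.
Proof.
by apply: Nice_off0 (Nice_mul (Nice_rinv n) (Nice_rinv n)) => x _; rewrite /i2 expr2.
Qed.

Lemma partial_i2 k x : x != 0 -> partial k i2 x = - 2 * (angl k x * rinv x ^+ 3).
Proof.
move=> x0; have -> : partial k i2 x = partial k (fun y => rinv y * rinv y) x.
  by apply: partial_off0 => // y _; rewrite /i2 expr2.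
by rewrite (pdiffM (pdiff_rinv_angl x0) (pdiff_rinv_angl x0)).2; ring.
Qed.

(** The case a = -2 of Delta r^a = a (a + m - 2) r^(a-2). *)
Lemma lap_i2 x : x != 0 -> lap i2 x = (8 - 2 * m%:R) * rinv x ^+ 4.
Proof.
move=> x0; have -> : lap i2 x = lap (fun y => rinv y * rinv y) x.
  by apply: lap_off0 => // y _; rewrite /i2 expr2.
rewrite (lapM (Nice_rinv 2) (Nice_rinv 2) x0).
have -> : grad_dot rinv rinv x = rinv x ^+ 4.
  rewrite /grad_dot (eq_bigr (fun k => rinv x ^+ 4 * angl k x ^+ 2)).
    by rewrite -mulr_sumr sum_angl2// mulr1.
  by move=> k _; rewrite !(pdiff_rinv_angl x0).2; ring.
have -> : lap rinv x = (3 - m%:R) * rinv x ^+ 3.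
  rewrite /lap (eq_bigr (fun k => 3 * rinv x ^+ 3 * angl k x ^+ 2 + - rinv x ^+ 3)).
    rewrite big_split /= -mulr_sumr sum_angl2// sumr_const card_ord -mulr_natl; ring.
  move=> k _; rewrite (@partial_off0 _ _ _ (fun y => - angl k y * (rinv y * rinv y)))//; last first.
    by move=> y y0; rewrite (pdiff_rinv_angl y0).2 expr2.
  have d := pdiffM (pdiffN (pdiff_angl k x0)) (pdiffM (pdiff_rinv_angl x0) (pdiff_rinv_angl x0)).
  by rewrite d.2 eqxx /=; ring.
ring.
Qed.

End laplacian.

(** * The map u: norm, Laplacian and energy density *)

Section umap.
Context {R : realType} {m : nat}.
Hypothesis m5 : (5 <= m)%N.
Implicit Types (f g : 'rV[R]_m -> R) (x : 'rV[R]_m) (i j k : 'I_m).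

Let cm : R := (Num.sqrt (m%:R * (m%:R - 1)))^-1.

Let m1_gt0 : 0 < m%:R - 1 :> R.
Proof. by rewrite subr_gt0 ltr1n (leq_trans _ m5). Qed.

Let m_gt0 : 0 < m%:R :> R.
Proof. by rewrite ltr0n (leq_trans _ m5). Qed.

Let cm2 : cm ^+ 2 * (m%:R * (m%:R - 1)) = 1.
Proof.
rewrite /cm exprVn sqr_sqrtr; first by rewrite mulVf// mulf_neq0// lt0r_neq0.
by rewrite mulr_ge0// ltW.
Qed.

Definition ucomp i j x : R := umap x i j.

Lemma ucompE i j x : ucomp i j x = cm * (- (i == j)%:R + m%:R * (angl i x * angl j x)).
Proof.
rewrite /ucomp mxE /angl; congr (_ * (_ + _ * _)).
by rewrite -exprVn -/(rinv x); ring.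
Qed.

Lemma Nice_ucomp n i j : Nice n 0 (ucomp i j).
Proof.
apply: Nice_off0 (Nice_mul (Nice_cst n 0 cm) (Nice_add (Nice_cst n 0 (- (i == j)%:R))
  (Nice_mul (Nice_cst n 0 m%:R) (Nice_anglM n i j)))) => x _.
by rewrite ucompE.
Qed.

Lemma partial_ucomp k i j x : x != 0 ->
  partial k (ucomp i j) x = cm * m%:R * partial k (fun y => angl i y * angl j y) x.
Proof.
move=> x0.
rewrite (@partial_off0 _ _ _ (fun y => cm * (- (i == j)%:R + m%:R * (angl i y * angl j y))))//; last first.
  by move=> y _; rewrite ucompE.
have d := pdiffP (Nice_diff (Nice_anglM 0 i j) x0).
rewrite (pdiffM (pdiff_cst cm x) (pdiffD (pdiff_cst _ x) (pdiffM (pdiff_cst m%:R x) d))).2.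
ring.
Qed.

Lemma lap_ucomp i j x : x != 0 -> lap (ucomp i j) x = - 2 * m%:R * (i2 x * ucomp i j x).
Proof.
move=> x0; rewrite ucompE.
have -> : lap (ucomp i j) x = cm * m%:R * lap (fun y => angl i y * angl j y) x.
  rewrite -(lapZ _ (Nice_anglM 2 i j) x0); apply: eq_bigr => k _.
  apply: partial_off0 => // y y0; rewrite partial_ucomp//.
  by rewrite (partialZ _ _ (Nice_anglM 1 i j)).
rewrite lap_anglM// /i2; ring.
Qed.

(** For a unit vector a, the matrix -I + m a a^T has squared Frobenius norm m - 2 m + m^2 = m (m -
    1), the square of the normalising denominator. *)
Lemma sum_ucomp2 x : x != 0 -> \sum_i \sum_j ucomp i j x ^+ 2 = 1.
Proof.
move=> x0; rewrite -cm2.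
rewrite (eq_bigr (fun i => cm ^+ 2 * (1 - 2 * m%:R * angl i x ^+ 2 + m%:R ^+ 2 * angl i x ^+ 2))).
  rewrite -mulr_sumr; congr (_ * _).
  rewrite !big_split /= sumr_const card_ord sumrN -!mulr_sumr sum_angl2//.
  rewrite -[1 *+ m]/(m%:R); ring.
move=> i _.
rewrite (eq_bigr (fun j => cm ^+ 2 * ((j == i)%:R * (1 - 2 * m%:R * (angl i x * angl j x))) +
   cm ^+ 2 * m%:R ^+ 2 * angl i x ^+ 2 * angl j x ^+ 2)).
  rewrite big_split /= -!mulr_sumr sum_delta sum_angl2//; ring.
move=> j _; rewrite ucompE eq_sym; case: (j == i) => /=; ring.
Qed.

Lemma sum_angl_partial_ucomp i j x : x != 0 -> \sum_k angl k x * partial k (ucomp i j) x = 0.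
Proof.
move=> x0; rewrite (eq_bigr (fun k => cm * m%:R * (angl k x * partial k (fun y => angl i y * angl j y) x))).
  by rewrite -mulr_sumr sum_angl_partial_anglM// mulr0.
by move=> k _; rewrite partial_ucomp//; ring.
Qed.

(** The value agrees with |grad u|^2 = - <u, Delta u>, valid for maps into a sphere; it is obtained
    here by direct expansion. *)
Lemma sum_grad_ucomp2 x : x != 0 ->
  \sum_i \sum_j \sum_k partial k (ucomp i j) x ^+ 2 = 2 * m%:R * i2 x.
Proof.
move=> x0.
rewrite (eq_bigr (fun i => (cm * m%:R) ^+ 2 * i2 x * (m%:R * angl i x ^+ 2 + 1 - 2 * angl i x ^+ 2))).
  rewrite -mulr_sumr !big_split /= sumr_const card_ord sumrN -!mulr_sumr sum_angl2//.
  rewrite -[1 *+ m]/(m%:R) /i2.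
  have -> : (cm * m%:R) ^+ 2 * rinv x ^+ 2 * (m%:R * 1 + m%:R - 2 * 1) =
    2 * m%:R * rinv x ^+ 2 * (cm ^+ 2 * (m%:R * (m%:R - 1))) by ring.
  by rewrite cm2 mulr1.
move=> i _.
rewrite (eq_bigr (fun j => (cm * m%:R) ^+ 2 * i2 x * (angl i x ^+ 2 + angl j x ^+ 2
   + 2 * ((j == i)%:R * (angl i x * angl j x)) - 4 * (angl i x ^+ 2 * angl j x ^+ 2)))).
  rewrite -mulr_sumr; congr (_ * _).
  rewrite !big_split /= sumr_const card_ord -mulr_natl sumrN -!mulr_sumr sum_delta sum_angl2//; ring.
move=> j _.
rewrite (eq_bigr (fun k => (cm * m%:R) ^+ 2 * partial k (fun y => angl i y * angl j y) x ^+ 2)).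
  by rewrite -mulr_sumr grad_anglM2// /i2 eq_sym; ring.
by move=> k _; rewrite partial_ucomp//; ring.
Qed.

End umap.

(** * Maps of the form (s u, t) and the scalar biharmonic equation *)

Section vmap.
Context {R : realType} {m : nat}.
Hypothesis m5 : (5 <= m)%N.
Implicit Types (f g s t : 'rV[R]_m -> R) (x : 'rV[R]_m) (i j k : 'I_m).
Notation mu := (@lebesgue_rV R m).
Notation B := (@uball R m).
Let mB := @measurable_uball R m.

(** One form for the map itself (constant s and t), for the variation and its derivatives in the
    parameter, and for the test field that refutes harmonicity. *)
Definition vmap s t x : 'rV[R]_(m * m + 1) :=
  row_mx (s x *: mxvec (umap x)) (const_mx (t x)).

Lemma component_vmapl s t i j :
  component (vmap s t) (lshift 1 (mxvec_index i j)) = fun x => s x * ucomp i j x.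
Proof. by apply/funext => x; rewrite /component row_mxEl mxE mxvecE. Qed.

Lemma component_vmapr s t (a : 'I_1) : component (vmap s t) (rshift (m * m) a) = t.
Proof. by apply/funext => x; rewrite /component row_mxEr mxE. Qed.

Lemma sum_vmap (F : 'I_(m * m + 1) -> R) : \sum_a F a =
  \sum_i \sum_j F (lshift 1 (mxvec_index i j)) + F (rshift (m * m) ord0).
Proof.
rewrite big_split_ord /= big_ord_recl big_ord0 addr0; congr (_ + _).
rewrite pair_big /= (reindex _ (curry_mxvec_bij m m)) /=.
by apply: eq_bigr => -[i j].
Qed.

Lemma vmap_indP (P : 'I_(m * m + 1) -> Prop) :
  (forall i j, P (lshift 1 (mxvec_index i j))) -> P (rshift (m * m) ord0) -> forall a, P a.
Proof.
move=> Pl Pr a; case: (split_ordP a) => b ->; last by rewrite ord1.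
by case/mxvec_indexP : b.
Qed.

Lemma Nice_vmap n s t : Nice n 0 s -> Nice n 0 t -> forall a, Nice n 0 (component (vmap s t) a).
Proof.
move=> ns nt; apply: vmap_indP => [i j|]; last by rewrite component_vmapr.
by rewrite component_vmapl; exact: (Nice_mul ns (Nice_ucomp n i j)).
Qed.

Lemma vmap_dot s t x (w : 'I_(m * m + 1) -> R) : x != 0 ->
  \sum_a vmap s t x ord0 a * w a =
  s x * (\sum_i \sum_j ucomp i j x * w (lshift 1 (mxvec_index i j))) + t x * w (rshift (m * m) ord0).
Proof.
move=> x0; rewrite sum_vmap; congr (_ + _); last by rewrite row_mxEr mxE.
rewrite mulr_sumr; apply: eq_bigr => i _; rewrite mulr_sumr; apply: eq_bigr => j _.
by rewrite row_mxEl mxE mxvecE mulrA.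
Qed.

Lemma enorm_vmap s t x : x != 0 -> s x ^+ 2 + t x ^+ 2 = 1 -> enorm (vmap s t x) = 1.
Proof.
move=> x0 st; rewrite /enorm sum_vmap row_mxEr mxE.
rewrite (eq_bigr (fun i => s x ^+ 2 * \sum_j ucomp i j x ^+ 2)); last first.
  move=> i _; rewrite mulr_sumr; apply: eq_bigr => j _.
  by rewrite row_mxEl mxE mxvecE exprMn.
by rewrite -mulr_sumr sum_ucomp2// mulr1 st sqrtr1.
Qed.

(** The gradient is parallel to x, hence orthogonal to the gradients of the 0-homogeneous u_ij; all
    cross terms between s and u drop out. *)
Definition radial s := forall x, x != 0 -> exists A, forall k, partial k s x = A * angl k x.

Lemma radial_grad_dot_ucomp s i j x : radial s -> x != 0 -> grad_dot s (ucomp i j) x = 0.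
Proof.
move=> rs x0; have [A pA] := rs x x0; rewrite /grad_dot.
under eq_bigr => k _ do rewrite pA -mulrA.
by rewrite -mulr_sumr sum_angl_partial_ucomp// mulr0.
Qed.

Lemma cgrad_dot_vmap s t x : Nice 1 0 s -> radial s -> x != 0 ->
  cgrad_dot (vmap s t) (vmap s t) x =
  grad_dot s s x + 2 * m%:R * i2 x * s x ^+ 2 + grad_dot t t x.
Proof.
move=> ns rs x0; rewrite /cgrad_dot sum_vmap component_vmapr; congr (_ + _).
rewrite (eq_bigr (fun i => \sum_j (grad_dot s s x * ucomp i j x ^+ 2 +
   s x ^+ 2 * \sum_k partial k (ucomp i j) x ^+ 2))).
  under eq_bigr => i _ do rewrite big_split /= -!mulr_sumr.
  rewrite big_split /= -!mulr_sumr sum_ucomp2// sum_grad_ucomp2// mulr1; congr (_ + _).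
  by rewrite mulrC.
move=> i _; apply: eq_bigr => j _; rewrite component_vmapl.
rewrite (eq_bigr (fun k => partial k s x * partial k s x * ucomp i j x ^+ 2 +
  (2 * s x * ucomp i j x * (partial k s x * partial k (ucomp i j) x) +
   s x ^+ 2 * partial k (ucomp i j) x ^+ 2))).
  rewrite !big_split /= -!mulr_sumr -mulr_suml -/(grad_dot s s x) -/(grad_dot s (ucomp i j) x).
  by rewrite radial_grad_dot_ucomp// mulr0 add0r.
move=> k _; rewrite (partialM k ns (Nice_ucomp 1 i j) x0).
by move: (partial k s x) (partial k (ucomp i j) x) => a b; ring.
Qed.

Lemma lap_vmapl s i j x : Nice 2 0 s -> radial s -> x != 0 ->
  lap (fun y => s y * ucomp i j y) x = (lap s x - 2 * m%:R * i2 x * s x) * ucomp i j x.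
Proof.
move=> ns rs x0; rewrite (lapM ns (Nice_ucomp 2 i j) x0).
rewrite radial_grad_dot_ucomp// lap_ucomp//.
by move: (lap s x) => a; ring.
Qed.

Lemma clap_dot_vmap s t x : Nice 2 0 s -> radial s -> x != 0 ->
  clap_dot (vmap s t) (vmap s t) x =
  (lap s x - 2 * m%:R * i2 x * s x) ^+ 2 + lap t x ^+ 2.
Proof.
move=> ns rs x0; rewrite /clap_dot sum_vmap component_vmapr [lap t x ^+ 2]expr2; congr (_ + _).
rewrite (eq_bigr (fun i => \sum_j (lap s x - 2 * m%:R * i2 x * s x) ^+ 2 * ucomp i j x ^+ 2)).
  under eq_bigr => i _ do rewrite -mulr_sumr.
  by rewrite -mulr_sumr sum_ucomp2// mulr1.
move=> i _; apply: eq_bigr => j _; rewrite component_vmapl lap_vmapl//.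
by rewrite -expr2 exprMn.
Qed.

(* i2 * f stands for -(1/2m) Delta f, so this is the biharmonic equation
   Delta^2 f + 4(m-2) div(r^-2 grad f) = 0 for f = u_ij. *)
Lemma lap_i2_ucomp i j x : x != 0 ->
  - 2 * m%:R * lap (fun y => i2 y * ucomp i j y) x =
  - 4 * (m%:R - 2) * (grad_dot i2 (ucomp i j) x + i2 x * lap (ucomp i j) x).
Proof.
move=> x0; rewrite (lapM (Nice_i2 2) (Nice_ucomp 2 i j) x0).
have -> : grad_dot i2 (ucomp i j) x = 0.
  apply: radial_grad_dot_ucomp => // y y0; exists (- 2 * rinv y ^+ 3) => k.
  by rewrite partial_i2//; ring.
rewrite lap_i2// lap_ucomp// /i2; ring.
Qed.

Lemma partial_vanish f i x : differentiable f x ->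
  (forall y, 1 <= enorm y -> f y = 0) -> 1 <= enorm x -> partial i f x = 0.
Proof. by move=> df f0 x1; apply: partial_outside => //; exact: diff_derivable. Qed.

Let sum_lin5 (a b c d : R) (F1 F2 F3 F4 F5 : 'I_m -> R) :
  \sum_k (a * F1 k - b * F2 k - c * (b * F3 k) - c * (b * (d * F4 k)) - c * (d * F5 k)) =
  a * (\sum_k F1 k) - b * (\sum_k F2 k) - c * (b * \sum_k F3 k)
   - c * (b * (d * \sum_k F4 k)) - c * (d * \sum_k F5 k).
Proof. by rewrite !mulr_sumr -!sumrB. Qed.

(** Green's identity for the field [X] = h grad g - g grad h - c r^(-2) g grad f, where h is the
    explicit expression of Delta f off the origin and c = 4 (m - 2). The equation Delta h + c
    div(r^(-2) grad f) = 0 turns its divergence into the integrand. [X] has order 3, so the origin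
    does not contribute. *)
Lemma integral_biharmonic_ucomp i j g : Nice 2 0 g -> (forall x, 1 <= enorm x -> g x = 0) ->
  (\int[mu]_(x in B) (lap (ucomp i j) x * lap g x
     - 4 * (m%:R - 2) * i2 x * grad_dot (ucomp i j) g x)%:E = 0)%E.
Proof.
move=> ng g0; set f := ucomp i j.
have nf n : Nice n 0 f := Nice_ucomp n i j.
pose h x := - 2 * m%:R * (i2 x * f x).
have nif n : Nice n 2 (fun x => i2 x * f x).
  by have := Nice_mul (Nice_i2 n) (nf n).
have nh n : Nice n 2 h.
  have := Nice_mul (Nice_cst n 0 (- 2 * m%:R)) (nif n); exact.
pose c : R := 4 * (m%:R - 2).
pose X k x := h x * partial k g x - g x * partial k h x - c * i2 x * partial k f x * g x.
have ng1 := Nice_anti (isT : (1 <= 2)%N) ng.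
have nX k : Nice 1 3 (X k).
  apply: Nice_sub; last first.
    apply: (Nice_mul (p := 3) (q := 0)) => //.
    apply: (Nice_mul (p := 2) (q := 1)); last exact: Nice_partial (nf 2).
    exact: (Nice_mul (p := 0) (Nice_cst 1 0 c) (Nice_i2 1)).
  apply: Nice_sub; first exact: (Nice_mul (nh 1) (Nice_partial k ng)).
  exact: (Nice_mul ng1 (Nice_partial k (nh 2))).
have X0 k x : 1 <= enorm x -> X k x = 0.
  move=> x1; have x0 : x != 0 by rewrite -enorm_gt0 (lt_le_trans ltr01 x1).
  rewrite /X g0// (partial_vanish k (Nice_diff ng x0) g0 x1).
  by rewrite !mulr0 mul0r !subr0.
have iX k : mu.-integrable B (EFin \o partial k (X k)).
  exact: (Nice_integrable m5 (isT : (4 <= 4)%N) (Nice_partial k (nX k))).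
have : (\int[mu]_(x in B) (\sum_k partial k (X k) x)%:E = 0)%E.
  under eq_integral => x _ do rewrite -sumEFin.
  rewrite integral_sum//; apply: big1 => k _; exact: (integral_partial_eq0 m5 k (nX k) (X0 k)).
move=> <-; apply: eq_integral_off0 => //.
- apply: measurable_funB.
    apply: measurable_funM; apply: measurable_sum => k.
      exact: Nice_measurable (Nice_partial k (Nice_partial k (nf 2))).
    exact: Nice_measurable (Nice_partial k (Nice_partial k ng)).
  apply: measurable_funM.
    by apply: measurable_funM; [exact: measurable_cst|exact: Nice_measurable (Nice_i2 0)].
  apply: measurable_sum => k; apply: measurable_funM.
    exact: Nice_measurable (Nice_partial k (nf 1)).
  exact: Nice_measurable (Nice_partial k ng).
- by apply: measurable_sum => k; exact: Nice_measurable (Nice_partial k (nX k)).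
move=> x x0 _.
have hE : lap f x = h x by rewrite /h /f lap_ucomp.
have hh : lap h x = - c * (grad_dot i2 f x + i2 x * lap f x).
  by rewrite (lapZ _ (nif 2) x0) lap_i2_ucomp// /c mulNr.
have S5 : _ = h x * lap g x - g x * lap h x - c * (g x * grad_dot i2 f x)
    - c * (g x * (i2 x * lap f x)) - c * (i2 x * grad_dot f g x) :=
  sum_lin5 (h x) (g x) c (i2 x) (fun k => partial k (partial k g) x)
    (fun k => partial k (partial k h) x) (fun k => partial k i2 x * partial k f x)
    (fun k => partial k (partial k f) x) (fun k => partial k f x * partial k g x).
transitivity (h x * lap g x - g x * lap h x - c * (g x * grad_dot i2 f x)
    - c * (g x * (i2 x * lap f x)) - c * (i2 x * grad_dot f g x)).
  rewrite hh hE -/c.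
  by move: (lap g x) (grad_dot i2 f x) (grad_dot f g x) (h x) => a b d e; ring.
rewrite -S5; apply: eq_bigr.
move=> k _.
have dg := pdiffP (Nice_diff ng x0); have df := pdiffP (Nice_diff (nf 0%N) x0).
have dh := pdiffP (Nice_diff (nh 0%N) x0); have di := pdiffP (Nice_diff (Nice_i2 0) x0).
have dpg := pdiffP (Nice_diff (Nice_partial k ng) x0).
have dpf := pdiffP (Nice_diff (Nice_partial k (nf 1)) x0).
have dph := pdiffP (Nice_diff (Nice_partial k (nh 1)) x0).
have d1 := pdiffM dh dpg; have d2 := pdiffM dg dph.
have d3 := pdiffM (pdiffM (pdiffM (pdiff_cst c x) di) dpf) dg.
rewrite (pdiffD (pdiffD d1 (pdiffN d2)) (pdiffN d3)).2.
move: (partial k (partial k g) x) (partial k g x) (partial k (partial k f) x) (partial k f x)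
  (partial k (partial k h) x) (partial k h x) (partial k i2 x) => a1 a2 a3 a4 a5 a6 a7.
ring.
Qed.

End vmap.

(** * The map is proper weakly biharmonic *)

Section biharmonic.
Context {R : realType} {m : nat}.
Hypothesis m5 : (5 <= m)%N.
Implicit Types (f g s t : 'rV[R]_m -> R) (x : 'rV[R]_m) (i j k : 'I_m).
Notation mu := (@lebesgue_rV R m).
Notation B := (@uball R m).
Let mB := @measurable_uball R m.

Lemma Nice_lap n p f : Nice n.+2 p f -> Nice n p.+2 (lap f).
Proof. by move=> nf; apply: Nice_sum => k; do 2 apply: Nice_partial. Qed.

Lemma Nice_grad_dot n p q f g : Nice n.+1 p f -> Nice n.+1 q g ->
  Nice n (p.+1 + q.+1) (grad_dot f g).
Proof. by move=> nf ng; apply: Nice_sum => k; apply: Nice_mul; exact: Nice_partial. Qed.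

Lemma radial_cst (c : R) : @radial R m (fun=> c).
Proof. by move=> x _; exists 0 => k; rewrite (pdiff_cst c x).2 mul0r. Qed.

Lemma grad_dot_cst (c : R) g x : grad_dot (fun=> c) g x = 0.
Proof. by apply: big1 => k _; rewrite (pdiff_cst c x).2 mul0r. Qed.

Lemma lap_cst (c : R) x : lap (fun=> c) x = 0.
Proof.
apply: big1 => k _; rewrite (_ : partial k (fun=> c) = fun=> 0); first by rewrite (pdiff_cst 0 x).2.
by apply/funext => y; rewrite (pdiff_cst c y).2.
Qed.

Lemma sobolev_sphere_vmap s t : Nice 2 0 s -> Nice 2 0 t ->
  (forall x, x != 0 -> s x ^+ 2 + t x ^+ 2 = 1) -> sobolev_sphere 2 (vmap s t).
Proof.
move=> ns nt st; split.
  by move=> a; exact: (@sobolev_Nice R m m5 2 0 _ isT (Nice_vmap ns nt a)).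
by apply: filterS (ae_neq0 m5) => x x0 _; exact: (enorm_vmap m5 x0 (st x x0)).
Qed.

Variable alpha : R.
Hypothesis alpha_lt : 0 < alpha < pi / 2.
Hypothesis sin_alpha : sin alpha ^+ 2 = 1 - 2 / m%:R.

Let w := vmap (fun _ : 'rV[R]_m => sin alpha) (fun=> cos alpha).

Let Nw n a : Nice n 0 (component w a).
Proof. by apply: Nice_vmap => //; exact: Nice_cst. Qed.

Let m_gt0 : 0 < m%:R :> R.
Proof. by rewrite ltr0n (leq_trans _ m5). Qed.

Let m_sin2 : m%:R * sin alpha ^+ 2 = m%:R - 2.
Proof. by rewrite sin_alpha mulrBr mulr1 mulrCA divff ?mulr1// lt0r_neq0. Qed.

(** The choice of alpha enters here: 2 m sin^2 alpha = 2 (m - 2) yields the coefficient of the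
    scalar equation satisfied by the u_ij. *)
Let cgrad_w x : x != 0 -> cgrad_dot w w x = 2 * (m%:R - 2) * i2 x.
Proof.
move=> x0; rewrite cgrad_dot_vmap//; [|exact: Nice_cst|exact: radial_cst].
by rewrite !grad_dot_cst add0r addr0 -m_sin2; ring.
Qed.

Let ae_grad_ww : ae_eq mu B (cgrad_dot w w) (wgrad_dot w w) /\ measurable_fun B (wgrad_dot w w).
Proof. by apply: wgrad_dot_Nice => // a; exact: Nw. Qed.

Lemma sobolev_sphere_utilde : sobolev_sphere 2 w.
Proof.
apply: sobolev_sphere_vmap; try exact: Nice_cst.
by move=> x _; rewrite addrC cos2Dsin2.
Qed.

(** The equation splits into components. The constant last one contributes nothing, and each of the
    others is sin alpha times the scalar identity for u_ij, tested with the corresponding component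
    of psi. *)
Lemma weak_biharmonic_utilde : weak_biharmonic w.
Proof.
split; first exact: sobolev_sphere_utilde.
move=> phi tphi; set psi := tangential w phi.
have nphi n a : Nice n 0 (component phi a) := Nice_test n (tphi a).
have psiE a : component psi a = fun x => component phi a x -
    (\sum_b component w b x * component phi b x) * component w a x.
  by apply/funext => x; rewrite /component /psi /tangential !mxE.
(* Being built from w, psi need not be smooth at the origin; it enters as a function of order 0 that
   vanishes outside the ball. *)
have npsi n a : Nice n 0 (component psi a).
  rewrite psiE; apply: Nice_sub => //.
  apply: (Nice_mul (p := 0) (q := 0)); last exact: Nw.
  by apply: Nice_sum => b; exact: (Nice_mul (p := 0) (q := 0) (Nw n b) (nphi n b)).
have psi0 a x : 1 <= enorm x -> component psi a x = 0.
  move=> x1; have xB : ~ B x by apply/negP; rewrite -leNgt.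
  rewrite psiE (test_outside (tphi a) xB) big1 ?mul0r ?subrr// => b _.
  by rewrite (test_outside (tphi b) xB) mulr0.
pose psil i j := component psi (lshift 1 (mxvec_index i j)).
pose T i j x := lap (ucomp i j) x * lap (psil i j) x
     - 4 * (m%:R - 2) * i2 x * grad_dot (ucomp i j) (psil i j) x.
have nT i j : Nice 0 4 (T i j).
  apply: Nice_sub.
    exact: (Nice_mul (p := 2) (q := 2) (Nice_lap (Nice_ucomp 2 i j)) (Nice_lap (npsi 2 _))).
  apply: (Nice_mul (p := 2) (q := 2)); last exact: (Nice_grad_dot (Nice_ucomp 1 i j) (npsi 1 _)).
  exact: (Nice_mul (p := 0) (q := 2) (Nice_cst 0 0 _) (Nice_i2 0)).
have iT i j : (\int[mu]_(x in B) (T i j x)%:E = 0)%E.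
  by apply: integral_biharmonic_ucomp => //; [exact: npsi|exact: psi0].
have [lE ml] := wlap_dot_Nice m5 (Nw 2) (npsi 2).
have [gE mg] := wgrad_dot_Nice m5 (Nw 1) (npsi 1).
have [hE mh] := ae_grad_ww.
have intT p : mu.-integrable B (fun x => (sin alpha * T p.1 p.2 x)%:E).
  exact: (Nice_integrable m5 (isT : (0 + 4 <= 4)%N) (Nice_mul (Nice_cst 0 0 (sin alpha)) (nT p.1 p.2))).
transitivity (\int[mu]_(x in B) (\sum_(p : 'I_m * 'I_m) (sin alpha * T p.1 p.2 x)%:E))%E; last first.
  rewrite integral_sum//; apply: big1 => p _.
  under eq_integral => x _ do rewrite EFinM.
  rewrite integralZl//; last exact: (Nice_integrable m5 (isT : (4 <= 4)%N) (nT p.1 p.2)).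
  by rewrite iT mule0.
apply: ae_eq_integral => //.
- apply/measurable_EFinP.
  exact: (measurable_funB ml (measurable_funM (measurable_funM (measurable_cst _) mh) mg)).
- by apply: emeasurable_sum => p; have /integrableP[mp _] := intT p; exact: mp.
have H : {ae mu, forall x, x != 0 -> B x ->
   wlap_dot w psi x = clap_dot w psi x /\ wgrad_dot w psi x = cgrad_dot w psi x /\
   wgrad_dot w w x = cgrad_dot w w x}.
  by apply: filterS3 lE gE hE => x H1 H2 H3 x0 xB; rewrite H1 ?H2 ?H3.
apply: filterS2 H (ae_neq0 m5) => x H x0 xB; have [-> [-> ->]] := H x0 xB.
rewrite sumEFin; congr EFin; rewrite cgrad_w// /clap_dot /cgrad_dot !sum_vmap.
have E0 : lap (component w (rshift (m * m) ord0)) x = 0 by rewrite component_vmapr lap_cst.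
have E1 : \sum_k partial k (component w (rshift (m * m) ord0)) x *
    partial k (component psi (rshift (m * m) ord0)) x = 0.
  by rewrite component_vmapr -/(grad_dot _ _ x) grad_dot_cst.
have E2 i j : lap (component w (lshift 1 (mxvec_index i j))) x = sin alpha * lap (ucomp i j) x.
  by rewrite component_vmapl (lapZ _ (Nice_ucomp 2 i j)).
have E3 i j : \sum_k partial k (component w (lshift 1 (mxvec_index i j))) x *
    partial k (component psi (lshift 1 (mxvec_index i j))) x =
    sin alpha * grad_dot (ucomp i j) (psil i j) x.
  rewrite component_vmapl /grad_dot mulr_sumr; apply: eq_bigr => k _.
  by rewrite (partialZ _ _ (Nice_ucomp 1 i j))// mulrA.
rewrite E0 E1 mul0r !addr0 pair_big /= mulr_sumr.
transitivity (\sum_(p : 'I_m * 'I_m) (sin alpha * (lap (ucomp p.1 p.2) x * lap (psil p.1 p.2) x)) -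
   \sum_(p : 'I_m * 'I_m) (4 * (m%:R - 2) * i2 x * (sin alpha * grad_dot (ucomp p.1 p.2) (psil p.1 p.2) x))).
  congr (_ - _); first by apply: eq_bigr => -[i j] _ /=; rewrite E2 mulrA.
  rewrite -mulr_sumr -mulr_sumr (eq_bigr (fun i => \sum_j sin alpha * grad_dot (ucomp i j) (psil i j) x)).
    by rewrite pair_big /= -!mulr_sumr; move: (\sum_p _) => S; ring.
  by move=> i _; apply: eq_bigr => j _; exact: E3.
rewrite -sumrB; apply: eq_bigr => -[i j] _ /=; rewrite /T.
by move: (lap (ucomp i j) x) (lap _ x) (grad_dot _ _ x) => a b d; ring.
Qed.

(** In the last coordinate the gradient term is 0, so the harmonic equation would leave 2 (m - 2)
    cos alpha r^(-2) = 0 weakly, with cos alpha > 0. *)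
Lemma utilde_not_weak_harmonic : ~ weak_harmonic w.
Proof.
move=> [_ H].
have H0 chi : test_function chi -> \int[mu]_(x in B) (i2 x * chi x) = 0.
  move=> tchi; have nchi n := Nice_test n tchi.
  pose phi := vmap (fun=> 0) chi.
  have t0 : test_function (fun _ : 'rV[R]_m => 0 : R).
    have e : [set x : 'rV[R]_m | (0 : R) != 0] = set0.
      by apply/seteqP; split => // x /=; rewrite eqxx.
    split; first exact: Sm_smooth (Sm_cst 0).
      by rewrite e closure0; exact: compact0.
    by rewrite e closure0.
  have tphi a : test_function (component phi a).
    move: a; apply: vmap_indP => [i j|]; last by rewrite component_vmapr.
    by rewrite component_vmapl; under eq_fun do rewrite mul0r.
  have nphi n a : Nice n 0 (component phi a) := Nice_test n (tphi a).
  have [gE mg] := wgrad_dot_Nice m5 (Nw 1) (nphi 1).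
  have [hE mh] := ae_grad_ww.
  have nF : Nice 0 2 (fun x => - (2 * (m%:R - 2) * cos alpha) * (i2 x * chi x)).
    apply: (Nice_mul (p := 0) (q := 2)); first exact: Nice_cst.
    exact: (Nice_mul (p := 2) (q := 0) (Nice_i2 0) (nchi 0)).
  have nic : Nice 0 2 (fun x => i2 x * chi x).
    exact: (Nice_mul (p := 2) (q := 0) (Nice_i2 0) (nchi 0)).
  have := H _ tphi.
  rewrite (@ae_eq_integral _ _ _ _ _ (fun x => (- (2 * (m%:R - 2) * cos alpha) * (i2 x * chi x))%:E)) //.
  - under eq_integral => x _ do rewrite EFinM.
    have ini := Nice_integrable m5 (isT : (2 <= 4)%N) nic.
    rewrite integralZl// => /eqP; rewrite mule_eq0 => /orP[|/eqP E]; last by rewrite /Rintegral E.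
    rewrite eqe oppr_eq0 !mulf_eq0 pnatr_eq0 /= => /orP[/eqP m2|/eqP c0].
      have : (2 : R) < m%:R by rewrite ltr_nat (leq_trans _ m5).
      by rewrite -subr_gt0 m2 ltxx.
    have /andP[a1 a2] := alpha_lt.
    have : 0 < cos alpha by apply: cos_gt0_pihalf; rewrite a2 andbT; lra.
    by rewrite c0 ltxx.
  - apply/measurable_EFinP; apply: (measurable_funB mg); apply: (measurable_funM mh).
    apply: measurable_sum => a; apply: measurable_funM.
      exact: Nice_measurable (Nw 0 a).
    exact: Nice_measurable (nphi 0 a).
  - by apply/measurable_EFinP; exact: Nice_measurable nF.
  have H' : {ae mu, forall x, x != 0 -> B x ->
    wgrad_dot w phi x = cgrad_dot w phi x /\ wgrad_dot w w x = cgrad_dot w w x}.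
    by apply: filterS2 gE hE => x H1 H2 x0 xB; rewrite H1 ?H2.
  apply: filterS2 H' (ae_neq0 m5) => x H' x0 xB; have [-> ->] := H' x0 xB.
  congr EFin; rewrite cgrad_w//.
  have -> : cgrad_dot w phi x = 0.
    rewrite /cgrad_dot; apply: big1 => a _; move: a; apply: vmap_indP => [i j|].
      rewrite /phi !component_vmapl (_ : (fun y => 0 * ucomp i j y) = fun=> 0); last first.
        by apply/funext => y; rewrite mul0r.
      by apply: big1 => k _; rewrite (pdiff_cst 0 x).2 mulr0.
    by rewrite component_vmapr -/(grad_dot _ _ x) grad_dot_cst.
  have -> : \sum_a w x ord0 a * phi x ord0 a = cos alpha * chi x.
    rewrite vmap_dot// /phi row_mxEr mxE big1 ?mulr0 ?add0r// => i _.
    by apply: big1 => j _; rewrite row_mxEl mxE mul0r mulr0.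
  by ring.
have li2 : L1loc (i2 : 'rV[R]_m -> R) by apply: (L1loc_Nice m5 (isT : (2 <= 4)%N) (Nice_i2 0)).
have H1 := L1loc_eq0 li2 H0.
(* r^(-2) is positive off the origin, so its vanishing almost everywhere would make the ball a null
   set. *)
have [N [mN N0 sN]] : {ae mu, forall x, ~ B x}.
  apply: filterS2 (ae_neq0 m5) H1 => x x0 Hx xB; have := Hx xB.
  rewrite /i2 /= => /eqP; rewrite expf_eq0 /= => /eqP i0.
  by have := rinv_gt0 x0; rewrite i0 ltxx.
have := @mu_uball_gt0 R m; apply/negP; rewrite -leNgt -N0.
by apply: le_measure; rewrite ?inE// => x xB; apply: sN => /=; apply.
Qed.

Lemma proper_weak_biharmonic_utilde : proper_weak_biharmonic (@utilde R m alpha).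
Proof. by split; [exact: weak_biharmonic_utilde|exact: utilde_not_weak_harmonic]. Qed.

End biharmonic.

(** * Uniform first-order estimates for sine and cosine *)

Section trig_estimates.
Context {R : realType}.
Implicit Types t h y : R.

Lemma sin_norm_le t : `|sin t| <= `|t|.
Proof.
wlog t0 : t / 0 < t => [H|].
  have [t0|t0|->] := ltgtP t 0; [|exact: H|by rewrite sin0 normr0].
  by rewrite -normrN -sinN -[`|t|]normrN; apply: H; rewrite oppr_gt0.
have [|c _] := @MVT R sin cos 0 t t0 (fun x _ => is_derive_sin x).
  by apply: continuous_subspaceT => x; exact: continuous_sin.
rewrite sin0 !subr0 => ->; rewrite normrM ler_piMl//.
by rewrite ler_norml cos_geN1 cos_le1.
Qed.

Lemma cos_sub1_norm_le t : `|cos t - 1| <= t ^+ 2.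
Proof.
have -> : cos t - 1 = - 2 * sin (t / 2) ^+ 2.
  have {1}-> : t = t / 2 + t / 2 by lra.
  by rewrite cosD -!expr2 cos2sin2; ring.
rewrite normrM normrN (ger0_norm (_ : 0 <= 2))// ger0_norm ?sqr_ge0//.
have : sin (t / 2) ^+ 2 <= (t / 2) ^+ 2.
  rewrite -[leLHS]real_normK ?num_real// -[leRHS]real_normK ?num_real//.
  by rewrite ler_pXn2r ?nnegrE//; exact: sin_norm_le.
have := sqr_ge0 t; lra.
Qed.

Lemma sin_sub_norm_le t : `|t| <= 1 -> `|sin t - t| <= t ^+ 2.
Proof.
wlog t0 : t / 0 < t => [H t1|].
  have [t0|t0|->] := ltgtP t 0; [|exact: H|by rewrite sin0 subrr normr0 sqr_ge0].
  have := H (- t); rewrite oppr_gt0 => /(_ t0); rewrite normrN => /(_ t1).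
  by rewrite sinN sqrrN -opprD normrN.
rewrite (gtr0_norm t0) => t1.
have d (x : R) : is_derive x 1 (fun y : R => sin y - y) (cos x - 1).
  exact: (@is_deriveB _ _ _ sin id x 1 _ _ (is_derive_sin x) (is_derive_id _ _)).
have [|c] := @MVT R (fun y => sin y - y) (fun x => cos x - 1) 0 t t0 (fun x _ => d x).
  apply: continuous_subspaceT => x; apply: (@differentiable_continuous _ _ _ x).
  by apply/derivable1_diffP; exact: (@ex_derive _ _ _ _ _ _ _ (d x)).
rewrite in_itv /= => /andP[c0 ct]; rewrite sin0 !subr0 => ->.
rewrite normrM (gtr0_norm t0) expr2; apply: ler_wpM2r; first exact: ltW.
apply: le_trans (cos_sub1_norm_le c) _; rewrite expr2.
by apply: le_trans (_ : c * 1 <= _); [apply: ler_wpM2l; lra|lra].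
Qed.

Lemma is_derive_sinM h y : is_derive y 1 (fun y => sin (h * y)) (h * cos (h * y)).
Proof.
have d : is_derive y 1 (fun y => h * y) h.
  by have := @is_deriveZ _ _ _ id h y 1 _ (is_derive_id _ _); rewrite /GRing.scale /= mulr1.
by rewrite mulrC; exact: (@is_derive1_comp _ sin _ _ _ _ (is_derive_sin (h * y)) d).
Qed.

Lemma is_derive_cosM h y : is_derive y 1 (fun y => cos (h * y)) (- (h * sin (h * y))).
Proof.
have d : is_derive y 1 (fun y => h * y) h.
  by have := @is_deriveZ _ _ _ id h y 1 _ (is_derive_id _ _); rewrite /GRing.scale /= mulr1.
rewrite (_ : - (h * sin (h * y)) = - sin (h * y) * h); last by ring.
exact: (@is_derive1_comp _ cos _ _ _ _ (is_derive_cos (h * y)) d).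
Qed.

(* The remainders of the first-order expansions of cos and sin, with their
   derivatives in y. *)
Definition cos_rem h (j : nat) y : R :=
  match j with
  | 0 => h^-1 * (cos (h * y) - 1)
  | 1 => - sin (h * y)
  | 2 => - (h * cos (h * y))
  | _ => h ^+ 2 * sin (h * y)
  end.

Definition sin_rem h (j : nat) y : R :=
  match j with
  | 0 => h^-1 * sin (h * y) - y
  | 1 => cos (h * y) - 1
  | 2 => - (h * sin (h * y))
  | _ => - (h ^+ 2 * cos (h * y))
  end.

Lemma is_derive_cos_rem h j y : h != 0 -> (j <= 2)%N ->
  is_derive y 1 (cos_rem h j) (cos_rem h j.+1 y).
Proof.
move=> h0; case: j => [|[|[|//]]] _ /=.
- have d := @is_deriveB _ _ _ (fun y => cos (h * y)) (cst 1) y 1 _ _ (is_derive_cosM h y) (is_derive_cst _ _ _).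
  have := @is_deriveZ _ _ _ _ h^-1 y 1 _ d; rewrite subr0 /GRing.scale /= mulrN mulrA mulVf// mul1r; exact.
- by have := @is_deriveN _ _ _ _ y 1 _ (is_derive_sinM h y); exact.
- have := @is_deriveN _ _ _ _ y 1 _ (@is_deriveZ _ _ _ _ h y 1 _ (is_derive_cosM h y)).
  by rewrite /GRing.scale /= mulrN opprK mulrA -expr2; exact.
Qed.

Lemma is_derive_sin_rem h j y : h != 0 -> (j <= 2)%N ->
  is_derive y 1 (sin_rem h j) (sin_rem h j.+1 y).
Proof.
move=> h0; case: j => [|[|[|//]]] _ /=.
- have d := @is_deriveZ _ _ _ _ h^-1 y 1 _ (is_derive_sinM h y).
  have := @is_deriveB _ _ _ _ id y 1 _ _ d (is_derive_id _ _).
  by rewrite /GRing.scale /= mulrA mulVf// mul1r; exact.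
- have d := @is_deriveB _ _ _ (fun y => cos (h * y)) (cst 1) y 1 _ _ (is_derive_cosM h y) (is_derive_cst _ _ _).
  by rewrite subr0 in d.
- have := @is_deriveN _ _ _ _ y 1 _ (@is_deriveZ _ _ _ _ h y 1 _ (is_derive_sinM h y)).
  by rewrite /GRing.scale /= mulrA -expr2; exact.
Qed.

(** Order 0 uses the quadratic error of the expansions; each later derivative is small by itself or
    carries a factor h. One rate for j <= 2 is what convergence in W^{2,2} needs. *)
Lemma rem_bound h j y : h != 0 -> `|h| <= 1 -> `|y| <= 1 -> (j <= 2)%N ->
  `|cos_rem h j y| <= `|h| /\ `|sin_rem h j y| <= `|h|.
Proof.
move=> h0 h1 y1.
have hp : 0 < `|h| by rewrite normr_gt0.
have hy : `|h * y| <= `|h| by rewrite normrM ler_piMr.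
have hy1 : `|h * y| <= 1 by exact: le_trans hy h1.
have hy2 : (h * y) ^+ 2 <= `|h| ^+ 2.
  by rewrite -[leLHS]real_normK ?num_real// ler_pXn2r ?nnegrE.
have h2 : `|h| ^+ 2 <= `|h| by rewrite expr2 ler_piMl.
have div t : `|t| <= (h * y) ^+ 2 -> `|h^-1 * t| <= `|h|.
  move=> tb; rewrite normrM normfV mulrC ler_pdivrMr// -expr2.
  exact: le_trans tb hy2.
have sb : `|sin (h * y)| <= 1 by rewrite ler_norml sin_geN1 sin_le1.
have cb : `|cos (h * y)| <= 1 by rewrite ler_norml cos_geN1 cos_le1.
case: j => [|[|[|//]]] _ /=; split.
- by apply: div; exact: cos_sub1_norm_le.
- have -> : h^-1 * sin (h * y) - y = h^-1 * (sin (h * y) - h * y).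
    by rewrite mulrBr mulrA mulVf// mul1r.
  by apply: div; exact: sin_sub_norm_le.
- by rewrite normrN (le_trans (sin_norm_le _)).
- by rewrite (le_trans (cos_sub1_norm_le _))// (le_trans hy2).
- by rewrite normrN normrM ler_piMr.
- by rewrite normrN normrM ler_piMr.
Qed.

End trig_estimates.

(** * The variation: a smooth curve in W^{2,2} with fixed boundary data *)

Section curve.
Context {R : realType} {m : nat}.
Hypothesis m5 : (5 <= m)%N.
Implicit Types (f g : 'rV[R]_m -> R) (x : 'rV[R]_m) (i j : 'I_m) (s h : R).
Notation mu := (@lebesgue_rV R m).
Notation B := (@uball R m).

(** Any power above 1 keeps the boundary values and gradients, but the sign of the second variation
    needs a large one: with exponent 6 it is exactly 0 at m = 12. *)
Definition eta x : R := (1 - rho x) ^+ 8.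

Lemma Sm_eta : Sm eta.
Proof. by apply: Sm_exp; apply: Sm_sub; [exact: Sm_cst|exact: Sm_rho]. Qed.

Lemma eta_le1 x : enorm x <= 1 -> `|eta x| <= 1.
Proof.
rewrite enorm_le1 => x1; have := rho_ge0 x => x0.
by rewrite ger0_norm ?exprn_ge0 ?subr_ge0// exprn_ile1//; lra.
Qed.

Lemma pdiff_eta x : pdiff eta x (fun i => - 16 * (1 - rho x) ^+ 7 * x ord0 i).
Proof.
have d := pdiffD (pdiff_cst 1 x) (pdiffN (pdiff_rho x)).
have dk : is_derive (1 - rho x) 1 (fun t : R => t ^+ 8) (8 * (1 - rho x) ^+ 7).
  have := @is_deriveX R R id 8 (1 - rho x) 1 1 (is_derive_id _ _).
  by rewrite /GRing.scale /= mulr1 exprfctE.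
by have := pdiff_comp d dk; apply: pdiff_fext => // i; ring.
Qed.

Variable alpha : R.

(** Each derivative in s multiplies by eta and advances the angle by pi/2, so a single formula gives
    all derivatives [Dvar k] of the curve. *)
Definition phase (k : nat) s x : R := alpha + s * eta x + k%:R * (pi / 2).

Definition Dvar k s : 'rV[R]_m -> 'rV[R]_(m * m + 1) :=
  vmap (fun x => eta x ^+ k * sin (phase k s x)) (fun x => eta x ^+ k * cos (phase k s x)).

Lemma Sm_phase k s : Sm (phase k s).
Proof.
apply: Sm_add; last exact: Sm_cst.
by apply: Sm_add; [exact: Sm_cst|apply: Sm_mul; [exact: Sm_cst|exact: Sm_eta]].
Qed.

Lemma Sm_Dvarl k s : Sm (fun x => eta x ^+ k * sin (phase k s x)).
Proof. by apply: Sm_mul; [apply: Sm_exp; exact: Sm_eta|apply: Sm_sin; exact: Sm_phase]. Qed.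

Lemma Sm_Dvarr k s : Sm (fun x => eta x ^+ k * cos (phase k s x)).
Proof. by apply: Sm_mul; [apply: Sm_exp; exact: Sm_eta|apply: Sm_cos; exact: Sm_phase]. Qed.

Lemma Nice_Dvar n k s a : Nice n 0 (component (Dvar k s) a).
Proof. by apply: Nice_vmap; apply: Nice_Sm; [exact: Sm_Dvarl|exact: Sm_Dvarr]. Qed.

Lemma Dvar0E s x : Dvar 0 s x =
  vmap (fun x => sin (alpha + s * eta x)) (fun x => cos (alpha + s * eta x)) x.
Proof. by rewrite /Dvar /vmap /phase !expr0 !mul1r mul0r addr0. Qed.

Lemma Dvar00 : Dvar 0 0 = @utilde R m alpha.
Proof. by apply/funext => x; rewrite Dvar0E /vmap mul0r addr0. Qed.

Lemma sobolev_sphere_Dvar0 s : sobolev_sphere 2 (Dvar 0 s).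
Proof.
apply: (sobolev_sphere_vmap m5).
- by apply: Nice_Sm; exact: Sm_Dvarl.
- by apply: Nice_Sm; exact: Sm_Dvarr.
- by move=> x _; rewrite !expr0 !mul1r addrC cos2Dsin2.
Qed.

(** The error of the difference quotient in s of eta^k sin(phi + s eta). Cosine is the case of phi +
    pi/2. *)
Definition sin_quot h s phi k x : R :=
  h^-1 * (eta x ^+ k * sin (phi + (s + h) * eta x) - eta x ^+ k * sin (phi + s * eta x))
   - eta x ^+ k.+1 * cos (phi + s * eta x).

Lemma sin_quotE h s phi k x : h != 0 -> sin_quot h s phi k x =
  eta x ^+ k * sin (phi + s * eta x) * cos_rem h 0 (eta x) +
  eta x ^+ k * cos (phi + s * eta x) * sin_rem h 0 (eta x).
Proof.
move=> h0; rewrite /sin_quot /cos_rem /sin_rem.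
have -> : phi + (s + h) * eta x = (phi + s * eta x) + h * eta x by ring.
rewrite sinD exprSr.
by ring.
Qed.

(** The addition formula separates factors free of h from the remainders in h eta. The constant of
    [nice_comp] is independent of the outer function, so the O(h) bounds on the remainders carry
    over to two derivatives in x. *)
Lemma nice_sin_quot s phi k : exists2 C, 0 <= C &
  forall h, h != 0 -> `|h| <= 1 -> nice 2 0 (C * `|h|) (sin_quot h s phi k).
Proof.
have Sp : Sm (fun x => phi + s * eta x).
  by apply: Sm_add; [exact: Sm_cst|apply: Sm_mul; [exact: Sm_cst|exact: Sm_eta]].
have [A nA] := Nice_Sm 2 (Sm_mul (Sm_exp k Sm_eta) (Sm_sin Sp)).
have [A' nA'] := Nice_Sm 2 (Sm_mul (Sm_exp k Sm_eta) (Sm_cos Sp)).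
have [C C0 HC] := nice_comp (Nice_Sm 2 Sm_eta).
exists (`|2 ^+ 2 * A * C| + `|2 ^+ 2 * A' * C|); first by rewrite addr_ge0.
move=> h h0 h1.
have n1 : nice 2 0 (C * `|h|) (fun x => cos_rem h 0 (eta x)).
  apply: (HC (cos_rem h) `|h|) => [j t j2|j x j2 x0 x1]; first exact: is_derive_cos_rem.
  exact: (rem_bound h0 h1 (eta_le1 x1) j2).1.
have n2 : nice 2 0 (C * `|h|) (fun x => sin_rem h 0 (eta x)).
  apply: (HC (sin_rem h) `|h|) => [j t j2|j x j2 x0 x1]; first exact: is_derive_sin_rem.
  exact: (rem_bound h0 h1 (eta_le1 x1) j2).2.
apply: (@nice_le _ _ 2 0 0 (2 ^+ 2 * A * (C * `|h|) + 2 ^+ 2 * A' * (C * `|h|))) => //.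
  rewrite mulrDl; apply: lerD; rewrite mulrA; apply: ler_wpM2r => //; exact: ler_norm.
apply: nice_off0 (nice_add (nice_mul nA n1) (nice_mul nA' n2)) => x _.
by rewrite sin_quotE.
Qed.



Lemma sobolev_norm2_le k p : (p + k <= 2)%N -> exists2 C : R, 0 <= C &
  forall M f, nice k p M f -> (sobolev_norm2 k f <= (C * M ^+ 2)%:E)%E.
Proof.
move=> pk; have [C C0 HC] := @cnorm2_bound R m m5 k p pk; exists C => // M f nf.
have Nf : Nice k p f by exists M.
rewrite (@sobolev_norm2_Nice _ _ m5 k p f f) //; first exact: HC.
- by apply: leq_trans pk _.
- exact: ae_eq_refl.
- exact: Nice_measurable Nf.
Qed.

Lemma cvg_sobolev_norm2_quot s phi k v : Nice 2 0 v ->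
  sobolev_norm2 2 (fun x => sin_quot h s phi k x * v x) @[h --> (0 : R)^'] --> 0%E.
Proof.
move=> [M nv]; have [C C0 HC] := nice_sin_quot s phi k.
have [D D0 HD] := @sobolev_norm2_le 2 0 isT.
pose K := D * (2 ^+ 2 * C * M) ^+ 2.
have K0 : 0 <= K by rewrite mulr_ge0// sqr_ge0.
have H : \forall h \near (0 : R)^', (0 <= sobolev_norm2 2 (fun x => sin_quot h s phi k x * v x)%R <= (K * h ^+ 2)%:E)%E.
  near=> h.
  have h0 : h != 0 by near: h; exact: nbhs_dnbhs_neq.
  have h1 : `|h| <= 1 by near: h; exact: dnbhs0_le.
  apply/andP; split.
    by rewrite /=; apply: adde_ge0; [|apply: sume_ge0 => i _; apply: adde_ge0;
      [|apply: sume_ge0 => j _; apply: adde_ge0 => //]]; apply: integral_ge0 => x _; rewrite lee_fin sqr_ge0.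
  apply: le_trans (HD _ _ (nice_mul (HC h h0 h1) nv)) _.
  rewrite lee_fin /K -[leRHS]mulrA; apply: ler_wpM2l => //.
  have -> : 2 ^+ 2 * (C * `|h|) * M = (2 ^+ 2 * C * M) * `|h| by ring.
  by rewrite exprMn real_normK ?num_real.
apply: (@squeeze_cvge _ _ _ _ (cst 0%E) _ (fun h => (K * h ^+ 2)%:E)) => //.
  exact: cvg_cst.
apply: cvg_EFin; first exact: nearW.
rewrite -[X in _ --> X](_ : K * 0 ^+ 2 = 0); last by rewrite expr0n mulr0.
apply: cvg_within_filter; apply: cvgM; first exact: cvg_cst.
exact: (@exprn_continuous _ 2 (0 : R)).
Unshelve. all: by end_near. Qed.

Lemma smooth_curve_Dvar : smooth_curve 1 (Dvar 0).
Proof.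
exists Dvar => // k s a _; split.
  exact: (@sobolev_Nice R m m5 2 0 _ isT (Nice_Dvar 2 k s a)).
pose phi : R := alpha + k%:R * (pi / 2).
have ph s' x : phase k s' x = phi + s' * eta x by rewrite /phase /phi; ring.
have ph1 s' x : phase k.+1 s' x = (phi + s' * eta x) + pi / 2.
  by rewrite /phase /phi -natr1; ring.
have cq q (P Q T : 'rV[R]_m -> 'rV[R]_q) (h : R) (b : 'I_q) x :
    component (fun x => h^-1 *: (P x - Q x) - T x) b x =
    h^-1 * (P x ord0 b - Q x ord0 b) - T x ord0 b by rewrite /component !mxE.
move: a; apply: vmap_indP => [i j|].
  have := cvg_sobolev_norm2_quot s phi k (Nice_ucomp 2 i j).
  apply: cvg_trans; apply: near_eq_cvg; apply: nearW => h; congr sobolev_norm2; apply/funext => x.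
  have E l s' : Dvar l s' x ord0 (lshift 1 (mxvec_index i j)) = eta x ^+ l * sin (phase l s' x) * ucomp i j x.
    by rewrite row_mxEl mxE mxvecE.
  by rewrite cq !E !ph ph1 sinDpihalf /sin_quot; ring.
have := cvg_sobolev_norm2_quot s (phi + pi / 2) k (Nice_cst 2 0 1).
apply: cvg_trans; apply: near_eq_cvg; apply: nearW => h; congr sobolev_norm2; apply/funext => x.
have E l s' : Dvar l s' x ord0 (rshift (m * m) ord0) = eta x ^+ l * cos (phase l s' x).
  by rewrite row_mxEr mxE.
rewrite cq !E !ph ph1 /sin_quot.
have E1 s' : phi + pi / 2 + s' * eta x = phi + s' * eta x + pi / 2 by ring.
by rewrite !E1 !sinDpihalf !cosDpihalf; ring.
Qed.

(** The singularity and the boundary are handled by different factors: tau is smooth with zero value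
    and gradient on the sphere, and v only has to be regularised near the origin. The products
    [tau * V n] then serve as approximants for both traces. *)
Lemma trace_pair tau v (V : nat -> 'rV[R]_m -> R) C :
  Sm tau -> (forall x, enorm x = 1 -> tau x = 0) ->
  (forall i x, enorm x = 1 -> partial i tau x = 0) ->
  Nice 2 0 v -> (forall n, Sm (V n)) ->
  (forall n, nice 2 0 C (fun x => V n x - v x) /\
     nice 2 2 (C * n.+1%:R^-1) (fun x => V n x - v x)) ->
  is_trace (fun x => tau x * v x) (cst 0) /\
  forall i, is_trace (wpartial i (fun x => tau x * v x)) (cst 0).
Proof.
move=> st tau0 dtau0 nv sV HV.
have [A nt] := Nice_Sm 2 st.
pose F n x := tau x * V n x.
have sF n : Sm (F n) by exact: Sm_mul.
have ntv : Nice 2 0 (fun x => tau x * v x) := Nice_mul (ex_intro _ A nt : Nice 2 0 tau) nv.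
have mtv := Nice_measurable ntv.
pose M := 2 ^+ 2 * A * C.
have nF n : nice 2 0 M (fun x => F n x - tau x * v x).
  by apply: nice_off0 (nice_mul nt (HV n).1) => x _; rewrite /F mulrBr.
have vF n : nice 2 2 (M * n.+1%:R^-1) (fun x => F n x - tau x * v x).
  have -> : M * n.+1%:R^-1 = 2 ^+ 2 * A * (C * n.+1%:R^-1) by rewrite /M; ring.
  by apply: nice_off0 (nice_mul nt (HV n).2) => x _; rewrite /F mulrBr.
have F0 n x : enorm x = 1 -> F n x = 0 by move=> x1; rewrite /F tau0// mul0r.
split.
  apply: (@is_trace_cst0 R m m5 0 M _ _ F) => //.
  - exact: Nice_anti ntv.
  - exact: ae_eq_refl.
  - by move=> n; exact: Sm_smooth.
  - by move=> n; exact: niceW.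
  - by move=> n; exact: niceW.
move=> i.
have [w1 w2] := wpartial_ae_Nice m5 i (isT : (0 <= 3)%N) (Nice_anti (isT : (1 <= 2)%N) ntv)
  (ae_eq_refl _ _ _) mtv.
have pE n x : x != 0 -> partial i (fun x => F n x - tau x * v x) x =
    partial i (F n) x - partial i (fun x => tau x * v x) x.
  move=> x0; have d1 := pdiffP (Sm_differentiable x (sF n)).
  by rewrite (pdiffD d1 (pdiffN (pdiffP (Nice_diff ntv x0)))).2.
apply: (@is_trace_cst0 R m m5 1 M _ _ (fun n => partial i (F n)) _ _ w1 w2) => //.
- exact: (Nice_partial i ntv).
- by move=> n; apply: Sm_smooth; exact: Sm_partial.
- move=> n x x1.
  rewrite (pdiffM (pdiffP (Sm_differentiable x st)) (pdiffP (Sm_differentiable x (sV n)))).2.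
  by rewrite tau0// dtau0// !mul0r addr0.
- by move=> n; apply: nice_off0 (nice_partial i (nF n)) => x; exact: pE.
- by move=> n; apply: nice_off0 (nice_partial i (vF n)) => x; exact: pE.
Qed.

(* u_ij with r^2 replaced by r^2 + 1/(n+1). *)
Definition ureg n i j x : R := (Num.sqrt (m%:R * (m%:R - 1)))^-1 *
  (- (i == j)%:R + m%:R * (x ord0 i * x ord0 j * (rho x + n.+1%:R^-1)^-1)).

Lemma Sm_ureg n i j : Sm (ureg n i j).
Proof.
apply: Sm_mul; first exact: Sm_cst.
apply: Sm_add; first exact: Sm_cst.
apply: Sm_mul; first exact: Sm_cst.
apply: Sm_mul; first by apply: Sm_mul; exact: Sm_coord.
apply: Sm_inv => [x|]; last by apply: Sm_add; [exact: Sm_rho|exact: Sm_cst].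
by rewrite lt0r_neq0// ltr_wpDl ?rho_ge0// invr_gt0 ltr0n.
Qed.

(** The difference is a constant times (x_i/r)(x_j/r) [zeta n], so both bounds are inherited from
    [zeta]. *)
Lemma nice_ureg i j : exists C, forall n,
  nice 2 0 C (fun x => ureg n i j x - ucomp i j x) /\
  nice 2 2 (C * n.+1%:R^-1) (fun x => ureg n i j x - ucomp i j x).
Proof.
have [C HC] := @nice_zeta R m 2.
pose c := - ((Num.sqrt (m%:R * (m%:R - 1)))^-1 * m%:R) : R.
have [A nA] := Nice_mul (Nice_cst 2 0 c) (Nice_anglM 2 i j).
have E n x : x != 0 -> c * (angl i x * angl j x) * zeta n x = ureg n i j x - ucomp i j x.
  move=> x0; rewrite ucompE /ureg /c /zeta /angl.
  have -> : x ord0 i * rinv x * (x ord0 j * rinv x) = x ord0 i * x ord0 j * (rho x)^-1.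
    by rewrite -rinv2; ring.
  have r0 : rho x != 0 by rewrite lt0r_neq0// rho_gt0.
  have e0 : (0 : R) < n.+1%:R^-1 by rewrite invr_gt0 ltr0n.
  have re : rho x + n.+1%:R^-1 != 0 by rewrite lt0r_neq0// ltr_wpDl ?rho_ge0.
  move: e0 re r0; move: (n.+1%:R^-1 : R) (rho x) (Num.sqrt _)^-1 => e r q e0 re r0.
  by field; rewrite re r0.
exists (2 ^+ 2 * A * C) => n; split.
  exact: nice_off0 (E n) (nice_mul nA (HC n).1).
have -> : 2 ^+ 2 * A * C * n.+1%:R^-1 = 2 ^+ 2 * A * (C * n.+1%:R^-1) by ring.
exact: nice_off0 (E n) (nice_mul nA (HC n).2).
Qed.

Lemma eta_sphere x : enorm x = 1 -> eta x = 0 /\ forall i, partial i eta x = 0.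
Proof.
move=> x1; have r1 : rho x = 1 by rewrite -sqr_enorm x1 expr1n.
by split=> [|i]; rewrite ?(pdiff_eta x).2 /eta r1 subrr expr0n ?mulr0 ?mul0r.
Qed.

Lemma same_boundary_data_Dvar s : same_boundary_data (Dvar 0 s) (@utilde R m alpha).
Proof.
rewrite -Dvar00.
have cE a : (component (Dvar 0 s) a \- component (Dvar 0 0) a) =
   fun x => component (Dvar 0 s) a x - component (Dvar 0 0) a x by [].
have d x : pdiff (fun x => alpha + s * eta x) x (fun i => s * partial i eta x).
  have := pdiffD (pdiff_cst alpha x) (pdiffM (pdiff_cst s x) (pdiffP (Sm_differentiable x Sm_eta))).
  by apply: pdiff_fext => // i; rewrite mul0r !add0r.
have S1 : Sm (fun x => alpha + s * eta x).
  by apply: Sm_add; [exact: Sm_cst|apply: Sm_mul; [exact: Sm_cst|exact: Sm_eta]].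
move=> a; rewrite cE; move: a; apply: vmap_indP => [i j|].
  rewrite !component_vmapl.
  have -> : (fun x => eta x ^+ 0 * sin (phase 0 s x) * ucomp i j x -
     eta x ^+ 0 * sin (phase 0 0 x) * ucomp i j x) =
     (fun x => (sin (alpha + s * eta x) - sin alpha) * ucomp i j x).
    by apply/funext => x; rewrite /phase !expr0 !mul1r !mul0r !addr0; ring.
  have [C HC] := nice_ureg i j.
  apply: (@trace_pair _ _ (fun n => ureg n i j) C) => //.
  - by apply: Sm_sub; [exact: Sm_sin|exact: Sm_cst].
  - by move=> x /eta_sphere[-> _]; rewrite mulr0 addr0 subrr.
  - move=> k x /eta_sphere[_ e0].
    rewrite (pdiffD (pdiff_comp (d x) (is_derive_sin _)) (pdiff_cst (- sin alpha) x)).2.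
    by rewrite e0 !mulr0 addr0.
  - exact: Nice_ucomp.
  - by move=> n; exact: Sm_ureg.
rewrite !component_vmapr.
have -> : (fun x => eta x ^+ 0 * cos (phase 0 s x) - eta x ^+ 0 * cos (phase 0 0 x)) =
     (fun x => (cos (alpha + s * eta x) - cos alpha) * 1).
  by apply/funext => x; rewrite /phase !expr0 !mul1r !mul0r !addr0 mulr1.
(* The last component is smooth already: v = 1, constant approximants and C = 0. *)
apply: (@trace_pair _ (fun=> 1) (fun _ _ => 1) 0).
- by apply: Sm_sub; [exact: Sm_cos|exact: Sm_cst].
- by move=> x /eta_sphere[-> _]; rewrite mulr0 addr0 subrr.
- move=> k x /eta_sphere[_ e0].
  rewrite (pdiffD (pdiff_comp (d x) (is_derive_cos _)) (pdiff_cst (- cos alpha) x)).2.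
  by rewrite e0 !mulr0 addr0.
- exact: Nice_cst.
- by move=> n; exact: Sm_cst.
- move=> n; have n0 p : nice 2 p 0 (fun _ : 'rV[R]_m => 1 - 1 : R).
    by rewrite subrr -[X in nice _ _ X _](normr0 R); exact: nice_cst.
  by rewrite mul0r.
Qed.

End curve.

(** * Truncated powers of 1 - t *)

Section truncated_power.
Context {R : realType}.

(** Truncation extends (1 - r^2)^j by 0 beyond the sphere while keeping it differentiable for j >=
    2, as integration over the ball without boundary term requires. *)
Definition tpow (j : nat) (t : R) : R := Num.max (1 - t) 0 ^+ j.

Lemma tpow_lt1 j t : t <= 1 -> tpow j t = (1 - t) ^+ j.
Proof. by move=> t1; rewrite /tpow max_l// subr_ge0. Qed.

Lemma tpow_ge1 j t : 1 <= t -> tpow j.+1 t = 0.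
Proof. by move=> t1; rewrite /tpow max_r ?expr0n// subr_le0. Qed.

Lemma is_derive_tpow j (t : R) : is_derive t 1 (tpow j.+2) (- j.+2%:R * tpow j.+1 t).
Proof.
have [t1|t1|->] := ltgtP t 1.
- apply: (@near_eq_is_derive _ _ _ (fun s : R => (1 - s) ^+ j.+2)).
    near=> s; rewrite tpow_lt1// ltW//; near: s; exact: lt_nbhsl.
  have d : is_derive t 1 (fun s : R => 1 - s) (-1).
    have := @is_deriveB R R R (cst 1) id t 1 _ _ (is_derive_cst _ _ _) (is_derive_id _ _).
    by rewrite sub0r; exact.
  have dk : is_derive (1 - t) 1 (fun s : R => s ^+ j.+2) (j.+2%:R * (1 - t) ^+ j.+1).
    have := @is_deriveX R R id j.+2 (1 - t) 1 1 (is_derive_id _ _).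
    by rewrite /GRing.scale /= mulr1 exprfctE.
  rewrite tpow_lt1 ?ltW//.
  apply: (is_derive_eq (@is_derive1_comp _ (fun s => s ^+ j.+2) (fun s => 1 - s) _ _ _ dk d)).
  by rewrite mulrN1 mulNr.
- apply: (@near_eq_is_derive _ _ _ (cst 0)).
    near=> s; rewrite tpow_ge1// ltW//; near: s; exact: lt_nbhsr.
  by rewrite tpow_ge1 ?ltW// mulr0; exact: is_derive_cst.
- rewrite tpow_ge1// mulr0.
  have H : h^-1 *: ((tpow j.+2 \o shift 1) (h *: 1) - tpow j.+2 1) @[h --> 0^'] --> (0 : R).
    apply/cvgrPdist_le => e e0; near=> h.
    have h0 : h != 0 by near: h; exact: nbhs_dnbhs_neq.
    have h1 : `|h| <= 1 by near: h; exact: dnbhs0_le.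
    have he : `|h| <= e by near: h; exact: dnbhs0_le.
    rewrite sub0r normrN /= (tpow_ge1 j.+1 (lexx 1)) subr0 /GRing.scale /= mulr1.
    apply: le_trans he; rewrite normrM normfV mulrC ler_pdivrMr ?normr_gt0//.
    have M1 : `|Num.max (1 - (h + 1)) 0| <= `|h|.
      rewrite (_ : 1 - (h + 1) = - h); last by ring.
      by rewrite maxEle; case: ifP; rewrite ?normr0// normrN.
    rewrite /tpow normrX !exprS mulrA; apply: (@le_trans _ _ (`|h| * `|h| * 1)).
      apply: ler_pM => //.
        by apply: ler_pM.
      by rewrite exprn_ile1// (le_trans M1).
    by rewrite mulr1.
  by apply: DeriveDef; [apply/cvg_ex; exists 0|exact: cvg_lim].
Unshelve. all: by end_near. Qed.

End truncated_power.

(** * Radial fields r^(-4) S(r^2) x and their divergence *)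

Section divergence.
Context {R : realType} {m : nat}.
Hypothesis m5 : (5 <= m)%N.
Implicit Types (f g : 'rV[R]_m -> R) (x : 'rV[R]_m) (i j : 'I_m).
Notation mu := (@lebesgue_rV R m).
Notation B := (@uball R m).
Let mB := @measurable_uball R m.

(** At order 1, [nice_comp] asks for two derivatives of the outer function, hence an exponent of at
    least 3. *)
Lemma Nice_tpow_rho (j : nat) : Nice 1 0 (fun x => tpow j.+3 (rho x)).
Proof.
have [C C0 HC] := nice_comp (Nice_Sm 1 (@Sm_rho R m)).
pose g (l : nat) (t : R) : R := match l with
  | 0 => tpow j.+3 t
  | 1 => - j.+3%:R * tpow j.+2 t
  | _ => - j.+3%:R * (- j.+2%:R * tpow j.+1 t) end.
exists (C * (j.+3%:R * j.+3%:R)); apply: (HC g) => [l t|l x l1 x0 x1].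
  case: l => [|[|//]] _; first exact: is_derive_tpow.
  exact: (@is_deriveZ _ _ _ _ (- j.+3%:R) t 1 _ (is_derive_tpow j t)).
have r1 : rho x <= 1 by rewrite -enorm_le1.
have tp k : `|tpow k (rho x)| <= 1.
  rewrite tpow_lt1// ger0_norm ?exprn_ge0 ?subr_ge0// exprn_ile1 ?subr_ge0//.
  by rewrite gerBl rho_ge0.
have j1 : 1 <= j.+3%:R :> R by rewrite ler1n.
case: l l1 => [|[|//]] _ /=.
  by apply: le_trans (tp _) _; rewrite mulr_ege1.
rewrite normrM normrN normr_nat; apply: ler_pM => //.
by apply: le_trans (tp _) _.
Qed.

Variables (I : Type) (r : seq I) (c : I -> R) (e : I -> nat).
Let S (t : R) : R := \sum_(l <- r) c l * tpow (e l).+3 t.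
Let dS (t : R) : R := \sum_(l <- r) c l * (- (e l).+3%:R * tpow (e l).+2 t).

(** The i-th component of r^(-4) S(r^2) x, factored so that its order 3 can be read off. *)
Definition rfield i x : R := angl i x * (rinv x * i2 x) * S (rho x).

Lemma Nice_rfield i : Nice 1 3 (rfield i).
Proof.
apply: (Nice_mul (p := 3) (q := 0)).
  exact: (Nice_mul (p := 0) (q := 3) (Nice_angl 1 i) (Nice_mul (Nice_rinv 1) (Nice_i2 1))).
have nl l : Nice 1 0 (fun x => c l * tpow (e l).+3 (rho x)).
  by have := Nice_mul (Nice_cst 1 0 (c l)) (Nice_tpow_rho (e l)); exact.
exact: (Nice_sum r nl).
Qed.

Lemma pdiff_S x : pdiff (fun y => S (rho y)) x (fun i => dS (rho x) * (2 * x ord0 i)).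
Proof.
have d l := pdiffM (pdiff_cst (c l) x) (pdiff_comp (pdiff_rho x) (is_derive_tpow (e l).+1 (rho x))).
have := pdiff_sum r d; apply: pdiff_fext => // i.
by rewrite /dS mulr_suml; apply: eq_bigr => l _; rewrite mul0r add0r !mulrA.
Qed.

Lemma sum_partial_rfield x : x != 0 -> \sum_i partial i (rfield i) x =
  rinv x ^+ 4 * ((m%:R - 4) * S (rho x) + 2 * rho x * dS (rho x)).
Proof.
move=> x0.
have di : pdiff (i2 : 'rV[R]_m -> R) x (fun k => - 2 * (angl k x * rinv x ^+ 3)).
  by apply: pdiff_fext (pdiffP (Nice_diff (Nice_i2 0) x0)) => // k; exact: partial_i2.
rewrite (eq_bigr (fun i => rinv x ^+ 4 * S (rho x) - 4 * rinv x ^+ 4 * S (rho x) * angl i x ^+ 2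
    + 2 * rinv x ^+ 2 * dS (rho x) * angl i x ^+ 2)).
  rewrite !big_split /= sumrN -!mulr_sumr sum_angl2// sumr_const card_ord -mulr_natl.
  have -> : rinv x ^+ 2 = rinv x ^+ 4 * rho x.
    have -> : rinv x ^+ 4 = rinv x ^+ 2 * rinv x ^+ 2 by rewrite -exprD.
    by rewrite -mulrA {3}rinv2 mulVf ?mulr1// lt0r_neq0// rho_gt0.
  by ring.
move=> i _.
rewrite (pdiffM (pdiffM (pdiff_angl i x0) (pdiffM (pdiff_rinv_angl x0) di)) (pdiff_S x)).2.
rewrite eqxx /= /i2.
have -> : angl i x * (rinv x * rinv x ^+ 2) * (dS (rho x) * (2 * x ord0 i)) =
   2 * rinv x ^+ 2 * dS (rho x) * (angl i x * (x ord0 i * rinv x)) by ring.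
by rewrite -/(angl i x); ring.
Qed.

Lemma Nice_divergence_rfield :
  Nice 0 4 (fun x => rinv x ^+ 4 * ((m%:R - 4) * S (rho x) + 2 * rho x * dS (rho x))).
Proof.
have nS : Nice 0 4 (fun x => \sum_i partial i (rfield i) x).
  by apply: Nice_sum => i; exact: (Nice_partial i (Nice_rfield i)).
by apply: Nice_off0 nS => x; exact: sum_partial_rfield.
Qed.

Lemma integral_sum_partial_rfield :
  (\int[mu]_(x in B) (rinv x ^+ 4 * ((m%:R - 4) * S (rho x) + 2 * rho x * dS (rho x)))%:E = 0)%E.
Proof.
have nr := Nice_rfield.
have nS : Nice 0 4 (fun x => \sum_i partial i (rfield i) x).
  by apply: Nice_sum => i; exact: (Nice_partial i (nr i)).
rewrite (eq_integral_off0 m5 (g := fun x => \sum_i partial i (rfield i) x)).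
- under eq_integral => x _ do rewrite -sumEFin.
  rewrite integral_sum//; last first.
    by move=> i; exact: (Nice_integrable m5 (isT : (4 <= 4)%N) (Nice_partial i (nr i))).
  apply: big1 => i _; apply: (integral_partial_eq0 m5 i (nr i)) => x x1.
  rewrite /rfield /S big1 ?mulr0// => l _; rewrite tpow_ge1 ?mulr0//.
  by rewrite -sqr_enorm expr_ge1// enorm_ge0.
- exact: Nice_measurable Nice_divergence_rfield.
- exact: Nice_measurable nS.
- by move=> x x0 _; rewrite sum_partial_rfield.
Qed.

End divergence.

(** * The bienergy along the variation as the integral of a square *)

Section energy.
Context {R : realType} {m : nat}.
Hypothesis m5 : (5 <= m)%N.
Implicit Types (f g : 'rV[R]_m -> R) (x : 'rV[R]_m) (i j : 'I_m) (s h : R).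
Notation mu := (@lebesgue_rV R m).
Notation B := (@uball R m).
Let mB := @measurable_uball R m.

Lemma lap_comp (g0 g1 g2 : R -> R) f x : Sm f ->
  (forall t : R, is_derive t 1 g0 (g1 t)) -> (forall t : R, is_derive t 1 g1 (g2 t)) ->
  lap (fun y => g0 (f y)) x = g2 (f x) * grad_dot f f x + g1 (f x) * lap f x.
Proof.
move=> sf d0 d1.
have df y := pdiffP (Sm_differentiable y sf).
have E i : partial i (fun y => g0 (f y)) = fun y => g1 (f y) * partial i f y.
  by apply/funext => y; rewrite (pdiff_comp (df y) (d0 (f y))).2.
rewrite /lap /grad_dot !mulr_sumr -big_split /=; apply: eq_bigr => i _; rewrite E.
have dp := pdiffP (Sm_differentiable x (Sm_partial i sf)).
by rewrite (pdiffM (pdiff_comp (df x) (d1 (f x))) dp).2 mulrA.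
Qed.

Lemma grad_dot_comp (g0 g1 : R -> R) f x : Sm f ->
  (forall t : R, is_derive t 1 g0 (g1 t)) ->
  grad_dot (fun y => g0 (f y)) (fun y => g0 (f y)) x = g1 (f x) ^+ 2 * grad_dot f f x.
Proof.
move=> sf d0; have df := pdiffP (Sm_differentiable x sf).
rewrite /grad_dot mulr_sumr; apply: eq_bigr => i _.
rewrite (pdiff_comp df (d0 (f x))).2.
by move: (partial i f x) => a; ring.
Qed.

Lemma lap_eta x : lap eta x = - 16 * m%:R * (1 - rho x) ^+ 7 + 224 * rho x * (1 - rho x) ^+ 6.
Proof.
have E i : partial i eta = fun y => - 16 * (1 - rho y) ^+ 7 * y ord0 i.
  by apply/funext => y; rewrite (pdiff_eta y).2.
rewrite /lap (eq_bigr (fun i => - 16 * (1 - rho x) ^+ 7 + 224 * (1 - rho x) ^+ 6 * x ord0 i ^+ 2)).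
  rewrite big_split /= sumr_const card_ord -mulr_sumr -/(rho x) -mulr_natl; ring.
move=> i _; rewrite E.
have d := pdiffD (pdiff_cst 1 x) (pdiffN (pdiff_rho x)).
have dk : is_derive (1 - rho x) 1 (fun t : R => t ^+ 7) (7 * (1 - rho x) ^+ 6).
  have := @is_deriveX R R id 7 (1 - rho x) 1 1 (is_derive_id _ _).
  by rewrite /GRing.scale /= mulr1 exprfctE.
rewrite (pdiffM (pdiffM (pdiff_cst (- 16) x) (pdiff_comp d dk)) (pdiff_coord i x)).2 eqxx /=.
ring.
Qed.

Lemma radial_comp_eta (g0 g1 : R -> R) (a s : R) : (forall t : R, is_derive t 1 g0 (g1 t)) ->
  radial (fun x : 'rV[R]_m => g0 (a + s * eta x)).
Proof.
move=> d0 x x0; exists (g1 (a + s * eta x) * (s * (- 16 * (1 - rho x) ^+ 7)) * enorm x) => k.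
have d := pdiffD (pdiff_cst a x) (pdiffM (pdiff_cst s x) (pdiff_eta x)).
rewrite (pdiff_comp d (d0 _)).2 /angl.
have -> : x ord0 k = x ord0 k * rinv x * enorm x by rewrite mulfVK// enorm_eq0.
by rewrite mulfK ?enorm_eq0//; ring.
Qed.

Variable alpha : R.

Let ang s x : R := alpha + s * eta x.

Let Sm_ang s : Sm (ang s).
Proof. by apply: Sm_add; [exact: Sm_cst|apply: Sm_mul; [exact: Sm_cst|exact: Sm_eta]]. Qed.

Let lap_ang s x : lap (ang s) x = s * lap eta x.
Proof.
rewrite /lap mulr_sumr; apply: eq_bigr => i _.
have -> : partial i (ang s) = fun y => s * partial i eta y.
  apply/funext => y.
  have d := pdiffD (pdiff_cst alpha y) (pdiffM (pdiff_cst s y) (pdiffP (Sm_differentiable y Sm_eta))).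
  by rewrite d.2 mul0r !add0r.
have d := pdiffM (pdiff_cst s x) (pdiffP (Sm_differentiable x (Sm_partial i Sm_eta))).
by rewrite d.2 mul0r add0r.
Qed.

(** Delta b - (m / r^2) sin(2 b) at b = alpha + s eta, with the double angle expanded. *)
Definition psi s x : R :=
  s * lap eta x - 2 * m%:R * (i2 x * (sin (ang s x) * cos (ang s x))).

(* Completing the square: for w = (sin b u, cos b) with b radial,
   |Delta w|^2 - |grad w|^4 = (Delta b - (m / r^2) sin (2 b))^2. *)
Lemma energy_density s x : x != 0 ->
  clap_dot (Dvar alpha 0 s) (Dvar alpha 0 s) x -
  cgrad_dot (Dvar alpha 0 s) (Dvar alpha 0 s) x ^+ 2 = psi s x ^+ 2.
Proof.
move=> x0.
have -> : Dvar alpha 0 s = vmap (fun x => sin (ang s x)) (fun x => cos (ang s x)).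
  by apply/funext => y; rewrite Dvar0E.
have ns : Nice 2 0 (fun x => sin (ang s x)) by apply: Nice_Sm; exact: Sm_sin.
have rs : radial (fun x => sin (ang s x)) by exact: (radial_comp_eta alpha s (@is_derive_sin R)).
rewrite (clap_dot_vmap m5 _ ns rs x0) (cgrad_dot_vmap m5 _ (Nice_anti (isT : (1 <= 2)%N) ns) rs x0).
have dms (t : R) : is_derive t 1 (fun t : R => - sin t) (- cos t).
  by have := @is_deriveN _ _ _ _ t 1 _ (is_derive_sin t); exact.
rewrite (lap_comp x (Sm_ang s) (@is_derive_sin R) (@is_derive_cos R)).
rewrite (lap_comp x (Sm_ang s) (@is_derive_cos R) dms).
rewrite (grad_dot_comp x (Sm_ang s) (@is_derive_sin R)) (grad_dot_comp x (Sm_ang s) (@is_derive_cos R)).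
rewrite (lap_ang s x) /psi.
have sc := cos2Dsin2 (ang s x).
move: sc; move: (s * lap eta x) (grad_dot (ang s) (ang s) x) (sin _) (cos _) (i2 x) => L N S C I sc.
pose T := 2 * m%:R * I.
(* A polynomial identity in unrelated S and C: the defect is exhibited as a multiple of 1 - (C^2 +
   S^2). *)
have -> : (- S * N + C * L - 2 * m%:R * I * S) ^+ 2 + (- C * N + - S * L) ^+ 2 -
  (C ^+ 2 * N + 2 * m%:R * I * S ^+ 2 + (- S) ^+ 2 * N) ^+ 2 =
  (L - 2 * m%:R * (I * (S * C))) ^+ 2 +
  (1 - (C ^+ 2 + S ^+ 2)) * (- L ^+ 2 + (C ^+ 2 + S ^+ 2) * N ^+ 2 + 2 * T * S ^+ 2 * N + T ^+ 2 * S ^+ 2).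
  rewrite /T; ring.
by rewrite sc subrr mul0r addr0.
Qed.

Lemma Nice_psi s : Nice 0 2 (psi s).
Proof.
apply: Nice_sub.
  apply: (@Nice_le _ _ 0 0 2) => //.
  exact: (Nice_mul (p := 0) (q := 0) (Nice_cst 0 0 s) (Nice_sum _ (fun k => Nice_Sm 0 (Sm_partial k (Sm_partial k Sm_eta))))).
apply: (Nice_mul (p := 0) (q := 2)); first exact: Nice_cst.
apply: (Nice_mul (p := 2) (q := 0)); first exact: Nice_i2.
by apply: Nice_Sm; apply: Sm_mul; [exact: Sm_sin|exact: Sm_cos].
Qed.

Lemma bienergy_Dvar s :
  bienergy (@Dvar R m alpha 0 s) = 2^-1 * \int[mu]_(x in B) (psi s x ^+ 2).
Proof.
rewrite /bienergy /Rintegral; congr (_ * fine _).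
have [lE ml] := wlap_dot_Nice m5 (Nice_Dvar alpha 2 0 s) (Nice_Dvar alpha 2 0 s).
have [gE mg] := wgrad_dot_Nice m5 (Nice_Dvar alpha 1 0 s) (Nice_Dvar alpha 1 0 s).
apply: ae_eq_integral => //.
- by apply/measurable_EFinP; apply: measurable_funB => //; exact: measurable_funX.
- by apply/measurable_EFinP; apply: measurable_funX; exact: Nice_measurable (Nice_psi s).
have H : {ae mu, forall x, x != 0 -> B x ->
   (wlap_dot (Dvar alpha 0 s) (Dvar alpha 0 s) x - wgrad_dot (Dvar alpha 0 s) (Dvar alpha 0 s) x ^+ 2)%:E
   = (psi s x ^+ 2)%:E}.
  apply: filterS2 lE gE => x H1 H2 x0 xB.
  by rewrite -(H1 xB) -(H2 xB) energy_density.
by apply: filterS2 H (ae_neq0 m5) => x H x0 xB; exact: H.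
Qed.

Definition psi1 s x : R := lap eta x -
  2 * m%:R * (i2 x * (eta x * (cos (ang s x) ^+ 2 - sin (ang s x) ^+ 2))).
Definition psi2 s x : R := 8 * m%:R * (i2 x * (eta x ^+ 2 * (sin (ang s x) * cos (ang s x)))).

Lemma Nice_psi1 s : Nice 0 2 (psi1 s).
Proof.
apply: Nice_sub.
  apply: (@Nice_le _ _ 0 0 2) => //.
  exact: (Nice_sum _ (fun k => Nice_Sm 0 (Sm_partial k (Sm_partial k Sm_eta)))).
apply: (Nice_mul (p := 0) (q := 2)); first exact: Nice_cst.
apply: (Nice_mul (p := 2) (q := 0)); first exact: Nice_i2.
apply: Nice_Sm; apply: Sm_mul; first exact: Sm_eta.
by apply: Sm_sub; apply: Sm_exp; [exact: Sm_cos|exact: Sm_sin].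
Qed.

Lemma Nice_psi2 s : Nice 0 2 (psi2 s).
Proof.
apply: (Nice_mul (p := 0) (q := 2)); first exact: Nice_cst.
apply: (Nice_mul (p := 2) (q := 0)); first exact: Nice_i2.
apply: Nice_Sm; apply: Sm_mul; first by apply: Sm_exp; exact: Sm_eta.
by apply: Sm_mul; [exact: Sm_sin|exact: Sm_cos].
Qed.

Let is_derive_ang s x : is_derive s 1 (fun t => ang t x) (eta x).
Proof.
have d : is_derive s 1 (fun t : R => t * eta x) (eta x).
  have := @is_deriveM _ _ id (cst (eta x)) s 1 _ _ (is_derive_id _ _) (is_derive_cst _ _ _).
  by rewrite /GRing.scale /= mulr0 add0r mulr1; exact.
have := @is_deriveD R R R (cst alpha) _ s 1 _ _ (is_derive_cst _ _ _) d.
by rewrite add0r; exact.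
Qed.

Let is_derive_sin_ang s x : is_derive s 1 (fun t => sin (ang t x)) (cos (ang s x) * eta x).
Proof. exact: (@is_derive1_comp _ sin _ _ _ _ (is_derive_sin _) (is_derive_ang s x)). Qed.

Let is_derive_cos_ang s x : is_derive s 1 (fun t => cos (ang t x)) (- sin (ang s x) * eta x).
Proof. exact: (@is_derive1_comp _ cos _ _ _ _ (is_derive_cos _) (is_derive_ang s x)). Qed.

Lemma is_derive_psi s x : is_derive s 1 (fun t => psi t x) (psi1 s x).
Proof.
have d1 : is_derive s 1 (fun t : R => t * lap eta x) (lap eta x).
  have := @is_deriveM _ _ id (cst (lap eta x)) s 1 _ _ (is_derive_id _ _) (is_derive_cst _ _ _).
  by rewrite /GRing.scale /= mulr0 add0r mulr1; exact.
have d2 := @is_deriveM _ _ _ _ s 1 _ _ (is_derive_sin_ang s x) (is_derive_cos_ang s x).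
have d3 := @is_deriveZ _ _ _ _ (2 * m%:R * i2 x) s 1 _ d2.
have d4 := @is_deriveB _ _ _ _ _ s 1 _ _ d1 d3.
have -> : (fun t => psi t x) = (fun t : R => t * lap eta x) -
   (2 * m%:R * i2 x) *: ((fun t => sin (ang t x)) * (fun t => cos (ang t x))).
  by apply/funext => t; rewrite /psi !fctE /GRing.scale /= !mulrA.
by apply: (is_derive_eq d4); rewrite /psi1 /GRing.scale /=; ring.
Qed.

Lemma is_derive_psi1 s x : is_derive s 1 (fun t => psi1 t x) (psi2 s x).
Proof.
have d1 := @is_deriveM _ _ _ _ s 1 _ _ (is_derive_sin_ang s x) (is_derive_sin_ang s x).
have d2 := @is_deriveM _ _ _ _ s 1 _ _ (is_derive_cos_ang s x) (is_derive_cos_ang s x).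
have d3 := @is_deriveZ _ _ _ _ (2 * m%:R * i2 x * eta x) s 1 _ (@is_deriveB _ _ _ _ _ s 1 _ _ d2 d1).
have d4 := @is_deriveB R R R (cst (lap eta x)) _ s 1 _ _ (is_derive_cst _ _ _) d3.
have -> : (fun t => psi1 t x) = cst (lap eta x) -
   (2 * m%:R * i2 x * eta x) *: ((fun t => cos (ang t x)) * (fun t => cos (ang t x)) -
      (fun t => sin (ang t x)) * (fun t => sin (ang t x))).
  by apply/funext => t; rewrite /psi1 !fctE /GRing.scale /= !expr2 !mulrA.
by apply: (is_derive_eq d4); rewrite /psi2 /GRing.scale /=; ring.
Qed.

End energy.

(** * Two derivatives of the bienergy under the integral sign *)

Section second_variation.
Context {R : realType} {m : nat}.
Hypothesis m5 : (5 <= m)%N.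
Implicit Types (f g : 'rV[R]_m -> R) (x : 'rV[R]_m) (i j : 'I_m) (s h : R).
Notation mu := (@lebesgue_rV R m).
Notation B := (@uball R m).
Let mB := @measurable_uball R m.

(** The majorant K (1 + r^(-4)) is integrable on the ball and free of s; its constant part also
    covers the origin, where [rinv] is 0. *)
Lemma derive_integral (f df : R -> 'rV[R]_m -> R) (K : R) : 0 <= K ->
  (forall s x, is_derive s 1 (fun t => f t x) (df s x)) ->
  (forall s, Nice 0 4 (f s)) ->
  (forall s x, `|s| < 2 -> B x -> `|df s x| <= K * (1 + rinv x ^+ 4)) ->
  forall s : R, `|s| < 2 ->
    is_derive s 1 (fun t => \int[mu]_(x in B) (f t x)) (\int[mu]_(x in B) (df s x)).
Proof.
move=> K0 dfd nf bdf s s2.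
pose G x : R := K * (1 + rinv x ^+ 4).
have sI : `]-2, 2[%classic s by rewrite /= in_itv /= -ltr_norml.
have intf t : `]-2, 2[%classic t -> mu.-integrable B (EFin \o f t).
  by move=> _; exact: (Nice_integrable m5 (isT : (4 <= 4)%N) (nf t)).
have derf t x : `]-2, 2[%classic t -> B x -> derivable (f ^~ x) t 1.
  by move=> _ _; exact: (@ex_derive _ _ _ _ _ _ _ (dfd t x)).
have G0 x : 0 <= G x by rewrite mulr_ge0// addr_ge0// exprn_ge0// rinv_ge0.
have d1E t x : partial1of2 f t x = df t x.
  by rewrite partial1of2E; exact: (@derive_val _ _ _ _ _ _ _ (dfd t x)).
have intG : mu.-integrable B (EFin \o G).
  rewrite (_ : EFin \o G = fun x => (K%:E * (cst 1%:E x + (rinv x ^+ 4)%:E))%E)//.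
  apply: integrableZl => //; apply: integrableD => //; first exact: (integrable_cst_uball 1).
  exact: integrable_rinv4.
have Gub t x : `]-2, 2[%classic t -> B x -> `|partial1of2 f t x| <= G x.
  by rewrite /= in_itv /= -ltr_norml d1E => t2; exact: bdf.
have H1 := @derivable_under_integral R _ _ mu f B mB s (-2) 2 sI intf derf G G0 intG Gub.
have H2 := @differentiation_under_integral R _ _ mu f B mB s (-2) 2 sI intf derf G G0 intG Gub.
apply: DeriveDef => //; rewrite -derive1E H2.
by apply: eq_Rintegral => x _; exact: d1E.
Qed.

Variable alpha : R.

Lemma psi_bounds : exists2 K : R, 0 <= K & forall s x, `|s| < 2 -> B x ->
  [/\ `|psi alpha s x| <= K * (1 + i2 x), `|psi1 alpha s x| <= K * (1 + i2 x) &
      `|psi2 alpha s x| <= K * (1 + i2 x)].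
Proof.
have [L L0 bL] : exists2 L, 0 <= L & forall x : 'rV[R]_m, enorm x <= 1 -> `|lap eta x| <= L.
  apply: bounded_cball => x; apply: differentiable_continuous; apply: Sm_differentiable.
  by apply: Sm_sum => k; do 2 apply: Sm_partial; exact: Sm_eta.
(* 2 L comes from |s| < 2 in front of Delta eta, and 8 m is the largest coefficient of r^(-2), that
   of [psi2]. *)
exists (2 * L + 8 * m%:R) => [|s x s2 xB]; first by rewrite addr_ge0// mulr_ge0.
have x1 : enorm x <= 1 := ltW xB.
have i0 : 0 <= i2 x by rewrite sqr_ge0.
have e1 := eta_le1 x1; have l1 := bL x x1.
set S := sin (alpha + s * eta x); set C := cos (alpha + s * eta x).
have S1 : `|S| <= 1 by rewrite ler_norml sin_geN1 sin_le1.
have C1 : `|C| <= 1 by rewrite ler_norml cos_geN1 cos_le1.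
have SC : `|S * C| <= 1 by rewrite normrM mulr_ile1.
have CS : `|C ^+ 2 - S ^+ 2| <= 2.
  apply: le_trans (ler_normB _ _) _; rewrite !normrX.
  by have := exprn_ile1 2 (normr_ge0 S) S1; have := exprn_ile1 2 (normr_ge0 C) C1; lra.
have m0 : (0 : R) <= m%:R by [].
have mi0 : 0 <= m%:R * i2 x by rewrite mulr_ge0.
have Li : 0 <= L * i2 x by rewrite mulr_ge0.
have fin (a b c : R) : `|a| <= 2 * L -> `|c| <= 1 -> 0 <= b <= 8 ->
   `|a + b * m%:R * (i2 x * c)| <= (2 * L + 8 * m%:R) * (1 + i2 x).
  move=> ha hc /andP[b0 b8]; apply: le_trans (ler_normD _ _) _.
  have h : `|b * m%:R * (i2 x * c)| <= 8 * (m%:R * i2 x).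
    rewrite (_ : b * m%:R * (i2 x * c) = (b * (m%:R * i2 x)) * c); last by ring.
    have bm : 0 <= b * (m%:R * i2 x) by exact: mulr_ge0.
    rewrite normrM (ger0_norm bm); apply: (@le_trans _ _ (b * (m%:R * i2 x))).
      exact: ler_piMr.
    exact: ler_wpM2r.
  by move: h ha Li mi0 m0; move: (i2 x) (m%:R : R) `|a| (`|b * _ * _|) => I M p q h ha Li mi0 m0; nra.
split.
- rewrite /psi -/S -/C (_ : _ - _ = s * lap eta x + 2 * m%:R * (i2 x * - (S * C))); last by ring.
  apply: fin; rewrite ?normrN//; last by apply/andP; split; lra.
  by rewrite normrM; apply: ler_pM => //; exact: ltW.
- rewrite /psi1 -/S -/C (_ : _ - _ = lap eta x + 4 * m%:R * (i2 x * (- 2^-1 * (eta x * (C ^+ 2 - S ^+ 2))))).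
    apply: fin; [lra| |apply/andP; split; lra].
    rewrite normrM normrN (ger0_norm (_ : 0 <= 2^-1)) ?invr_ge0// mulrC ler_pdivrMr// mul1r normrM.
    by apply: le_trans (_ : 1 * 2 <= _); [apply: ler_pM|lra].
  by move: (i2 x) (eta x) (lap _ _) => a b d; field.
- rewrite /psi2 -/S -/C -[X in `|X|]add0r; apply: fin; last by apply/andP; split; lra.
    by rewrite normr0 mulr_ge0.
  by rewrite normrM mulr_ile1// normrX exprn_ile1.
Qed.

(** The energy is half the integral of psi^2, so E1 is the integral of [psi * psi1], and the product
    rule gives the integrand of the second variation. *)
Lemma is_derive_energy : exists E1 : R -> R,
  (forall s : R, `|s| < 2 -> is_derive s 1 (fun s => bienergy (@Dvar R m alpha 0 s)) (E1 s)) /\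
  is_derive (0 : R) 1 E1 (\int[mu]_(x in B) (psi1 alpha 0 x ^+ 2 + psi alpha 0 x * psi2 alpha 0 x)).
Proof.
have [K K0 HK] := psi_bounds.
have i4 x : (1 + i2 x) * (1 + i2 x) <= 2 * (1 + rinv x ^+ 4).
  have -> : rinv x ^+ 4 = i2 x ^+ 2 by rewrite /i2 -exprM.
  by have := sqr_ge0 (1 - i2 x); move: (i2 x) => a; rewrite !expr2; lra.
have i20 x : 0 <= 1 + i2 x by rewrite addr_ge0// sqr_ge0.
have prod x (a b : R) : `|a| <= K * (1 + i2 x) -> `|b| <= K * (1 + i2 x) ->
    `|a * b| <= 2 * K ^+ 2 * (1 + rinv x ^+ 4).
  move=> ha hb; rewrite normrM; apply: (@le_trans _ _ (K * (1 + i2 x) * (K * (1 + i2 x)))).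
    exact: ler_pM.
  rewrite (_ : _ * _ = K ^+ 2 * ((1 + i2 x) * (1 + i2 x))); last by ring.
  rewrite (_ : 2 * _ * _ = K ^+ 2 * (2 * (1 + rinv x ^+ 4))); last by ring.
  by apply: ler_wpM2l => //; exact: sqr_ge0.
have n1 := @Nice_psi1 R m alpha.
pose f s x := 2^-1 * psi alpha s x ^+ 2.
pose df s x := psi alpha s x * psi1 alpha s x.
pose ddf s x := psi1 alpha s x ^+ 2 + psi alpha s x * psi2 alpha s x.
have df1 s x : is_derive s 1 (fun t => f t x) (df s x).
  have d := @is_deriveZ _ _ _ _ (2^-1) s 1 _ (@is_deriveM _ _ _ _ s 1 _ _ (is_derive_psi alpha s x) (is_derive_psi alpha s x)).
  have -> : (fun t => f t x) = 2^-1 *: ((fun t => psi alpha t x) * (fun t => psi alpha t x)).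
    by apply/funext => t; rewrite /f !fctE /GRing.scale /= expr2.
  by apply: (is_derive_eq d); rewrite /df /GRing.scale /=; field.
have df2 s x : is_derive s 1 (fun t => df t x) (ddf s x).
  have d := @is_deriveM _ _ _ _ s 1 _ _ (is_derive_psi alpha s x) (is_derive_psi1 alpha s x).
  by apply: (is_derive_eq d); rewrite /ddf /GRing.scale /=; ring.
have nf s : Nice 0 4 (f s).
  apply: (Nice_mul (p := 0) (q := 4)); first exact: Nice_cst.
  exact: (Nice_mul (p := 2) (q := 2) (Nice_psi alpha s) (Nice_psi alpha s)).
have ndf s : Nice 0 4 (df s).
  exact: (Nice_mul (p := 2) (q := 2) (Nice_psi alpha s) (n1 s)).
have K2 : 0 <= 4 * K ^+ 2 by rewrite mulr_ge0// sqr_ge0.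
have J0 x : 0 <= K ^+ 2 * (1 + rinv x ^+ 4).
  by rewrite mulr_ge0 ?sqr_ge0// addr_ge0// exprn_ge0// rinv_ge0.
exists (fun s => \int[mu]_(x in B) (df s x)); split.
  move=> s s2.
  have -> : (fun s => bienergy (@Dvar R m alpha 0 s)) = (fun s => \int[mu]_(x in B) (f s x)).
    apply/funext => t; rewrite (bienergy_Dvar m5) -RintegralZl//.
    exact: (Nice_integrable m5 (isT : (2 + 2 <= 4)%N) (Nice_mul (Nice_psi alpha t) (Nice_psi alpha t))).
  apply: (derive_integral K2 df1 nf) => // t x t2 xB.
  have [H1 H2 _] := HK t x t2 xB.
  by apply: le_trans (prod x _ _ H1 H2) _; have := J0 x; rewrite -!mulrA; lra.
have z2 : `|0 : R| < 2 by rewrite normr0.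
apply: (derive_integral K2 df2 ndf) => // t x t2 xB.
have [H1 H2 H3] := HK t x t2 xB.
apply: le_trans (ler_normD _ _) _; rewrite [psi1 _ _ _ ^+ 2]expr2.
by have := prod x _ _ H2 H2; have := prod x _ _ H1 H3; have := J0 x; rewrite -!mulrA; lra.
Qed.

End second_variation.

(** * The sign of the second variation *)

Section instability.
Context {R : realType} {m : nat}.
Hypothesis m5 : (5 <= m)%N.
Hypothesis m12 : (m <= 12)%N.
Variable alpha : R.
Hypothesis sin_alpha : sin alpha ^+ 2 = 1 - 2 / m%:R.
Implicit Types (x : 'rV[R]_m).
Notation mu := (@lebesgue_rV R m).
Notation B := (@uball R m).
Let mB := @measurable_uball R m.

(* With y = 1 - r^2, the second variation is the integral of r^-4 P(y), where
   P = a_12 y^12 + ... + a_16 y^16.  The coefficients c_13, ..., c_16 of S are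
   those for which r^-4 ((m - 4) S + 2 r^2 dS/d(r^2)) agrees with it up to a
   multiple of r^-4 y^16. *)
Let a12 : R := 224 ^+ 2.
Let a13 : R := - 2 * 224 * (448 + 16 * m%:R).
Let a14 : R := (448 + 16 * m%:R) ^+ 2 + 448 * (216 + 18 * m%:R).
Let a15 : R := - 2 * (448 + 16 * m%:R) * (216 + 18 * m%:R).
Let a16 : R := (216 + 18 * m%:R) ^+ 2 - 32 * (m%:R - 2).
Let c13 : R := - a12 / 26.
Let c14 : R := - (a13 - (m%:R + 22) * c13) / 28.
Let c15 : R := - (a14 - (m%:R + 24) * c14) / 30.
Let c16 : R := - (a15 - (m%:R + 26) * c15) / 32.
Let gap : R := (m%:R + 28) * c16 - a16.
Let c (l : nat) : R := nth 0 [:: c13; c14; c15; c16] l.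
Let S (t : R) : R := \sum_(l <- [:: 0; 1; 2; 3]%N) c l * tpow (10 + l).+3 t.
Let dS (t : R) : R := \sum_(l <- [:: 0; 1; 2; 3]%N) c l * (- (10 + l).+3%:R * tpow (10 + l).+2 t).

Let E t : (m%:R - 4) * S t + 2 * t * dS t = (m%:R - 4) * (c13 * tpow 13 t + c14 * tpow 14 t + c15 * tpow 15 t + c16 * tpow 16 t)
  - 2 * t * (c13 * 13 * tpow 12 t + c14 * 14 * tpow 13 t + c15 * 15 * tpow 14 t + c16 * 16 * tpow 15 t).
Proof.
rewrite /S /dS !big_cons !big_nil /c /=.
by move: (tpow 12 t) (tpow 13 t) (tpow 14 t) (tpow 15 t) (tpow 16 t) => *; ring.
Qed.

(** [gap] is a polynomial in m with rational coefficients, evaluated at the eight admissible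
    integers. The margin at m = 12 is narrow: about 37.7, while [a16] is 186304. *)
Lemma gap_gt0 : 0 < gap.
Proof.
have M : m%:R \in [:: 5; 6; 7; 8; 9; 10; 11; 12 : R].
  move: m5 m12; case: m => //; do 4 (case => //); do 8 (case => [_ _|]; first by rewrite !inE eqxx ?orbT).
  by [].
move: M; rewrite /gap /c16 /c15 /c14 /c13 /a12 /a13 /a14 /a15 /a16 !inE.
by do 7 (case/orP => [/eqP->|]; first lra); move=> /eqP ->; lra.
Qed.

(** In powers of y the divergence has coefficients (m - 4 + 2 k) c_k - 2 (k + 1) c_(k+1), with c_12
    = c_17 = 0. Matching degrees 12 to 15 is a triangular system with pivots 26, 28, 30, 32; only
    y^16 is left over. *)
Lemma second_variation_density x : x != 0 -> B x ->
  psi1 alpha 0 x ^+ 2 + psi alpha 0 x * psi2 alpha 0 x =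
  rinv x ^+ 4 * ((m%:R - 4) * S (rho x) + 2 * rho x * dS (rho x))
  - gap * (rinv x ^+ 4 * (1 - rho x) ^+ 16).
Proof.
move=> x0 xB.
have r1 : rho x <= 1 by rewrite -enorm_le1 ltW.
have M0 : m%:R != 0 :> R by rewrite pnatr_eq0 -lt0n (leq_trans _ m5).
have I1 : i2 x * rho x = 1 by rewrite /i2 rinv2 mulVf// gt_eqF// rho_gt0.
have -> : rinv x ^+ 4 = i2 x ^+ 2 by rewrite /i2 -exprM.
have ca : cos alpha ^+ 2 = 2 / m%:R.
  by have := cos2Dsin2 alpha; rewrite sin_alpha; lra.
rewrite E !tpow_lt1// /psi /psi1 /psi2 !mul0r !addr0 !sub0r lap_eta /eta ca sin_alpha.
(* 16 m^2 sin^2 alpha cos^2 alpha = 16 m^2 (1 - 2/m) (2/m) = 32 (m - 2). *)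
have -> : - (2 * m%:R * (i2 x * (sin alpha * cos alpha))) *
    (8 * m%:R * (i2 x * (((1 - rho x) ^+ 8) ^+ 2 * (sin alpha * cos alpha)))) =
    - 32 * (m%:R - 2) * (i2 x ^+ 2 * (1 - rho x) ^+ 16).
  rewrite -exprM (_ : _ * _ = - 16 * m%:R ^+ 2 * (sin alpha ^+ 2 * cos alpha ^+ 2) *
    (i2 x ^+ 2 * (1 - rho x) ^+ 16)); last by ring.
  by congr (_ * _); rewrite ca sin_alpha; field.
move: I1; have -> : rho x = 1 - (1 - rho x) by ring.
move: (i2 x) (1 - rho x) M0 => I y M0 I1.
(* Delta eta carries no factor r^(-2); inserting r^(-2) r^2 = 1 makes both sides r^(-4) times
   polynomials in y. *)
have -> : - 16 * m%:R * (1 - (1 - y)) ^+ 7 + 224 * (1 - y) * (1 - (1 - y)) ^+ 6 =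
    I * ((1 - y) * (- 16 * m%:R * y ^+ 7 + 224 * (1 - y) * y ^+ 6)).
  by rewrite [RHS]mulrA I1 mul1r; ring.
rewrite (_ : 1 - (1 - y) = y); last by ring.
rewrite /gap /c16 /c15 /c14 /c13 /a12 /a13 /a14 /a15 /a16.
by field.
Qed.

Lemma Nice_rinv4 : Nice 0 4 (fun x => rinv x ^+ 4).
Proof.
have := Nice_mul (@Nice_i2 R m 0) (Nice_i2 0).
by apply: Nice_off0 => x _; rewrite /i2 -exprD.
Qed.

(** A nonnegative integrand with integral 0 vanishes almost everywhere, but this one is positive on
    the punctured ball, which is not null. *)
Lemma integral_rinv4_gt0 (k : nat) :
  0 < \int[mu]_(x in B) (rinv x ^+ 4 * (1 - rho x) ^+ k).
Proof.
have nr : Nice 0 0 (fun x => (1 - rho x) ^+ k).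
  by apply: Nice_Sm; apply: Sm_exp; apply: Sm_sub; [exact: Sm_cst|exact: Sm_rho].
have ng : Nice 0 4 (fun x => rinv x ^+ 4 * (1 - rho x) ^+ k).
  apply: (Nice_mul (p := 4) (q := 0)) => //.
  exact: Nice_rinv4.
have g0 x : B x -> 0 <= rinv x ^+ 4 * (1 - rho x) ^+ k.
  move=> xB; rewrite mulr_ge0 ?exprn_ge0 ?rinv_ge0// subr_ge0 -enorm_le1.
  exact: ltW.
have ig := Nice_integrable m5 (isT : (4 <= 4)%N) ng.
rewrite lt_neqAle Rintegral_ge0// andbT eq_sym; apply/negP => /eqP I0.
have J0 : (\int[mu]_(x in B) `|(rinv x ^+ 4 * (1 - rho x) ^+ k)%:E| = 0)%E.
  rewrite -(fineK (integrable_fin_num mB (integrable_abse ig))).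
  rewrite -[RHS]/(0%:E) -I0 /Rintegral; congr (EFin (fine _)).
  by apply: eq_integral => x; rewrite inE => xB; rewrite /= ger0_norm ?g0.
have mg : measurable_fun B (EFin \o (fun x => rinv x ^+ 4 * (1 - rho x) ^+ k)).
  by apply/measurable_EFinP; exact: Nice_measurable ng.
have H1 := (@ae_eq_integral_abs _ _ _ mu B mB _ mg).1 J0.
have [N [mN N0 sN]] : {ae mu, forall x, ~ B x}.
  apply: filterS2 (ae_neq0 m5) H1 => x x0 Hx xB; have := Hx xB.
  rewrite /= => -[] /eqP; apply/negP; rewrite gt_eqF// mulr_gt0// exprn_gt0 ?rinv_gt0//.
  by rewrite subr_gt0 -sqr_enorm expr_lt1 ?enorm_ge0.
have := @mu_uball_gt0 R m; apply/negP; rewrite -leNgt -N0.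
by apply: le_measure; rewrite ?inE// => x xB; apply: sN => /=; apply.
Qed.

Lemma second_variation_lt0 :
  \int[mu]_(x in B) (psi1 alpha 0 x ^+ 2 + psi alpha 0 x * psi2 alpha 0 x) < 0.
Proof.
pose F x := rinv x ^+ 4 * ((m%:R - 4) * S (rho x) + 2 * rho x * dS (rho x)).
pose g x : R := rinv x ^+ 4 * (1 - rho x) ^+ 16.
have nF : Nice 0 4 F := Nice_divergence_rfield _ _ _.
have ng : Nice 0 4 g.
  apply: (Nice_mul (p := 4) (q := 0)).
    exact: Nice_rinv4.
  by apply: Nice_Sm; apply: Sm_exp; apply: Sm_sub; [exact: Sm_cst|exact: Sm_rho].
have iF := Nice_integrable m5 (isT : (4 <= 4)%N) nF.
have ig := Nice_integrable m5 (isT : (4 <= 4)%N) ng.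
have ngg : Nice 0 4 (fun x => gap * g x) by apply: (Nice_mul (p := 0) (q := 4)) => //; exact: Nice_cst.
rewrite /Rintegral (eq_integral_off0 m5 (g := fun x => F x - gap * g x)).
- rewrite -/(Rintegral _ _ _) RintegralB//; last exact: (Nice_integrable m5 (isT : (4 <= 4)%N) ngg).
  rewrite RintegralZl// {1}/Rintegral integral_sum_partial_rfield// sub0r oppr_lt0.
  by rewrite mulr_gt0// ?gap_gt0// integral_rinv4_gt0.
- apply: (Nice_measurable (n := 0) (p := 4)); apply: Nice_add.
    exact: (Nice_mul (p := 2) (q := 2) (Nice_psi1 alpha 0) (Nice_psi1 alpha 0)).
  exact: (Nice_mul (p := 2) (q := 2) (Nice_psi alpha 0) (Nice_psi2 alpha 0)).
- exact: Nice_measurable (Nice_sub nF ngg).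
- exact: second_variation_density.
Qed.

Lemma unstable_utilde : unstable (@utilde R m alpha).
Proof.
exists 1, (Dvar alpha 0); split => //.
- by move=> s _; split; [exact: sobolev_sphere_Dvar0|exact: same_boundary_data_Dvar].
- exact: smooth_curve_Dvar.
- exact: Dvar00.
have [E1 [dE dE1]] := is_derive_energy m5 alpha.
set En := fun s => bienergy _.
have near2 : \forall s \near (0 : R), `|s| < 2.
  by apply: (@nbhs0_lt _ R^o).
(* Agreement near 0 suffices, since the second derivative at 0 depends only on the germ of the
   first. *)
have E1E : \forall s \near (0 : R), derive1 En s = E1 s.
  apply: filterS near2 => s s2; rewrite derive1E.
  exact: (@derive_val _ _ _ _ _ _ _ (dE s s2)).
have EE : \forall s \near (0 : R), E1 s = derive1 En s by apply: filterS E1E => s ->.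
have d2 := near_eq_is_derive EE dE1.
split.
- by apply: filterS near2 => s /dE [].
- by case: d2.
- by rewrite derive1Sn derive1n1 derive1E (@derive_val _ _ _ _ _ _ _ d2); exact: second_variation_lt0.
Qed.

End instability.

Theorem theorem1p3 (R : realType) (m : nat) (hm : (5 <= m <= 12)%N)
    (alpha : R) (halpha : 0 < alpha < pi / 2)
    (hsin : sin alpha ^+ 2 = 1 - 2 / m%:R) :
  proper_weak_biharmonic (@utilde R m alpha) /\ unstable (@utilde R m alpha).
Proof.
have /andP[m5 m12] := hm.
by split; [exact: proper_weak_biharmonic_utilde|exact: unstable_utilde].
Qed.
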